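(* Let $0<\alpha<1$ and let $X:\mathbb{R}^N\to\mathbb{R}^d$ be index-$\alpha$ fractional Brownian motion. Let $\mu$ be a Borel probability measure on $\mathbb{R}^N$ with compact support. Then for all $q>1$, $$\underline{D}_q(\mu_X)=\min\Big\{d,\ \frac1\alpha\,\underline{D}_q(\mu)\Big\}\quad\text{a.s.},$$ and, if the generalized $q$-dimension $D_q(\mu)$ exists, then $D_q(\mu_X)$ exists a.s. and $$D_q(\mu_X)=\min\Big\{d,\ \frac1\alpha\,D_q(\mu)\Big\}\quad\text{a.s.}$$
   Context: Index-$\alpha$ fractional Brownian motion $X=(X_1,\dots,X_d):\mathbb{R}^N\to\mathbb{R}^d$ has components $X_1,\dots,X_d$ that are independent copies of the real-valued centered Gaussian random field $B^\alpha:\mathbb{R}^N\to\mathbb{R}$ with covariance $$\mathsf{E}\big(B^\alpha(x)B^\alpha(y)\big)=\tfrac12\big(|x|^{2\alpha}+|y|^{2\alpha}-|x-y|^{2\alpha}\big),\quad x,y\in\mathbb{R}^N;$$ $X$ is taken with continuous sample paths. For a nonzero finite Borel measure $\nu$ of bounded support on $\mathbb{R}^n$ and $r>0$, let $\mathcal{M}_r$ be the family of $r$-mesh cubes $[i_1r,(i_1+1)r)\times\cdots\times[i_nr,(i_n+1)r)$, $i_1,\dots,i_n\in\mathbb{Z}$, and let $M_r(q)=\sum_{C\in\mathcal{M}_r}\nu(C)^q$. For $q>0$, $q\ne1$, $$\underline{D}_q(\nu)=\liminf_{r\to0}\frac{\log M_r(q)}{(q-1)\log r},\qquad \overline{D}_q(\nu)=\limsup_{r\to0}\frac{\log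 M_r(q)}{(q-1)\log r}.$$ If these are equal, the common value $D_q(\nu)$ is called the generalized $q$-dimension, and it is said to exist. $\mu_X$ is the random Borel measure on $\mathbb{R}^d$ given by $\mu_X(A)=\mu\{x: X(x)\in A\}$ for Borel $A\subseteq\mathbb{R}^d$. *)

(* Defs.v *)
From HB Require Import structures.
From mathcomp Require Import all_boot all_order all_algebra.
From mathcomp Require Import all_classical all_reals all_analysis.

Set Implicit Arguments.
Unset Strict Implicit.
Unset Printing Implicit Defensive.

Import Order.TTheory GRing.Theory Num.Theory.
Import numFieldNormedType.Exports.

Local Open Scope classical_set_scope.
Local Open Scope ring_scope.

(* R^n with its Borel sigma-algebra; the carrier is convertible to 'rV[R]_n. *)
Notation borel_rV R n := (g_sigma_algebraType (@open 'rV[R]_n)).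

(* The library norm on 'rV[R]_n is the sup norm. *)
Definition euclidean_norm (R : realType) (n : nat) (x : 'rV[R]_n) : R :=
  Num.sqrt (\sum_(j < n) x 0 j ^+ 2).

(* normal_prob m 0 is a junk value in the library, whereas a Gaussian variable
   of variance 0 is almost surely constant. *)
Definition gaussian_law (R : realType) (m s : R) (A : set R) : \bar R :=
  if s == 0 then \d_m A else normal_prob m s A.

Definition gaussian_variable (disp : measure_display)
    (T : measurableType disp) (R : realType) (P : probability T R)
    (Y : T -> R) : Prop :=
  measurable_fun setT Y /\
  exists m s : R, 0 <= s /\
    forall A : set R, measurable A -> P (Y @^-1` A) = gaussian_law m s A.

(* All finite-dimensional distributions are (possibly degenerate) multivariate
   normal, i.e. all finite linear combinations are univariate normal. *)
Definition gaussian_field (disp : measure_display)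
    (T : measurableType disp) (R : realType) (P : probability T R)
    (I : Type) (B : T -> I -> R) : Prop :=
  forall (k : nat) (t : 'I_k -> I) (c : 'I_k -> R),
    gaussian_variable P (fun w => \sum_(j < k) c j * B w (t j)).

Definition sigma_of_field (disp : measure_display)
    (T : measurableType disp) (R : realType) (I : Type) (B : T -> I -> R) :
    set (set T) :=
  <<s \bigcup_t preimage_set_system setT (fun w => B w t) measurable >>.

Definition independent_fields (disp : measure_display)
    (T : measurableType disp) (R : realType) (P : probability T R)
    (d : nat) (I : Type) (B : 'I_d -> T -> I -> R) : Prop :=
  forall (J : {set 'I_d}) (A : 'I_d -> set T),
    (forall i, i \in J -> sigma_of_field (B i) (A i)) ->
    P (\bigcap_(i in [set` J]) A i) = (\prod_(i in J) P (A i))%E.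

Definition real_fbm (disp : measure_display)
    (T : measurableType disp) (R : realType) (P : probability T R)
    (N : nat) (alpha : R) (B : T -> 'rV[R]_N -> R) : Prop :=
  [/\ gaussian_field P B,
      forall x, ('E_P[fun w => B w x] = 0)%E &
      forall x y, 'E_P[fun w => (B w x * B w y)%R]%E =
        (2^-1 * (euclidean_norm x `^ (2 * alpha)
               + euclidean_norm y `^ (2 * alpha)
               - euclidean_norm (x - y) `^ (2 * alpha)))%:E].

Definition fbm (disp : measure_display)
    (T : measurableType disp) (R : realType) (P : probability T R)
    (N d : nat) (alpha : R) (X : T -> 'rV[R]_N -> 'rV[R]_d) : Prop :=
  [/\ forall i, real_fbm P alpha (fun w x => X w x 0 i),
      independent_fields P (fun i w x => X w x 0 i) &
      forall w, continuous (X w)].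

Definition mesh_cube (R : realType) (n : nat) (r : R) (i : 'rV[int]_n) :
    set 'rV[R]_n :=
  [set x | forall j, (i 0 j)%:~R * r <= x 0 j < (i 0 j + 1)%:~R * r].

Definition mesh_moment (R : realType) (n : nat)
    (nu : set (borel_rV R n) -> \bar R) (q r : R) : \bar R :=
  (\esum_(i in [set: 'rV[int]_n]) (nu (mesh_cube r i) `^ q))%E.

Definition moment_ratio (R : realType) (n : nat)
    (nu : set (borel_rV R n) -> \bar R) (q r : R) : \bar R :=
  (lne (mesh_moment nu q r) * (((q - 1) * ln r)^-1)%:E)%E.

Definition lower_gdim (R : realType) (n : nat) (q : R)
    (nu : set (borel_rV R n) -> \bar R) : \bar R :=
  limf_einf (moment_ratio nu q) 0^'+.

Definition upper_gdim (R : realType) (n : nat) (q : R)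
    (nu : set (borel_rV R n) -> \bar R) : \bar R :=
  limf_esup (moment_ratio nu q) 0^'+.

Definition gdim_exists (R : realType) (n : nat) (q : R)
    (nu : set (borel_rV R n) -> \bar R) : Prop :=
  lower_gdim q nu = upper_gdim q nu.

(* Only meaningful under gdim_exists, where it is the common value. *)
Definition gdim (R : realType) (n : nat) (q : R)
    (nu : set (borel_rV R n) -> \bar R) : \bar R :=
  lower_gdim q nu.

Definition msupport (R : realType) (n : nat)
    (nu : set (borel_rV R n) -> \bar R) : set 'rV[R]_n :=
  [set x | forall U : set 'rV[R]_n, open U -> U x -> (0 < nu U)%E].

Definition image_measure (R : realType) (N d : nat)
    (mu : set (borel_rV R N) -> \bar R) (f : 'rV[R]_N -> 'rV[R]_d) :
    set (borel_rV R d) -> \bar R :=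
  pushforward mu (f : borel_rV R N -> borel_rV R d).

(* Main.v *)
(* Let nu be the image of mu under X, and write M_r(mu), M_r(nu) for the q-th
   mesh moments. Lower and upper dimensions can be read off along geometric
   sequences of mesh sizes.

   Upper bounds. For beta < alpha the increments of X on a cube of side
   rho = 2^-m exceed rho^beta with small probability, so the expectation of the
   sum over the cubes C of mu{x in C : |X(x) - X(x_C)| > rho^beta}^q is a small
   multiple of M_rho(mu). By Borel-Cantelli, M_rho(mu) <= C M_(rho^beta)(nu)
   eventually, almost surely. Only moments of the increments enter, no Hoelder
   continuity. The bound by d holds for every measure, by the power mean
   inequality.

   Lower bound. Pitt's strong local nondeterminism bounds the probability that
   X(y_1), ..., X(y_n) all lie within r of X(x) by a constant times the product
   of the factors (1 + delta_i^(2 alpha) / r^2)^(-d/2), where delta_i is the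
   distance of y_i to the earlier points. Nondeterminism is proved by writing
   |z|^(2 alpha) as a mixture of mean squared increments of a tent function in
   random directions, which makes the variance a mixture of squares that can be
   bounded below near the isolated point. The small ball estimate then follows
   by eliminating the variables of a Gaussian vector one at a time.

   For non-integer q > 1 the q-th moments are reached by a weight: with
   psi(y) = 1 + sum_k (2^(k alpha t) mu(Q_k(y)))^(q-1), where Q_k(y) is the dyadic
   cube of side 2^-k around y, and theta = psi^(-1/(q-1)), the integral of psi
   is bounded when t < lower_gdim mu / alpha, the measure theta mu is uniformly
   alpha t-dimensional at every scale, and
   nu(C)^q <= 2^q (int_(X in C) psi dmu) (int_(X in C) theta dmu)^(q-1).
   Since integer moments of the theta mu-mass near X(x) are controlled by the
   small ball estimate, E M_r(nu) <= C r^(t (q-1)). *)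

Require Import Defs.
From HB Require Import structures.
From mathcomp Require Import all_boot all_order all_algebra.
From mathcomp Require Import all_classical all_reals all_analysis.
From mathcomp Require Import measurable_realfun ring lra.
Import Order.TTheory GRing.Theory Num.Theory.
Import numFieldNormedType.Exports.
Local Open Scope classical_set_scope.
Local Open Scope ring_scope.

Set Implicit Arguments.
Unset Strict Implicit.
Unset Printing Implicit Defensive.

(** * Gaussian integrals *)

(** Gaussianity is given through linear combinations only, so Gaussian vectors are handled through
    the means of cosines of their linear combinations; no joint density is formed and no covariance
    matrix is inverted. The indicator of [|U| <= 1] is dominated by [expR ((1 - U ^+ 2) / 2)], and
    [expR (- U ^+ 2 / 2)] is itself a Gaussian average of cosines of [U]. Removing one variable
    therefore costs one scalar Gaussian integral and a rank-one change of the covariance form, and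
    semidefinite forms need no separate treatment. Each estimate is proved with a small loss in the
    exponent: a strict gap between two exponents becomes the ratio of a convergent geometric series.
    Exponents then tend to their limits along a sequence, so that countably many null sets are
    discarded. The weight [psi] collects the scales [k < m] only, which makes it bounded, and
    [theta] bounded away from 0. Nothing is lost at mesh size [2^(- alpha m)]: below distance [2^-m]
    the small ball factor is simply bounded by 1. *)

Lemma measurable_addr {R : realType} (a : R) :
  measurable_fun [set: R] (fun x : R => x + a).
Proof. exact: measurable_funD. Qed.

Lemma ge0_integral_translate {R : realType} (f : R -> \bar R) (a : R) :
  measurable_fun [set: R] f -> (forall x, 0 <= f x)%E ->
  (\int[@lebesgue_measure R]_x f ((x : R) + a)%R = \int[lebesgue_measure]_x f x)%E.
Proof.
move=> mf f0.
have mD : measurable_fun [set: measurableTypeR R]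
    (fun x : measurableTypeR R => (x + a : measurableTypeR R)).
  exact: measurable_addr.
pose phi : {mfun measurableTypeR R >-> measurableTypeR R} :=
  HB.pack (fun x : measurableTypeR R => x + a : measurableTypeR R)
   (isMeasurableFun.Build _ _ _ _ _ mD).
have lamE (A : set R) : measurable A ->
    pushforward (@lebesgue_measure R) phi A = lebesgue_measure A.
  move=> mA; apply/esym/lebesgue_measure_unique => //= _ [[c d]] _ <-.
  rewrite /pushforward.
  have -> : (phi @^-1` [set` `]c, d]]) = [set` `]c - a, d - a]].
    by apply/seteqP; split => x /=; rewrite !in_itv/= ltrBlDr lerBrDr.
  rewrite !lebesgue_measure_itv/= !lte_fin ltrD2r; case: ifP => // _.
  by rewrite -EFinB; congr EFin; ring.
transitivity (\int[pushforward lebesgue_measure phi]_x f x)%E.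
  by rewrite (ge0_integral_pushforward mD).
by apply: eq_measure_integral => A mA _; exact: lamE.
Qed.

Import HBNNSimple.

Lemma ge0_integral_density d {T : measurableType d} {R : realType}
    (m : {measure set T -> \bar R}) (nu : {measure set T -> \bar R}) (p : T -> R) (f : T -> \bar R) :
  measurable_fun [set: T] p -> (forall x, 0 <= p x) ->
  (forall A, measurable A -> nu A = \int[m]_(x in A) (p x)%:E)%E ->
  measurable_fun [set: T] f -> (forall x, 0 <= f x)%E ->
  (\int[nu]_x f x = \int[m]_x (f x * (p x)%:E))%E.
Proof.
move=> mp p0 nuE mf f0.
pose h := nnsfun_approx measurableT mf.
have cvgh x : (EFin \o h ^~ x) n @[n --> \oo] --> f x.
  by apply: cvg_nnsfun_approx.
have hnd x : {homo (fun n => (h n x)%:E) : n m / (n <= m)%N >-> (n <= m)%E}.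
  by move=> a b ab; rewrite lee_fin; exact/lefP/nd_nnsfun_approx.
have -> : (\int[nu]_x f x = limn (fun n => \int[nu]_x (h n x)%:E))%E.
  rewrite -monotone_convergence //; first last.
  - by move=> n x _; rewrite lee_fin.
  - by move=> n; exact/measurable_EFinP.
  - by apply: eq_integral => x _; apply/esym/cvg_lim => //; exact: cvgh.
have -> : (\int[m]_x (f x * (p x)%:E) =
    limn (fun n => \int[m]_x ((h n x)%:E * (p x)%:E)))%E.
  rewrite -monotone_convergence //; first last.
  - by move=> x _ a b ab; rewrite lee_wpmul2r ?lee_fin//; exact: hnd.
  - by move=> n x _; rewrite -EFinM lee_fin mulr_ge0.
  - by move=> n; apply/measurable_EFinP/measurable_funM.
  - apply: eq_integral => x _; apply/esym/cvg_lim => //.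
    apply: cvgeZr => //; exact: cvgh.
apply: congr_lim; apply/funext => n.
under eq_integral do rewrite fimfunE -fsumEFin//.
rewrite ge0_integral_fsum//; last 2 first.
- by move=> y; exact/measurable_EFinP/measurable_funM.
- by move=> y x _; rewrite nnfun_muleindic_ge0.
under [RHS]eq_integral.
  move=> x _.
  rewrite fimfunE -fsumEFin// ge0_mule_fsuml; last first.
    by move=> y; rewrite nnfun_muleindic_ge0.
  over.
rewrite ge0_integral_fsum//; last 2 first.
- move=> y; apply: emeasurable_funM; last exact/measurable_EFinP.
  exact/measurable_EFinP/measurable_funM.
- by move=> y x _; rewrite mule_ge0 ?lee_fin// -lee_fin EFinM nnfun_muleindic_ge0.
apply: eq_fsbigr => r rh; rewrite integralZl_indic_nnsfun// integral_indic// setIT.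
have r0 : (0 <= r)%R by move: rh; rewrite inE => -[x _ <-].
rewrite nuE// integral_mkcond.
under [RHS]eq_integral do rewrite EFinM -muleA.
rewrite ge0_integralZl//; last 2 first.
- by apply: emeasurable_funM; [exact/measurable_EFinP|exact/measurable_EFinP].
- by move=> x _; rewrite mule_ge0// lee_fin.
- congr (_ * _)%E; apply: eq_integral => x _.
  by rewrite epatch_indic muleC.
Qed.

Lemma continuous_measurable_EFin {R : realType} (f : R -> R) :
  continuous f -> measurable_fun [set: R] (fun x => (f x)%:E).
Proof.
by move=> cf; apply/measurable_EFinP; apply: continuous_measurable_fun.
Qed.

Lemma ge0_integral_normal {R : realType} (m s : R) (f : R -> \bar R) :
  measurable_fun [set: R] f -> (forall x, 0 <= f x)%E ->
  (\int[normal_prob m s]_x f x =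
   \int[@lebesgue_measure R]_x (f x * (normal_pdf m s x)%:E))%E.
Proof.
move=> mf f0.
apply: (@ge0_integral_density _ (measurableTypeR R) R lebesgue_measure (normal_prob m s)) => //.
- exact: measurable_normal_pdf.
- exact: normal_pdf_ge0.
Qed.

Lemma ge0_integral_normal_affine {R : realType} (m s : R) (f : R -> R) :
  0 < s -> continuous f -> (forall x, 0 <= f x) ->
  (\int[normal_prob m s]_x (f x)%:E =
   \int[normal_prob 0 1]_x (f (m + s * (x : R)))%:E)%E.
Proof.
move=> s0 cf f0.
have F'E : (fun x : R => m + s * x)^`()%classic = cst s.
  apply/funext => x; rewrite derive1E deriveD// derive_cst add0r deriveM//.
  by rewrite derive_id derive_cst scaler0 addr0 scaler1.
have cF : continuous (fun x : R => m + s * x).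
  by move=> x; apply: cvgD; [exact: cvg_cst|apply: cvgM; [exact: cvg_cst|exact: cvg_id]].
rewrite ge0_integral_normal; last 2 first.
- exact: continuous_measurable_EFin.
- by move=> x; rewrite lee_fin.
rewrite ge0_integral_normal; last 2 first.
- apply: continuous_measurable_EFin => x.
  exact: continuous_comp (cF x) (cf _).
- by move=> x; rewrite lee_fin.
under eq_integral do rewrite -EFinM.
rewrite (@increasing_ge0_integration_by_substitutionT R (fun x : R => m + s * x)
  (fun x => f x * normal_pdf m s x)).
- apply: eq_integral => x _; rewrite F'E -EFinM /= !fctE/= -mulrA; congr (EFin (_ * _)).
  rewrite !normal_pdfE ?oner_neq0 ?gt_eqF// mulrAC; congr (_ * _).
    rewrite /normal_peak expr1n mul1r -mulrnAr sqrtrM ?sqr_ge0// sqrtr_sqr gtr0_norm//.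
    by rewrite invfM mulrAC mulVf ?gt_eqF// mul1r.
  rewrite /normal_fun; congr expR; field; rewrite gt_eqF//.
- by move=> x y xy; rewrite ltrD2l ltr_pM2l.
- by rewrite F'E => x; exact: cvg_cst.
- by rewrite F'E; exact: is_cvg_cst.
- by rewrite F'E; exact: is_cvg_cst.
- by move=> x; apply: derivableD => //; apply: derivableM.
- apply: (@cvg_comp _ _ _ (fun x : R => s * x) (fun x => m + x) _ -oo).
    by apply: gt0_cvgMrNy => //; exact: cvg_id.
  exact: cvg_addrl_Ny.
- apply: (@cvg_comp _ _ _ (fun x : R => s * x) (fun x => m + x) _ +oo).
    by apply: gt0_cvgMry => //; exact: cvg_id.
  exact: cvg_addrl.
- move=> x; apply: cvgM; first exact: cf.
  by apply: continuous_normal_pdf; rewrite gt_eqF.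
- by move=> x; rewrite mulr_ge0// normal_pdf_ge0.
Qed.

(** Completing the square: against the standard density the integrand is a multiple of the normal
    density of mean [- B / (1 + C)] and variance [1 / (1 + C)], and [-1 < C] is what makes this
    variance positive. *)
Lemma integral_gaussian_quadratic {R : realType} (A B C : R) : -1 < C ->
  (\int[normal_prob 0 1]_x (expR (- (A + 2 * B * (x : R) + C * x ^+ 2) / 2))%:E =
   ((Num.sqrt (1 + C))^-1 * expR (- (A - B ^+ 2 / (1 + C)) / 2))%:E)%E.
Proof.
move=> C1.
have C0 : 0 < 1 + C by lra.
set s := (Num.sqrt (1 + C))^-1.
have s0 : 0 < s by rewrite invr_gt0 sqrtr_gt0.
have s2 : s ^+ 2 = (1 + C)^-1 by rewrite /s exprVn sqr_sqrtr// ltW.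
have cE : continuous (fun x : R => expR (- (A + 2 * B * x + C * x ^+ 2) / 2)).
  move=> x; apply: (cvg_comp _ expR); last exact: continuous_expR.
  apply: cvgM; last exact: cvg_cst.
  apply: (@cvgN _ R^o); apply: (@cvgD _ R^o).
    apply: (@cvgD _ R^o); first exact: cvg_cst.
    by apply: cvgM; [exact: cvg_cst|exact: cvg_id].
  by apply: cvgM; [exact: cvg_cst|exact: sqr_continuous].
rewrite ge0_integral_normal; last 2 first.
- exact: continuous_measurable_EFin.
- by move=> x; rewrite lee_fin expR_ge0.
transitivity (\int[lebesgue_measure]_x ((s * expR (- (A - B ^+ 2 / (1 + C)) / 2))%:E *
     (normal_pdf (- B / (1 + C)) s x)%:E))%E.
  apply: eq_integral => x _; rewrite -!EFinM; congr EFin.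
  rewrite !normal_pdfE ?oner_neq0 ?gt_eqF//.
  have -> : normal_peak 1 = s * normal_peak s.
    rewrite /normal_peak expr1n mul1r -mulrnAr sqrtrM ?sqr_ge0// sqrtr_sqr gtr0_norm//.
    by rewrite invfM mulrA divff ?gt_eqF// mul1r.
  rewrite [LHS]mulrCA -!mulrA; congr (_ * _); rewrite [RHS]mulrCA; congr (_ * _).
  rewrite /normal_fun -!expRD; congr expR; rewrite s2.
  by field; rewrite gt_eqF.
rewrite ge0_integralZl_EFin//; first last.
- by rewrite mulr_ge0 ?expR_ge0// ltW.
- by apply/measurable_EFinP; exact: measurable_normal_pdf.
- by move=> x _; rewrite lee_fin normal_pdf_ge0.
by rewrite integral_normal_pdf mule1.
Qed.

Lemma ge0_integral_lebesgueN {R : realType} (f : R -> \bar R) :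
  measurable_fun [set: R] f -> (forall x, 0 <= f x)%E ->
  (\int[@lebesgue_measure R]_x f (- (x : R))%R = \int[@lebesgue_measure R]_x f x)%E.
Proof.
move=> mf f0.
have mN : measurable_fun [set: measurableTypeR R] (-%R : _ -> measurableTypeR R).
  exact: measurable_funN.
transitivity (\int[pushforward lebesgue_measure (-%R : measurableTypeR R -> measurableTypeR R)]_x f x)%E.
  by rewrite (ge0_integral_pushforward mN).
by apply: eq_measure_integral => A mA _; exact: lebesgue_measureN.
Qed.

Lemma ge0_integral_gaussN {R : realType} (f : R -> \bar R) :
  measurable_fun [set: R] f -> (forall x, 0 <= f x)%E ->
  (\int[normal_prob 0 1]_x f (- (x : R))%R = \int[@normal_prob R 0 1]_x f x)%E.
Proof.
move=> mf f0.
have mg : measurable_fun [set: R] (fun x : R => f (- x)).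
  by apply: (measurableT_comp mf); exact: measurable_funN.
rewrite !ge0_integral_normal// -[RHS]ge0_integral_lebesgueN; last 2 first.
- apply: emeasurable_funM => //; apply/measurable_EFinP.
  exact: measurable_normal_pdf.
- by move=> x; rewrite mule_ge0// lee_fin normal_pdf_ge0.
apply: eq_integral => x _; congr (_ * EFin _)%E.
by rewrite !normal_pdfE ?oner_neq0// /normal_fun !subr0 sqrrN.
Qed.

Lemma ge0_integral_gauss_scale {R : realType} (f : R -> R) (a : R) :
  continuous f -> (forall x, 0 <= f x) ->
  (\int[normal_prob 0 1]_x (f (a * (x : R)))%:E =
   \int[normal_prob 0 1]_x (f (`|a| * (x : R)))%:E)%E.
Proof.
move=> cf f0; have [a0|a0] := ger0P a => //.
rewrite -(@ge0_integral_gaussN _ (fun x : R => (f (a * x))%:E)).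
- by apply: eq_integral => x _; rewrite mulrN mulNr.
- apply: continuous_measurable_EFin => x.
  by apply: continuous_comp (cf _); apply: cvgM; [exact: cvg_cst|exact: cvg_id].
- by move=> x; rewrite lee_fin.
Qed.

Lemma normal_peak_gt0E {R : realType} (s : R) : 0 < s -> normal_peak s = s^-1 * normal_peak 1.
Proof.
move=> s0; rewrite /normal_peak expr1n mul1r -mulrnAr sqrtrM ?sqr_ge0// sqrtr_sqr.
by rewrite gtr0_norm// invfM.
Qed.

(** The inner integral is written with the normal density centred at [a * u]; after exchanging the
    integrals, the one over [u] is a Gaussian integral of a quadratic exponential. *)
Lemma gaussian_convolution {R : realType} (f : R -> R) (a b : R) :
  continuous f -> (forall x, 0 <= f x) -> 0 <= b ->
  (\int[normal_prob 0 1]_u \int[normal_prob 0 1]_v (f (a * (u : R) + b * (v : R)))%:E =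
   \int[normal_prob 0 1]_w (f (Num.sqrt (a ^+ 2 + b ^+ 2) * (w : R)))%:E)%E.
Proof.
(* The case [b = 0] is apart: the inner law then has no density. *)
move=> cf f0; rewrite le_eqVlt => /predU1P[<-|b0].
  rewrite expr0n addr0 sqrtr_sqr -ge0_integral_gauss_scale//.
  apply: eq_integral => u _; under eq_integral do rewrite mul0r addr0.
  by rewrite integral_cst//= probability_setT mule1.
set S := Num.sqrt _.
have S0 : 0 < S by rewrite sqrtr_gt0 ltr_wpDl ?sqr_ge0// exprn_gt0.
have S2 : S ^+ 2 = a ^+ 2 + b ^+ 2 by rewrite sqr_sqrtr// addr_ge0 ?sqr_ge0.
have mf : measurable_fun [set: R] f by exact: continuous_measurable_fun.
transitivity (\int[normal_prob 0 1]_u \int[@lebesgue_measure R]_z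
    ((f z)%:E * (normal_pdf (a * (u : R)) b z)%:E))%E.
  apply: eq_integral => u _.
  rewrite -(@ge0_integral_normal_affine _ (a * u) b)// ge0_integral_normal//.
  exact/measurable_EFinP.
rewrite (@fubini_tonelli _ _ (measurableTypeR R) (measurableTypeR R) _ (normal_prob 0 1) lebesgue_measure
  (fun uz => (f uz.2)%:E * (normal_pdf (a * (uz.1 : R)) b uz.2)%:E)%E)/=; last 2 first.
- apply/measurable_EFinP; apply: measurable_funM.
    exact: (measurableT_comp mf).
  rewrite (_ : (fun x : R * R => _) = (fun x => normal_peak b * expR (- (x.2 - a * x.1) ^+ 2 / (b ^+ 2 *+ 2)))); last first.
    by apply/funext => x; rewrite normal_pdfE ?gt_eqF.
  apply: measurable_funM => //; apply: measurableT_comp => //.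
  apply: measurable_funM => //; apply: measurableT_comp => //.
  apply: measurable_funX => //; apply: measurable_funB => //.
  exact: measurable_funM.
- by move=> x; rewrite -EFinM lee_fin mulr_ge0// normal_pdf_ge0.
transitivity (\int[normal_prob 0 S]_x (f x)%:E)%E; last first.
  rewrite ge0_integral_normal_affine//.
  by apply: eq_integral => w _; rewrite add0r.
rewrite [RHS]ge0_integral_normal//; last exact/measurable_EFinP.
apply: eq_integral => z _.
rewrite ge0_integralZl_EFin//; first last.
- apply/measurable_EFinP; rewrite (_ : (fun u : R => _) =
      (fun u => normal_peak b * expR (- (z - a * u) ^+ 2 / (b ^+ 2 *+ 2)))).
    apply: measurable_funM => //; apply: measurableT_comp => //.
    apply: measurable_funM => //; apply: measurableT_comp => //.
    by apply: measurable_funX => //; apply: measurable_funB.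
  by apply/funext => x; rewrite normal_pdfE ?gt_eqF.
- by move=> x _; rewrite lee_fin normal_pdf_ge0.
congr (_ * _)%E.
transitivity ((normal_peak b)%:E * \int[normal_prob 0 1]_x (expR (- (z ^+ 2 / b ^+ 2 +
    2 * (- (a * z / b ^+ 2)) * (x : R) + (a ^+ 2 / b ^+ 2) * x ^+ 2) / 2))%:E)%E.
  rewrite -ge0_integralZl_EFin//; first last.
  - exact: normal_peak_ge0.
  - apply: continuous_measurable_EFin => x.
    apply: (cvg_comp _ expR); last exact: continuous_expR.
    apply: cvgM; last exact: cvg_cst.
    apply: (@cvgN _ R^o); apply: (@cvgD _ R^o).
      apply: (@cvgD _ R^o); first exact: cvg_cst.
      by apply: cvgM; [exact: cvg_cst|exact: cvg_id].
    by apply: cvgM; [exact: cvg_cst|exact: sqr_continuous].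
  apply: eq_integral => x _; rewrite normal_pdfE ?gt_eqF// /normal_fun -EFinM.
  by congr (EFin (_ * expR _)); field; rewrite gt_eqF.
rewrite integral_gaussian_quadratic; last first.
  by rewrite (@lt_le_trans _ _ 0)// divr_ge0// sqr_ge0.
rewrite -EFinM normal_pdfE ?gt_eqF// /normal_fun; congr EFin; rewrite mulrA; congr (_ * expR _).
  rewrite (normal_peak_gt0E b0) (normal_peak_gt0E S0) mulrAC; congr (_ * _).
  have -> : 1 + a ^+ 2 / b ^+ 2 = S ^+ 2 / b ^+ 2.
    by rewrite S2; field; rewrite gt_eqF.
  rewrite sqrtrM ?sqr_ge0// sqrtr_sqr -exprVn sqrtr_sqr !gtr0_norm ?invr_gt0//.
  by field; rewrite !gt_eqF.
rewrite S2; field; rewrite !gt_eqF//=.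
by rewrite ltr_wpDl ?sqr_ge0// exprn_gt0.
Qed.

(** * The Gaussian characteristic function *)

Lemma derive_ge0_le {R : realType} (f g : R -> R) (x : R) :
  (forall y : R, is_derive y (1 : R) f (g y)) -> (forall y, 0 <= y -> 0 <= g y) ->
  0 <= x -> f 0 <= f x.
Proof.
move=> df g0 x0; apply: (@ger0_derive1_ndecr R f 0 x) => //.
- move=> y; rewrite in_itv/= => /andP[/ltW y0 _].
  by rewrite derive1E derive_val; exact: g0.
- apply: continuous_subspaceT => y.
  by apply: differentiable_continuous; apply/derivable1_diffP; exact: ex_derive.
Qed.

Lemma sin_le_id {R : realType} (x : R) : 0 <= x -> sin x <= x.
Proof.
move=> x0; rewrite -subr_ge0.
have -> : 0 = 0 - sin 0 :> R by rewrite sin0 subrr.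
apply: (@derive_ge0_le _ (id - @sin R) (fun y => 1 - cos y)) => //.
Qed.

Lemma cos_ge_quadratic {R : realType} (x : R) : 0 <= x -> 1 - x ^+ 2 / 2 <= cos x.
Proof.
move=> x0; rewrite -subr_ge0.
have -> : 0 = cos 0 - (1 - 0 ^+ 2 / 2) :> R by rewrite cos0; ring.
apply: (@derive_ge0_le _ (fun y => cos y - (1 - y ^+ 2 / 2)) (fun y => y - sin y)) => //; last first.
  by move=> y y0; rewrite subr_ge0 sin_le_id.
move=> y; rewrite (_ : (fun y => _) = (@cos R) - (cst 1 - 2^-1 *: (@id R ^+ 2))); last first.
  by apply/funext => z /=; rewrite !fctE mulrC.
have sE (a b : R) : a *: b = a * b by [].
by apply: is_derive_eq; rewrite !sE expr1; field.
Qed.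

(** The sharp coefficient is 1/6. Only the order of the remainder enters later, so the coefficients
    here and in [cos_le_quartic] are left at 1. *)
Lemma sin_ge_cubic {R : realType} (x : R) : 0 <= x -> x - x ^+ 3 <= sin x.
Proof.
move=> x0; rewrite -subr_ge0.
have -> : 0 = sin 0 - (0 - 0 ^+ 3) :> R by rewrite sin0; ring.
apply: (@derive_ge0_le _ (@sin R - (id - @id R ^+ 3)) (fun y => cos y - (1 - 3 * y ^+ 2))) => //.
  move=> y; have sE (a b : R) : a *: b = a * b by [].
  by apply: is_derive_eq; rewrite !sE /=; ring.
by move=> y y0; have := cos_ge_quadratic y0; have := sqr_ge0 y; lra.
Qed.

Lemma cos_le_quartic {R : realType} (x : R) : 0 <= x ->
  cos x <= 1 - x ^+ 2 / 2 + x ^+ 4.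
Proof.
move=> x0; have sE (a b : R) : a *: b = a * b by [].
have df (y : R) : is_derive y (1 : R)
    (cst 1 - 2^-1 *: (@id R ^+ 2) + @id R ^+ 4 - @cos R) (sin y - (y - 4 * y ^+ 3)).
  by apply: is_derive_eq; rewrite !sE /=; field.
have g0 (y : R) : 0 <= y -> 0 <= sin y - (y - 4 * y ^+ 3).
  by move=> y0; have := sin_ge_cubic y0; have := exprn_ge0 3 y0; lra.
by have := derive_ge0_le df g0 x0; rewrite !fctE /cst !sE !expr0n cos0 /=; lra.
Qed.

Lemma expRN_le_quadratic {R : realType} (x : R) : 0 <= x ->
  expR (- x) <= 1 - x + x ^+ 2.
Proof.
move=> x0; have x1 : 0 < 1 + x by lra.
rewrite expRN (@le_trans _ _ (1 + x)^-1)//.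
  by rewrite lef_pV2 ?posrE ?expR_gt0// expR_ge1Dx.
rewrite -div1r ler_pdivrMr//.
have -> : (1 - x + x ^+ 2) * (1 + x) = 1 + x ^+ 3 by ring.
by rewrite lerDl exprn_ge0.
Qed.

(* Both sides agree up to the second order at 0. *)
Lemma cos_expR_dist {R : realType} (x : R) :
  `|cos x - expR (- (x ^+ 2 / 2))| <= x ^+ 4.
Proof.
wlog x0 : x / 0 <= x.
  move=> H; have [|/ltW x0] := leP 0 x; first exact: H.
  have e : (- x) ^+ 4 = x ^+ 4 by ring.
  by rewrite -cosN -(sqrrN x) -e; apply: H; rewrite oppr_ge0.
have h1 := cos_ge_quadratic x0; have h2 := cos_le_quartic x0.
have h3 := expR_ge1Dx (- (x ^+ 2 / 2)).
have h4 : expR (- (x ^+ 2 / 2)) <= 1 - x ^+ 2 / 2 + (x ^+ 2 / 2) ^+ 2.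
  by apply: expRN_le_quadratic; rewrite divr_ge0// sqr_ge0.
have e4 : x ^+ 4 = (x ^+ 2) ^+ 2 by rewrite -exprM.
have := sqr_ge0 (x ^+ 2); rewrite -e4 => h5.
have e5 : (x ^+ 2 / 2) ^+ 2 = x ^+ 4 / 4 by rewrite e4; field.
rewrite e5 in h4.
by rewrite ler_norml; apply/andP; split; lra.
Qed.

(** Only finiteness matters: [x ^+ 4 <= 32 * expR (x ^+ 2 / 4)], and the Gaussian integral of the
    right-hand side is the quadratic formula at [C = - 1 / 2]. *)
Lemma gauss_moment4 {R : realType} :
  {M : R | 0 <= M & (\int[normal_prob 0 1]_x ((x : R) ^+ 4)%:E = M%:E)%E}.
Proof.
set I : \bar R := (\int[_]_x _)%E.
have I0 : (0 <= I)%E.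
  by apply: integral_ge0 => x _; rewrite lee_fin (@exprM _ _ 2 2) sqr_ge0.
suff IM : (I <= (32 * (Num.sqrt (1 + - 2^-1))^-1)%:E)%E.
  exists (fine I); first exact: fine_ge0.
  by rewrite fineK// ge0_fin_numE// (le_lt_trans IM)// ltry.
have := @integral_gaussian_quadratic R 0 0 (- 2^-1) ltac:(lra).
rewrite expr0n mul0r subr0 oppr0 mul0r expR0 mulr1 EFinM => <-.
rewrite -ge0_integralZl_EFin//; last first.
  apply: continuous_measurable_EFin => x.
  apply: (cvg_comp _ expR); last exact: continuous_expR.
  apply: cvgM; last exact: cvg_cst.
  apply: (@cvgN _ R^o); apply: (@cvgD _ R^o).
    apply: (@cvgD _ R^o); first exact: cvg_cst.
    by apply: cvgM; [exact: cvg_cst|exact: cvg_id].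
  by apply: cvgM; [exact: cvg_cst|exact: sqr_continuous].
apply: ge0_le_integral => //.
- by move=> x _; rewrite lee_fin (@exprM _ _ 2 2) sqr_ge0.
- by apply/measurable_EFinP; apply: measurable_funX.
- apply/measurable_EFinP; apply: measurable_funM => //; apply: measurableT_comp => //.
  by apply: measurable_funM => //; apply: measurableT_comp => //; apply: measurable_funD => //;
    [apply: measurable_funD => //; exact: measurable_funM|apply: measurable_funM => //; exact: measurable_funX].
- move=> x _; rewrite -EFinM lee_fin.
  have := @expR_ge1Dxn R (x ^+ 2 / 4) 1.
  rewrite divr_ge0 ?sqr_ge0// => /(_ isT).
  have -> : - (0 + 2 * 0 * x + - 2^-1 * x ^+ 2) / 2 = x ^+ 2 / 4 by field.
  have -> : (x ^+ 2 / 4) ^+ 2 / 2`!%:R = x ^+ 4 / 32.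
    by rewrite (_ : 2`! = 2)//; field.
  by lra.
Qed.

Lemma bounded_integrable d {T : measurableType d} {R : realType}
    (P : probability T R) (f : T -> R) (M : R) :
  measurable_fun [set: T] f -> (forall x, `|f x| <= M) ->
  P.-integrable [set: T] (EFin \o f).
Proof.
move=> mf fM; apply: measurable_bounded_integrable => //.
  by rewrite /= probability_setT ltry.
by exists M; split; [exact: num_real|move=> y My x _ /=; rewrite (le_trans (fM x))// ltW].
Qed.

Lemma EFin_Rintegral d {T : measurableType d} {R : realType}
    (P : probability T R) (f : T -> R) (M : R) :
  measurable_fun [set: T] f -> (forall x, `|f x| <= M) ->
  ((\int[P]_x f x)%:E = \int[P]_x (f x)%:E)%E.
Proof.
by move=> mf fM; rewrite /Rintegral fineK// integrable_fin_num//; exact: bounded_integrable fM.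
Qed.

Lemma Rintegral_cst1 d {T : measurableType d} {R : realType}
    (P : probability T R) (c : R) : \int[P]_x c = c.
Proof. by rewrite Rintegral_cst//= probability_setT mulr1. Qed.

(** The transfer rules for Gaussian integrals are stated for nonnegative integrands; adding 1 brings
    [sin] and [cos] within their reach. *)
Lemma integral_add1 d {T : measurableType d} {R : realType}
    (P : probability T R) (f : T -> R) :
  measurable_fun [set: T] f -> (forall x, `|f x| <= 1) ->
  (\int[P]_x (1 + f x)%:E = (1 + \int[P]_x f x)%:E)%E.
Proof.
move=> mf f1; rewrite -(@EFin_Rintegral _ _ _ P _ (1 + 1))//.
- congr EFin; rewrite RintegralD//.
  + by rewrite Rintegral_cst1.
  + by apply: (@bounded_integrable _ _ _ _ _ 1) => // x; rewrite normr1.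
  + exact: bounded_integrable f1.
- exact: measurable_funD.
- by move=> x; rewrite (le_trans (ler_normD _ _))// normr1 lerD2l.
Qed.

Lemma gauss_bounded_integrable {R : realType} (f : R -> R) (M : R) :
  measurable_fun [set: R] f -> (forall x, `|f x| <= M) ->
  (normal_prob 0 1).-integrable [set: R] (EFin \o f).
Proof. exact: (@bounded_integrable _ (measurableTypeR R) R (normal_prob 0 1)). Qed.

Lemma gauss_integral_add1 {R : realType} (f : R -> R) :
  measurable_fun [set: R] f -> (forall x, `|f x| <= 1) ->
  (\int[normal_prob 0 1]_x (1 + f (x : R))%:E =
   (1 + \int[normal_prob 0 1]_x f (x : R))%:E)%E.
Proof. exact: (@integral_add1 _ (measurableTypeR R) R (normal_prob 0 1)). Qed.

Lemma continuous_scale {R : realType} (t : R) : continuous (fun x : R => t * x).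
Proof. by move=> x; apply: cvgM; [exact: cvg_cst|exact: cvg_id]. Qed.

Lemma measurable_sin_scale {R : realType} (t : R) :
  measurable_fun [set: R] (fun x => sin (t * x)).
Proof.
apply: continuous_measurable_fun => x.
by apply: continuous_comp; [exact: continuous_scale|exact: continuous_sin].
Qed.

Lemma measurable_cos_scale {R : realType} (c t : R) :
  measurable_fun [set: R] (fun x => cos (c + t * x)).
Proof.
apply: continuous_measurable_fun => x.
apply: (@continuous_comp _ _ _ (fun x => c + t * x) (@cos R)); last exact: continuous_cos.
by apply: cvgD; [exact: cvg_cst|exact: continuous_scale].
Qed.

Lemma Rintegral_gauss_sin {R : realType} (t : R) :
  \int[normal_prob 0 1]_x sin (t * (x : R)) = 0.
Proof.
have ms := @measurable_sin_scale R t.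
have := @ge0_integral_gaussN R (fun x : R => (1 + sin (t * x))%:E).
rewrite (gauss_integral_add1 ms (fun x => sin_max _)).
under eq_integral do rewrite mulrN sinN.
rewrite (@gauss_integral_add1 _ (fun x => - sin (t * x))); last 2 first.
- exact: measurable_funN.
- by move=> x; rewrite normrN sin_max.
have me : measurable_fun [set: R] (fun x : R => (1 + sin (t * x))%:E).
  by apply/measurable_EFinP; exact: measurable_funD.
have pe (x : R) : (0 <= (1 + sin (t * x))%:E)%E.
  by rewrite lee_fin -lerBlDl sub0r sin_geN1.
move=> /(_ me pe)[].
rewrite (_ : \int[_]_x - sin _ = - \int[normal_prob 0 1]_x sin (t * (x : R))); first by lra.
under eq_Rintegral do rewrite -mulN1r.
rewrite RintegralZl ?mulN1r//.
exact: (gauss_bounded_integrable ms (fun x => sin_max _)).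
Qed.

Lemma Rintegral_gauss_cosD {R : realType} (c t : R) :
  \int[normal_prob 0 1]_x cos (c + t * (x : R)) =
  cos c * \int[normal_prob 0 1]_x cos (t * (x : R)).
Proof.
have ms := @measurable_sin_scale R t.
have mc : measurable_fun [set: R] (fun x => cos (t * x)).
  by have := @measurable_cos_scale R 0 t; under eq_fun do rewrite add0r.
have is_ : (normal_prob (0:R) 1).-integrable [set: R] (EFin \o (fun x : R => sin (t * x))).
  exact: (gauss_bounded_integrable ms (fun x => sin_max _)).
have ic : (normal_prob (0:R) 1).-integrable [set: R] (EFin \o (fun x : R => cos (t * x))).
  exact: (gauss_bounded_integrable mc (fun x => cos_max _)).
under eq_Rintegral do rewrite cosD.
rewrite RintegralB//.
- by rewrite !RintegralZl// Rintegral_gauss_sin mulr0 subr0.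
- by have := integrableZl measurableT (cos c) ic.
- by have := integrableZl measurableT (sin c) is_.
Qed.

(** The functional equation of the characteristic function, read off from the convolution of
    [1 + cos]. Together with the behaviour at 0 it determines that function. *)
Lemma Rintegral_gauss_cosM {R : realType} (a b : R) : 0 <= b ->
  (\int[normal_prob 0 1]_x cos (a * (x : R))) * (\int[normal_prob 0 1]_x cos (b * (x : R)))
  = \int[normal_prob 0 1]_x cos (Num.sqrt (a ^+ 2 + b ^+ 2) * (x : R)).
Proof.
move=> b0; set pb := (X in _ * X).
have mc (t : R) : measurable_fun [set: R] (fun x => cos (t * x)).
  by have := @measurable_cos_scale R 0 t; under eq_fun do rewrite add0r.
have ic (t : R) : (normal_prob (0:R) 1).-integrable [set: R] (EFin \o (fun x : R => cos (t * x))).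
  exact: (gauss_bounded_integrable (mc t) (fun x => cos_max _)).
have pb1 : `|pb| <= 1.
  rewrite (le_trans (le_normr_Rintegral _ _))//.
  rewrite -[leRHS](@Rintegral_cst1 _ _ R (normal_prob 0 1)); apply: le_Rintegral => //.
  - exact: integrable_norm (ic b).
  - by apply: (@gauss_bounded_integrable _ _ 1) => // x; rewrite normr1.
  - by move=> x _; exact: cos_max.
have := @gaussian_convolution R (fun x => 1 + cos x) a b.
have cc : continuous (fun x : R => 1 + cos x).
  by move=> x; apply: (@cvgD _ R^o); [exact: cvg_cst|exact: continuous_cos].
have c0 (x : R) : 0 <= 1 + cos x by rewrite -lerBlDl sub0r cos_geN1.
move=> /(_ cc c0 b0).
rewrite (gauss_integral_add1 (mc _) (fun x => cos_max _)).
under eq_integral.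
  move=> u _; rewrite (gauss_integral_add1 (measurable_cos_scale _ _) (fun x => cos_max _)).
  rewrite Rintegral_gauss_cosD.
  over.
rewrite (@gauss_integral_add1 _ (fun u => cos (a * u) * pb)); last 2 first.
- exact: measurable_funM.
- by move=> x; rewrite normrM mulr_ile1// cos_max.
by move=> [] /addrI <-; rewrite RintegralZr.
Qed.

Lemma sqrtrV_bounds {R : realType} (y : R) : 0 <= y ->
  1 - y / 2 <= (Num.sqrt (1 + y))^-1 <= 1 - y / 2 + y ^+ 2.
Proof.
move=> y0; have y1 : 0 < 1 + y by lra.
set r := Num.sqrt (1 + y).
have r0 : 0 < r by rewrite sqrtr_gt0.
have r2 : r ^+ 2 = 1 + y by rewrite sqr_sqrtr// ltW.
apply/andP; split.
  (* With [r ^+ 2 = 1 + y], the tangent bound at [y = 0] reads [r ^+ 3 - 3 * r + 2 >= 0], which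
     factors. *)
  have : r ^-1 * (r - 1) ^+ 2 * (r + 2) >= 0.
    have r3 : 0 <= r + 2 by lra.
    by rewrite mulr_ge0// mulr_ge0 ?sqr_ge0// invr_ge0 ltW.
  have -> : r ^-1 * (r - 1) ^+ 2 * (r + 2) = r ^+ 2 - 3 + 2 * r^-1.
    by field; rewrite gt_eqF.
  by rewrite r2; lra.
rewrite -div1r ler_pdivrMr//.
rewrite -(@ler_sqr _ 1) ?nnegrE//; last by rewrite mulr_ge0 ?ltW//; have := sqr_ge0 (y - 4^-1); lra.
rewrite expr1n exprMn r2.
have -> : (1 - y / 2 + y ^+ 2) ^+ 2 * (1 + y) = 1 + 5 / 4 * y ^+ 2 + 5 / 4 * y ^+ 3 + y ^+ 5.
  by field.
by have := exprn_ge0 2 y0; have := exprn_ge0 3 y0; have := exprn_ge0 5 y0; lra.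
Qed.

Lemma sqrtrV_expR_dist {R : realType} (y : R) : 0 <= y ->
  `|(Num.sqrt (1 + y))^-1 - expR (- (y / 2))| <= y ^+ 2.
Proof.
move=> y0; have /andP[h1 h2] := sqrtrV_bounds y0.
have h3 := expR_ge1Dx (- (y / 2)).
have h4 : expR (- (y / 2)) <= 1 - y / 2 + (y / 2) ^+ 2.
  by apply: expRN_le_quadratic; lra.
have := sqr_ge0 y; move: h4; rewrite expr_div_n => h4 h5.
by rewrite ler_norml; apply/andP; split; lra.
Qed.

Lemma dist_expr_le {R : realType} (a b : R) n : `|a| <= 1 -> `|b| <= 1 ->
  `|a ^+ n - b ^+ n| <= n%:R * `|a - b|.
Proof.
move=> a1 b1; elim: n => [|n IH]; first by rewrite !expr0 subrr normr0 mul0r.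
have -> : a ^+ n.+1 - b ^+ n.+1 = a * (a ^+ n - b ^+ n) + (a - b) * b ^+ n.
  by rewrite !exprS; ring.
rewrite (le_trans (ler_normD _ _))// !normrM -[in leRHS]natr1 mulrDl mul1r lerD//.
  by rewrite (le_trans _ IH)// ler_piMl.
by rewrite ler_piMr// normrX exprn_ile1.
Qed.

Lemma le_all_eps {R : realType} (a b K : R) :
  (forall e : R, 0 < e -> e <= 1 -> a <= b + K * e) -> a <= b.
Proof.
move=> H; rewrite leNgt; apply/negP => ba.
pose e := Num.min 1 ((a - b) / (2 * (`|K| + 1))).
have e0 : 0 < e by rewrite lt_min ltr01 divr_gt0// ?subr_gt0// mulr_gt0.
have /(H _ e0) : e <= 1 by rewrite ge_min lexx.
have : e <= (a - b) / (2 * (`|K| + 1)) by rewrite ge_min lexx orbT.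
rewrite ler_pdivlMr ?mulr_gt0// => h1 h2.
have h3 : K * e <= (`|K| + 1) * e.
  by rewrite ler_pM2r// (le_trans (ler_norm K))// lerDl.
by nra.
Qed.

(** The second moment is minus twice the derivative at [e = 0] of the Gaussian integral of
    [expR (- e * x ^+ 2 / 2)], known to be [(Num.sqrt (1 + e))^-1]. The fourth moment controls the
    remainder. *)
Lemma gauss_moment2 {R : realType} :
  (\int[normal_prob 0 1]_x ((x : R) ^+ 2)%:E = 1)%E.
Proof.
have [M M0 m4] := @gauss_moment4 R.
set m2 := (X in X = _).
have mX n : measurable_fun [set: R] (fun x : R => (x ^+ n)%:E).
  by apply/measurable_EFinP; exact: measurable_funX.
have pX2 (x : R) : (0 <= (x ^+ 2)%:E)%E by rewrite lee_fin sqr_ge0.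
have pX4 (x : R) : (0 <= (x ^+ 4)%:E)%E by rewrite lee_fin (@exprM _ _ 2 2) sqr_ge0.
have i1 : (\int[normal_prob 0 1]_(x in [set: R]) 1 = 1 :> \bar R)%E.
  by rewrite integral_cst//= probability_setT mule1.
have m20 : (0 <= m2)%E by exact: integral_ge0.
have m2M : (m2 <= (1 + M)%:E)%E.
  rewrite EFinD -{1}i1 -m4.
  rewrite -ge0_integralD//; last exact: mX.
  apply: ge0_le_integral => //.
  - exact: mX.
  - by apply: emeasurable_funD => //; exact: mX.
  - move=> x _; rewrite -EFinD lee_fin (@exprM _ _ 2 2).
    by have := sqr_ge0 (x ^+ 2 - 2^-1); have := sqr_ge0 (x : R); nra.
have m2fin : m2 \is a fin_num by rewrite ge0_fin_numE// (le_lt_trans m2M)// ltry.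
rewrite -(fineK m2fin); congr EFin; set c := fine m2.
(* Integrates [1 - y <= expR (- y) <= 1 - y + y ^+ 2] at [y = e * x ^+ 2 / 2]. Dividing by [e] and
   letting it tend to 0 will give both inequalities for [c]. *)
have key (e : R) : 0 < e ->
    1 <= (Num.sqrt (1 + e))^-1 + e / 2 * c <= 1 + e ^+ 2 * M.
  move=> e0.
  have cE : continuous (fun x : R => expR (- (0 + 2 * 0 * x + e * x ^+ 2) / 2)).
    move=> x; apply: (cvg_comp _ expR); last exact: continuous_expR.
    apply: cvgM; last exact: cvg_cst.
    apply: (@cvgN _ R^o); apply: (@cvgD _ R^o).
      apply: (@cvgD _ R^o); first exact: cvg_cst.
      by apply: cvgM; [exact: cvg_cst|exact: cvg_id].
    by apply: cvgM; [exact: cvg_cst|exact: sqr_continuous].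
  have mE := continuous_measurable_EFin cE.
  have mZ n k : measurable_fun [set: R] (fun x : R => (k%:E * (x ^+ n)%:E)%E).
    by apply: emeasurable_funM => //; exact: mX.
  have e20 : 0 <= e / 2 by lra.
  have pZ2 (x : R) : (0 <= (e / 2)%:E * (x ^+ 2)%:E)%E by rewrite mule_ge0// lee_fin.
  have pZ4 (x : R) : (0 <= (e ^+ 2)%:E * (x ^+ 4)%:E)%E by rewrite mule_ge0// lee_fin sqr_ge0.
  have mid : (((Num.sqrt (1 + e))^-1 + e / 2 * c)%:E =
      \int[normal_prob 0 1]_x ((expR (- (0 + 2 * 0 * (x : R) + e * x ^+ 2) / 2))%:E +
        (e / 2)%:E * (x ^+ 2)%:E))%E.
    rewrite ge0_integralD//; last exact: mZ.
    rewrite ge0_integralZl_EFin//; last exact: mX.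
    rewrite integral_gaussian_quadratic; last by lra.
    by rewrite EFinD EFinM /c fineK// expr0n mul0r subr0 oppr0 mul0r expR0 mulr1.
  have mD : measurable_fun [set: R] (fun x : R => ((expR (- (0 + 2 * 0 * (x : R) + e * x ^+ 2) / 2))%:E +
        (e / 2)%:E * (x ^+ 2)%:E)%E).
    by apply: emeasurable_funD => //; exact: mZ.
  rewrite -!lee_fin mid; apply/andP; split.
    rewrite -[leLHS]i1; apply: ge0_le_integral => //.
    - move=> x _; rewrite -EFinM -EFinD lee_fin.
      have := expR_ge1Dx (- (0 + 2 * 0 * x + e * x ^+ 2) / 2); lra.
  apply: (@le_trans _ _ (\int[normal_prob 0 1]_x (1 + (e ^+ 2)%:E * ((x : R) ^+ 4)%:E))%E).
    apply: ge0_le_integral => //.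
    - by move=> x _; rewrite adde_ge0.
    - by apply: emeasurable_funD => //; exact: mZ.
    - move=> x _; rewrite -!EFinM -!EFinD lee_fin.
      have h : 0 <= e * x ^+ 2 / 2 by rewrite divr_ge0// mulr_ge0 ?sqr_ge0// ltW.
      have := expRN_le_quadratic h.
      have -> : - (0 + 2 * 0 * x + e * x ^+ 2) / 2 = - (e * x ^+ 2 / 2) by lra.
      have -> : (e * x ^+ 2 / 2) ^+ 2 = (e ^+ 2 * x ^+ 4) / 4 by field.
      have : 0 <= e ^+ 2 * x ^+ 4 by rewrite mulr_ge0 ?sqr_ge0// -lee_fin.
      by lra.
  rewrite ge0_integralD//; last exact: mZ.
  rewrite i1 ge0_integralZl_EFin//; [|exact: mX|exact: sqr_ge0].
  by rewrite [X in (_ * X)%E](_ : _ = M%:E)// -EFinM -EFinD lexx.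
apply/eqP; rewrite eq_le; apply/andP; split.
  apply: (@le_all_eps _ _ _ (2 * M)) => e e0 _.
  have /andP[_ h1] := key e e0.
  have /andP[h2 _] := sqrtrV_bounds (ltW e0).
  have : e * c <= e * (1 + 2 * M * e) by nra.
  by rewrite ler_pM2l.
apply: (@le_all_eps _ _ _ 2) => e e0 _.
have /andP[h1 _] := key e e0.
have /andP[_ h2] := sqrtrV_bounds (ltW e0).
have : e * 1 <= e * (c + 2 * e) by nra.
by rewrite ler_pM2l.
Qed.

(** Averaging with the reflection [x -> - x] cancels the cross term, so all integrands stay
    nonnegative. *)
Lemma gauss_affine_sqr {R : realType} (c s : R) :
  (\int[normal_prob 0 1]_x ((c + s * (x : R)) ^+ 2)%:E = (c ^+ 2 + s ^+ 2)%:E)%E.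
Proof.
have mX k : measurable_fun [set: R] (fun x : R => ((c + k * x) ^+ 2)%:E).
  apply/measurable_EFinP; apply: measurable_funX; exact: measurable_funD.
have pX k (x : R) : (0 <= ((c + k * x) ^+ 2)%:E)%E by rewrite lee_fin sqr_ge0.
set I := (X in X = _).
have IN : I = (\int[normal_prob 0 1]_x ((c + (- s) * (x : R)) ^+ 2)%:E)%E.
  rewrite /I -(@ge0_integral_gaussN _ (fun x : R => ((c + s * x) ^+ 2)%:E))//.
  by apply: eq_integral => x _; rewrite mulrN mulNr.
have : (I + I = (2 * (c ^+ 2 + s ^+ 2))%:E)%E.
  rewrite {2}IN -ge0_integralD//; [|exact: mX|exact: mX].
  transitivity (\int[normal_prob 0 1]_x ((2 * c ^+ 2)%:E + (2 * s ^+ 2)%:E * ((x : R) ^+ 2)%:E))%E.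
    by apply: eq_integral => x _; rewrite -EFinM -!EFinD; congr EFin; ring.
  have p1 : 0 <= 2 * s ^+ 2 by rewrite mulr_ge0// sqr_ge0.
  have m1 : measurable_fun [set: R] (fun x : R => (x ^+ 2)%:E).
    by apply/measurable_EFinP; exact: measurable_funX.
  have e1 : (\int[normal_prob (0 : R) 1]_(x in [set: R]) (2 * c ^+ 2)%:E = (2 * c ^+ 2)%:E)%E.
    by rewrite integral_cst//= probability_setT mule1.
  have e2 : (\int[normal_prob 0 1]_x ((2 * s ^+ 2)%:E * ((x : R) ^+ 2)%:E) = (2 * s ^+ 2)%:E)%E.
    transitivity ((2 * s ^+ 2)%:E * \int[normal_prob 0 1]_x ((x : R) ^+ 2)%:E)%E.
      by apply: ge0_integralZl_EFin => // x _; rewrite lee_fin sqr_ge0.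
    by rewrite gauss_moment2 mule1.
  rewrite ge0_integralD//.
  - apply: (eq_trans (f_equal2 adde e1 e2)).
    by congr EFin; ring.
  - by move=> x _; rewrite lee_fin mulr_ge0// sqr_ge0.
  - by move=> x _; rewrite mule_ge0// lee_fin sqr_ge0.
  - by apply: emeasurable_funM.
have : (0 <= I)%E by exact: integral_ge0.
case: I {IN} => [r| |]// _; rewrite -EFinD => -[] h; congr EFin; lra.
Qed.

(** Doubling the argument raises both sides to the fourth power. At [s = t / 2 ^+ k] they differ by
    at most [(M + 1) * s ^+ 4]; raising numbers bounded by 1 to the power [4 ^ k] turns this into
    [(M + 1) * t ^+ 4 / 4 ^+ k], which tends to 0. *)
Lemma Rintegral_gauss_cos {R : realType} (t : R) :
  \int[normal_prob 0 1]_x cos (t * (x : R)) = expR (- (t ^+ 2 / 2)).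
Proof.
pose phi (t : R) := \int[normal_prob 0 1]_x cos (t * (x : R)).
wlog t0 : t / 0 <= t.
  move=> H; have [|/ltW t0] := leP 0 t; first exact: H.
  rewrite -sqrrN -H ?oppr_ge0//; apply: eq_Rintegral => x _.
  by rewrite mulNr cosN.
have mc (s : R) : measurable_fun [set: R] (fun x => cos (s * x)).
  by have := @measurable_cos_scale R 0 s; under eq_fun do rewrite add0r.
have ic (s : R) : (normal_prob (0:R) 1).-integrable [set: R] (EFin \o (fun x : R => cos (s * x))).
  exact: (gauss_bounded_integrable (mc s) (fun x => cos_max _)).
have phi1 s : `|phi s| <= 1.
  rewrite (le_trans (le_normr_Rintegral _ _))//.
  rewrite -[leRHS](@Rintegral_cst1 _ _ R (normal_prob 0 1)); apply: le_Rintegral => //.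
  - exact: integrable_norm (ic s).
  - by apply: (@gauss_bounded_integrable _ _ 1) => // x; rewrite normr1.
  - by move=> x _; exact: cos_max.
have phi2 s : 0 <= s -> phi (2 * s) = phi s ^+ 4.
  move=> s0.
  have h (a b : R) : 0 <= b -> 0 <= a -> 2 * a ^+ 2 = b ^+ 2 -> phi a ^+ 2 = phi b.
    move=> b0 a0 ab; rewrite expr2 /phi Rintegral_gauss_cosM//.
    by rewrite -mulr2n -mulr_natl ab sqrtr_sqr ger0_norm.
  rewrite (@exprM _ _ 2 2) (h s (Num.sqrt 2 * s)) ?mulr_ge0 ?sqrtr_ge0//.
    by rewrite (h _ (2 * s)) ?mulr_ge0 ?sqrtr_ge0// !exprMn sqr_sqrtr//; ring.
  by rewrite exprMn sqr_sqrtr.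
have phin n s : 0 <= s -> phi (2 ^+ n * s) = phi s ^+ (4 ^ n).
  move=> s0; elim: n => [|n IH]; first by rewrite expr0 mul1r expn0 expr1.
  by rewrite exprS -mulrA phi2 ?mulr_ge0 ?exprn_ge0// IH -exprM expnSr.
have [M M0 m4] := @gauss_moment4 R.
(* Both terms are compared with [(Num.sqrt (1 + s ^+ 2))^-1], the Gaussian mean of
   [expR (- (s * x) ^+ 2 / 2)]: the first pointwise in [x], the second by expanding the square
   root. *)
have approx s : `|phi s - expR (- (s ^+ 2 / 2))| <= (M + 1) * s ^+ 4.
  have mE : measurable_fun [set: R] (fun x : R => expR (- (0 + 2 * 0 * x + s ^+ 2 * x ^+ 2) / 2)).
    apply: measurableT_comp => //; apply: measurable_funM => //; apply: measurableT_comp => //.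
    apply: measurable_funD; first exact: measurable_funD.
    by apply: measurable_funM => //; exact: measurable_funX.
  have E1 (x : R) : `|expR (- (0 + 2 * 0 * x + s ^+ 2 * x ^+ 2) / 2)| <= 1.
    rewrite ger0_norm ?expR_ge0// -expR0 ler_expR mulNr oppr_le0.
    by rewrite mulr0 mul0r !add0r divr_ge0// mulr_ge0// sqr_ge0.
  have iE := gauss_bounded_integrable mE E1.
  have phiE : \int[normal_prob 0 1]_x expR (- (0 + 2 * 0 * (x : R) + s ^+ 2 * x ^+ 2) / 2)
       = (Num.sqrt (1 + s ^+ 2))^-1.
    rewrite /Rintegral integral_gaussian_quadratic/=.
      by rewrite expr0n mul0r subr0 oppr0 mul0r expR0 mulr1.
    by rewrite (lt_le_trans _ (sqr_ge0 _)).
  rewrite (le_trans (ler_distD (Num.sqrt (1 + s ^+ 2))^-1 _ _))// mulrDl mul1r lerD//; last first.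
    by rewrite (le_trans (sqrtrV_expR_dist (sqr_ge0 _)))// -exprM.
  have iB : (normal_prob (0 : R) 1).-integrable [set: R] (EFin \o (fun x : R =>
      cos (s * x) - expR (- (0 + 2 * 0 * x + s ^+ 2 * x ^+ 2) / 2))).
    apply: (@gauss_bounded_integrable _ _ 2); first exact: measurable_funB.
    by move=> x; rewrite (le_trans (ler_normB _ _))// -[2]/(1 + 1) lerD ?cos_max.
  have mAbs : measurable_fun [set: R] (fun x : R =>
      `|cos (s * x) - expR (- (0 + 2 * 0 * x + s ^+ 2 * x ^+ 2) / 2)|).
    by apply: measurableT_comp => //; exact: measurable_funB.
  rewrite -phiE -RintegralB//.
  rewrite (le_trans (le_normr_Rintegral _ _))//.
  rewrite -lee_fin (@EFin_Rintegral _ (measurableTypeR R) R (normal_prob 0 1) _ 2); last 2 first.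
  - exact: mAbs.
  - by move=> x; rewrite normr_id (le_trans (ler_normB _ _))// -[2]/(1 + 1) lerD ?cos_max.
  rewrite (mulrC M) EFinM -m4.
  rewrite -ge0_integralZl_EFin//; last 3 first.
  - by move=> x _; rewrite lee_fin (@exprM _ _ 2 2) sqr_ge0.
  - by apply/measurable_EFinP; exact: measurable_funX.
  - by rewrite (@exprM _ _ 2 2) sqr_ge0.
  apply: ge0_le_integral => //.
  - by apply/measurable_EFinP; exact: mAbs.
  - apply: emeasurable_funM => //; apply/measurable_EFinP; exact: measurable_funX.
  - move=> x _; rewrite -EFinM lee_fin.
    have -> : - (0 + 2 * 0 * (x : R) + s ^+ 2 * x ^+ 2) / 2 = - ((s * (x : R)) ^+ 2 / 2) by field.
    have -> : s ^+ 4 * (x : R) ^+ 4 = (s * (x : R)) ^+ 4 by rewrite exprMn.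
    exact: cos_expR_dist.
apply/eqP; rewrite -subr_eq0 -normr_eq0; apply/eqP/le_anti/andP; split => //.
apply: (@le_all_eps _ _ _ ((M + 1) * t ^+ 4)) => e e0 _; rewrite add0r.
have [k ke] : exists k : nat, (4 ^+ k)^-1 <= e.
  have /archi_boundP : 0 <= e^-1 by rewrite invr_ge0 ltW.
  set k := Num.bound _ => kb; exists k.
  rewrite invf_ple ?posrE ?exprn_gt0// (le_trans (ltW kb))//.
  by rewrite -natrX ler_nat ltnW// ltn_expl.
pose s := t / 2 ^+ k.
have s0 : 0 <= s by rewrite divr_ge0// exprn_ge0.
have tE : t = 2 ^+ k * s by rewrite /s mulrC divfK// expf_neq0.
rewrite -/(phi t) [in phi t]tE phin//.
have -> : expR (- (t ^+ 2 / 2)) = expR (- (s ^+ 2 / 2)) ^+ (4 ^ k).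
  rewrite -expRM_natr; congr expR; rewrite tE exprMn natrX -exprM mulnC exprM.
  by rewrite (_ : 2 ^+ 2 = 4 :> R); [ring|ring].
have e1 : `|expR (- (s ^+ 2 / 2))| <= 1.
  by rewrite ger0_norm ?expR_ge0// -expR0 ler_expR oppr_le0 divr_ge0// sqr_ge0.
rewrite (le_trans (dist_expr_le _ (phi1 s) e1))//.
rewrite (@le_trans _ _ ((4 ^ k)%:R * ((M + 1) * s ^+ 4)))//.
  by rewrite ler_wpM2l// approx.
have -> : (4 ^ k)%:R * ((M + 1) * s ^+ 4) = (M + 1) * t ^+ 4 * (4 ^+ k)^-1.
  have e4 : 4 ^+ k = (2 ^+ k) ^+ 2 :> R.
    by rewrite -exprM mulnC exprM; congr (_ ^+ _); ring.
  by rewrite natrX tE e4; field.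
by rewrite ler_wpM2l// mulr_ge0 ?exprn_ge0// addr_ge0.
Qed.

(** * Moments and cosines of Gaussian variables *)

Section gaussian_variables.
Context d {T : measurableType d} {R : realType} (P : probability T R).

Lemma gaussian_law_transfer (Y : T -> R) (m s : R) (f : R -> R) :
  measurable_fun [set: T] Y -> 0 <= s ->
  (forall A, measurable A -> P (Y @^-1` A) = gaussian_law m s A) ->
  continuous f -> (forall x, 0 <= f x) ->
  (\int[P]_w (f (Y w))%:E = \int[normal_prob 0 1]_x (f (m + s * (x : R)))%:E)%E.
Proof.
move=> mY s0 PY cf f0.
have mY' : measurable_fun [set: T] (Y : T -> measurableTypeR R) by exact: mY.
pose phi : {mfun T >-> measurableTypeR R} :=
  HB.pack (Y : T -> measurableTypeR R) (isMeasurableFun.Build _ _ _ _ _ mY').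
have mf := continuous_measurable_EFin cf.
transitivity (\int[pushforward P phi]_x (f x)%:E)%E.
  by rewrite (ge0_integral_pushforward mY')// => x _; rewrite lee_fin.
have [s_eq0|s_neq0] := eqVneq s 0.
  transitivity (\int[\d_(m : measurableTypeR R)]_x (f x)%:E)%E.
    apply: eq_measure_integral => A mA _.
    by have := PY A mA; rewrite /gaussian_law s_eq0 eqxx.
  rewrite integral_dirac//= diracT mul1e s_eq0.
  under eq_integral do rewrite mul0r addr0.
  by rewrite integral_cst//= probability_setT mule1.
rewrite -ge0_integral_normal_affine//; last by rewrite lt_neqAle eq_sym s_neq0.
apply: eq_measure_integral => A mA _.
by have := PY A mA; rewrite /gaussian_law (negbTE s_neq0).
Qed.

Lemma gaussian_variableP (Y : T -> R) : gaussian_variable P Y ->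
  exists m s : R, [/\ 0 <= s,
    P.-integrable [set: T] (EFin \o Y),
    (\int[P]_w (Y w)%:E = m%:E)%E,
    (\int[P]_w (Y w ^+ 2)%:E = (m ^+ 2 + s ^+ 2)%:E)%E &
    forall f : R -> R, continuous f -> (forall x, 0 <= f x) ->
    (\int[P]_w (f (Y w))%:E = \int[normal_prob 0 1]_x (f (m + s * (x : R)))%:E)%E].
Proof.
move=> [mY [m [s [s0 PY]]]]; exists m, s.
have tr := fun f => @gaussian_law_transfer Y m s f mY s0 PY.
have sqr c : (\int[P]_w ((c + Y w) ^+ 2)%:E = ((c + m) ^+ 2 + s ^+ 2)%:E)%E.
  rewrite (tr (fun x => (c + x) ^+ 2)).
  - rewrite -gauss_affine_sqr; apply: eq_integral => x _.
    by rewrite addrA.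
  - move=> x; apply: (@continuous_comp _ _ _ (fun x => c + x) (fun x => x ^+ 2)).
      by apply: cvgD; [exact: cvg_cst|exact: cvg_id].
    exact: sqr_continuous.
  - by move=> x; exact: sqr_ge0.
have sqr0 : (\int[P]_w (Y w ^+ 2)%:E = (m ^+ 2 + s ^+ 2)%:E)%E.
  have := sqr 0; rewrite add0r => <-.
  by apply: eq_integral => w _; rewrite add0r.
have mY2 : measurable_fun [set: T] (fun w => (Y w ^+ 2)%:E).
  by apply/measurable_EFinP; exact: measurable_funX.
have iY2 : P.-integrable [set: T] (fun w => (Y w ^+ 2)%:E).
  apply/integrableP; split => //.
  under eq_integral do rewrite gee0_abs ?lee_fin ?sqr_ge0//.
  by rewrite sqr0 ltry.
have i1 : P.-integrable [set: T] (EFin \o (fun=> 1 : R)).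
  by apply: (@bounded_integrable _ _ _ _ _ 1) => // x; rewrite normr1.
have iY : P.-integrable [set: T] (EFin \o Y).
  apply: (@le_integrable _ _ _ _ _ _ _ (fun w => 1%:E + (Y w ^+ 2)%:E)%E) => //.
  - exact/measurable_EFinP.
  - move=> w _ /=; rewrite lee_fin [leRHS]ger0_norm ?addr_ge0 ?sqr_ge0//.
    by rewrite -(@real_normK _ (Y w)) ?num_real//; have := sqr_ge0 (`|Y w| - 2^-1); nra.
  - exact: integrableD.
split => //.
have fY : (\int[P]_w (Y w)%:E)%E \is a fin_num by exact: integrable_fin_num.
rewrite -(fineK fY); congr EFin; set M := fine _.
(* The mean is read off from the second moment of [1 + Y]. *)
have := sqr 1.
have -> : (\int[P]_w ((1 + Y w) ^+ 2)%:E = (1 + 2 * M + (m ^+ 2 + s ^+ 2))%:E)%E.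
  transitivity (\int[P]_w (((1 : R)%:E + (2%:E * (Y w)%:E)) + (Y w ^+ 2)%:E))%E.
    by apply: eq_integral => w _; rewrite -EFinM -!EFinD; congr EFin; ring.
  have i2Y : P.-integrable [set: T] (fun w => 2%:E * (Y w)%:E)%E.
    exact: integrableZl.
  have i12 : P.-integrable [set: T] (fun w => 1%:E + 2%:E * (Y w)%:E)%E.
    exact: integrableD.
  rewrite integralD// sqr0 integralD// integralZl// integral_cst//= probability_setT.
  by rewrite mule1 -(fineK fY) -/M -EFinM -!EFinD.
by move=> [] h; nra.
Qed.

End gaussian_variables.

Lemma gaussian_centered_cos d {T : measurableType d} {R : realType} (P : probability T R)
    (Y : T -> R) (v : R) : gaussian_variable P Y ->
  (\int[P]_w (Y w)%:E = 0)%E -> (\int[P]_w (Y w ^+ 2)%:E = v%:E)%E ->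
  \int[P]_w cos (Y w) = expR (- (v / 2)).
Proof.
move=> gY EY EY2.
have mY : measurable_fun [set: T] Y by case: gY.
have [m [s [s0 _ mE vE tr]]] := gaussian_variableP gY.
have {mE} m0 : m = 0 by move: mE; rewrite EY => -[].
have {vE} vE : v = s ^+ 2 by move: vE; rewrite EY2 m0 expr0n add0r => -[].
have mcY : measurable_fun [set: T] (fun w => cos (Y w)).
  apply: measurableT_comp => //; apply: continuous_measurable_fun; exact: continuous_cos.
have := tr (fun x => 1 + cos x).
rewrite (integral_add1 _ mcY (fun w => cos_max _)).
rewrite (gauss_integral_add1 (measurable_cos_scale m s) (fun x => cos_max _)).
rewrite Rintegral_gauss_cosD Rintegral_gauss_cos m0 cos0 mul1r vE.
have cc : continuous (fun x : R => 1 + cos x).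
  by move=> x; apply: (@cvgD _ R^o); [exact: cvg_cst|exact: continuous_cos].
have c0 (x : R) : 0 <= 1 + cos x by rewrite -lerBlDl sub0r cos_geN1.
by move=> /(_ cc c0) [] /addrI.
Qed.

Lemma Rintegral_exchange d1 d2 {T1 : measurableType d1} {T2 : measurableType d2}
    {R : realType} (P : probability T1 R) (Q : probability T2 R)
    (f : T1 * T2 -> R) (M : R) :
  measurable_fun [set: T1 * T2] f -> (forall x, `|f x| <= M) ->
  \int[P]_x (\int[Q]_y f (x, y)) = \int[Q]_y (\int[P]_x f (x, y)).
Proof.
move=> mf fM.
have fi : (P \x Q)%E.-integrable [set: T1 * T2] (EFin \o f) by exact: bounded_integrable fM.
have := Fubini fi.
rewrite /Rintegral => h; congr fine.
transitivity (\int[P]_x \int[Q]_y (f (x, y))%:E)%E.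
  apply: eq_integral => x _.
  have := @EFin_Rintegral _ _ _ Q (fun y => f (x, y)) M => -> //.
  by apply: measurableT_comp mf _; exact: pair1_measurable.
rewrite h; apply: eq_integral => y _.
have := @EFin_Rintegral _ _ _ P (fun x => f (x, y)) M => -> //.
by apply: measurableT_comp mf _; exact: pair2_measurable.
Qed.

(** * Eliminating the variables of a Gaussian vector *)

Section gaussian_elimination.
Context d {T : measurableType d} {R : realType} (P : probability T R) (n : nat).
Variables (U : 'I_n -> T -> R) (B : 'rV[R]_n -> 'rV[R]_n -> R) (v : 'I_n -> R).
Hypothesis mU : forall j, measurable_fun [set: T] (U j).
Hypothesis BC : forall c e, B c e = B e c.
Hypothesis BD : forall c e t f, B (c + t *: e) f = B c f + t * B e f.
Hypothesis B0 : forall c, 0 <= B c c.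
Hypothesis cosB : forall c : 'rV[R]_n,
  \int[P]_w cos (\sum_j c 0 j * U j w) = expR (- (B c c / 2)).
Hypothesis v0 : forall j, 0 <= v j.
(** [B] stands for the covariance form of [U]. The vectors [c] allowed here describe [U j] plus
    combinations of earlier variables, so [v j] is a lower bound for the variance of [U j] given the
    earlier ones. *)
Hypothesis vB : forall (j : 'I_n) (c : 'rV[R]_n), c 0 j = 1 ->
  (forall l : 'I_n, (j < l)%N -> c 0 l = 0) -> v j <= B c c.

Let G (k : nat) w := \prod_(j < n | (j < k)%N) expR (- (U j w ^+ 2 / 2)).

Let G01 k w : 0 <= G k w <= 1.
Proof.
rewrite /G; elim/big_rec: _ => [|j x _ /andP[x0 x1]]; first by rewrite ler01 lexx.
rewrite mulr_ge0 ?expR_ge0//= mulr_ile1 ?expR_ge0//.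
by rewrite -expR0 ler_expR oppr_le0 divr_ge0// sqr_ge0.
Qed.

Let mG k : measurable_fun [set: T] (G k).
Proof.
rewrite (_ : G k = fun w => \prod_(j <- [seq j : 'I_n <- index_enum 'I_n | (j < k)%N])
    expR (- (U j w ^+ 2 / 2))); last first.
  by apply/funext => w; rewrite big_filter.
apply: measurable_prod => j _.
apply: measurableT_comp => //; apply: measurableT_comp => //.
by apply: measurable_funM => //; exact: measurable_funX.
Qed.

Let dot (c : 'rV[R]_n) w := \sum_j c 0 j * U j w.

Let mdot c : measurable_fun [set: T] (dot c).
Proof. by apply: measurable_sum => j; exact: measurable_funM. Qed.

Let dotD c e t w : dot (c + t *: e) w = dot c w + t * dot e w.
Proof.
rewrite /dot mulr_sumr -big_split; apply: eq_bigr => j _ /=.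
by rewrite !mxE mulrDl mulrA.
Qed.

Let Gl (k : 'I_n) w : G k.+1 w = expR (- (U k w ^+ 2 / 2)) * G k w.
Proof.
rewrite /G (bigD1 k)//=; congr (_ * _); apply: eq_bigl => j.
by rewrite ltnS ltn_neqAle andbC.
Qed.

Let bdM a b : `|a| <= 1 :> R -> 0 <= b <= 1 -> `|a * b| <= 1.
Proof.
by move=> a1 /andP[b0 b1]; rewrite normrM (ger0_norm b0) mulr_ile1.
Qed.

(** The factor of index [k] is the Gaussian mean of [cos (x * U k)]. The product of the two cosines
    may be replaced by the cosine of the sum, as the sine part has mean 0; the factor thus becomes a
    random shift of [c] along one axis. *)
Let GS (k : 'I_n) c :
  \int[P]_w (cos (dot c w) * G k.+1 w) =
  \int[normal_prob 0 1]_x \int[P]_w (cos (dot (c + (x : R) *: delta_mx 0 k) w) * G k w).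
Proof.
have dotk w : dot (delta_mx 0 k) w = U k w.
  rewrite /dot (bigD1 k)//= mxE !eqxx mul1r big1 ?addr0// => j jk.
  by rewrite mxE (negbTE jk) andbF mul0r.
under eq_Rintegral => w _.
  rewrite Gl mulrA -Rintegral_gauss_cos -Rintegral_gauss_cosD.
  rewrite -RintegralZr//; last first.
    exact: (gauss_bounded_integrable (measurable_cos_scale _ _) (fun x => cos_max _)).
  over.
rewrite (@Rintegral_exchange _ _ T (measurableTypeR R) R P (normal_prob 0 1)
  (fun wx => cos (dot c wx.1 + U k wx.1 * wx.2) * G k wx.1) 1)/=.
- apply: eq_Rintegral => x _; apply: eq_Rintegral => w _.
  by rewrite dotD dotk (mulrC x).
- apply: measurable_funM; last exact: measurableT_comp (mG k) _.
  apply: measurableT_comp.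
    by apply: continuous_measurable_fun; exact: continuous_cos.
  apply: measurable_funD; first exact: measurableT_comp (mdot c) _.
  by apply: measurable_funM => //; exact: measurableT_comp (mU k) _.
- by move=> x; apply: bdM; [exact: cos_max|exact: G01].
Qed.

(** [B'] is the covariance form of [U] under the weight [G k], and [D] is the mean of that weight.
    The fourth clause retains what [vB] needs: [B'] dominates [B] after a correction of [c] in its
    first [k] coordinates, so the variance available for the next variable is at least its [v]. *)
Let claim (k : nat) : (k <= n)%N ->
  exists (D : R) (B' : 'rV[R]_n -> 'rV[R]_n -> R),
   [/\ 0 <= D <= \prod_(j < n | (j < k)%N) (Num.sqrt (1 + v j))^-1,
      forall c e, B' c e = B' e c,
      forall c e t f, B' (c + t *: e) f = B' c f + t * B' e f,
      forall c, exists b : 'rV[R]_n,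
        (forall l : 'I_n, (k <= l)%N -> b 0 l = 0) /\ B (c - b) (c - b) <= B' c c &
      forall c, \int[P]_w (cos (dot c w) * G k w) = D * expR (- (B' c c / 2))].
Proof.
elim: k => [_|k IH kn].
  exists 1, B; split => //.
  - by rewrite big1// lexx ler01.
  - by move=> c; exists 0; split; [move=> l _; rewrite mxE|rewrite subr0].
  - move=> c; rewrite mul1r -cosB; apply: eq_Rintegral => w _.
    by rewrite /G big1// mulr1.
have [D [B' [/andP[D0 D1] BC' BD' Bb' E']]] := IH (ltnW kn).
pose k' := Ordinal kn; pose e : 'rV[R]_n := delta_mx 0 k'; pose C := B' e e.
have Cv : v k' <= C.
  have [b [bk bB]] := Bb' e; apply: le_trans bB; apply: vB.
    by rewrite !mxE !eqxx (bk k') ?subr0.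
  move=> l kl; rewrite !mxE (bk l) ?subr0; last exact: ltnW.
  by rewrite (_ : (l == k') = false)// -val_eqE/= gtn_eqF.
have C0 : 0 <= C by rewrite (le_trans _ Cv).
have C1 : 0 < 1 + C by rewrite ltr_wpDr.
(* Integrating [expR (- B' (c + x *: e) (c + x *: e) / 2)] over a Gaussian [x] completes the square:
   it gives the factor with [1 + C] and removes a rank-one term from [B']. *)
exists (D * (Num.sqrt (1 + C))^-1), (fun c f => B' c f - B' c e * B' f e / (1 + C)); split.
- rewrite mulr_ge0 ?invr_ge0 ?sqrtr_ge0//=.
  rewrite (bigD1 k')//= mulrC ler_pM ?invr_ge0 ?sqrtr_ge0//.
    rewrite lef_pV2 ?posrE ?sqrtr_gt0//; last by rewrite ltr_wpDr.
    by rewrite ler_wsqrtr// lerD2l.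
  rewrite (le_trans D1)// le_eqVlt; apply/orP; left; apply/eqP; apply: eq_bigl => j.
  by rewrite ltnS ltn_neqAle andbC.
- by move=> c f; rewrite BC' (mulrC (B' c e)).
- by move=> c f t g; rewrite !BD'; field; rewrite gt_eqF.
(* The new form at [c] equals [beta ^+ 2] plus [B'] at [c - beta *: e]. A correction for the latter
   vector, increased by [beta *: e], therefore serves for [c]. *)
- move=> c; pose beta := B' c e / (1 + C).
  have [b [bk bB]] := Bb' (c + (- beta) *: e).
  exists (b + beta *: e); split.
    move=> l kl; rewrite !mxE (bk l) 1?ltnW// add0r (_ : (l == k') = false) ?andbF ?mulr0//.
    by rewrite -val_eqE/= gtn_eqF.
  have -> : c - (b + beta *: e) = c + (- beta) *: e - b.
    by rewrite scaleNr opprD addrA addrAC.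
  apply: (le_trans bB).
  rewrite !BD' ![B' _ (c + _)]BC' !BD' -/C (BC' e c).
  have -> : B' c e = beta * (1 + C) by rewrite /beta divfK// gt_eqF.
  have -> : B' c c - beta * (1 + C) * (beta * (1 + C)) / (1 + C) =
     B' c c - beta ^+ 2 * (1 + C) by field; rewrite gt_eqF.
  by have := sqr_ge0 beta; lra.
- move=> c; rewrite (GS k').
  have qE (x : R) : B' (c + x *: e) (c + x *: e) =
      B' c c + 2 * B' c e * x + C * x ^+ 2.
    by rewrite !BD' ![B' _ (c + _)]BC' !BD' -/C (BC' e c); ring.
  have cE : measurable_fun [set: R] (fun x : R => expR (- (B' (c + x *: e) (c + x *: e) / 2))).
    under eq_fun do rewrite qE.
    apply: measurableT_comp => //; apply: measurableT_comp => //; apply: measurable_funM => //.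
    apply: measurable_funD; first by apply: measurable_funD => //; exact: measurable_funM.
    by apply: measurable_funM => //; exact: measurable_funX.
  have B'0 f : 0 <= B' f f by have [b [_ h]] := Bb' f; exact: le_trans h.
  have E1 (x : R) : `|expR (- (B' (c + x *: e) (c + x *: e) / 2))| <= 1.
    by rewrite ger0_norm ?expR_ge0// -expR0 ler_expR oppr_le0 divr_ge0.
  under eq_Rintegral do rewrite E'.
  rewrite RintegralZl//; last exact: gauss_bounded_integrable E1.
  rewrite -mulrA; congr (_ * _).
  rewrite /Rintegral; under eq_integral => x _.
    rewrite (_ : - (B' (c + (x : R) *: e) (c + x *: e) / 2) =
       - (B' c c + 2 * B' c e * (x : R) + C * x ^+ 2) / 2); last by rewrite qE mulNr.
    over.
  rewrite integral_gaussian_quadratic/=; last by rewrite (lt_le_trans _ C0).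
  by rewrite expr2 mulNr.
Qed.

Lemma gaussian_elimination :
  \int[P]_w \prod_j expR (- (U j w ^+ 2 / 2)) <= \prod_j (Num.sqrt (1 + v j))^-1.
Proof.
have [D [B' [/andP[D0 D1] _ _ Bb' E']]] := claim (leqnn n).
have gE w : \prod_j expR (- (U j w ^+ 2 / 2)) = cos (dot 0 w) * G n w.
  rewrite (_ : dot 0 w = 0) ?cos0 ?mul1r.
    by apply: eq_bigl => j; rewrite ltn_ord.
  by rewrite /dot big1// => j _; rewrite mxE mul0r.
under eq_Rintegral do rewrite gE.
rewrite E'; have [b [_ bB]] := Bb' 0.
rewrite (@le_trans _ _ (D * 1))//.
  rewrite ler_wpM2l// -expR0 ler_expR oppr_le0 divr_ge0//.
  exact: le_trans bB.
rewrite mulr1 (le_trans D1)// le_eqVlt; apply/orP; left; apply/eqP.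
by apply: eq_bigl => j; rewrite ltn_ord.
Qed.

End gaussian_elimination.

(** Coordinates are added one at a time as factors of a product space, and the convolution identity
    merges each with the previous ones. Numbering them by [nat] lets the induction reuse [g] without
    changing index types. *)
Lemma isotropic_gaussian {R : realType} (N : nat) :
  exists (d : measure_display) (T : measurableType d) (P : probability T R) (g : nat -> T -> R),
    (forall j, measurable_fun [set: T] (g j)) /\
    forall (z : nat -> R) (f : R -> R), continuous f -> (forall x, 0 <= f x) ->
    (\int[P]_w (f (\sum_(j < N) g j w * z j))%:E =
     \int[normal_prob 0 1]_x (f (Num.sqrt (\sum_(j < N) z j ^+ 2) * (x : R)))%:E)%E.
Proof.
elim: N => [|N [d [T [P [g [mg gP]]]]]].
  exists _, (measurableTypeR R), (normal_prob 0 1), (fun _ _ => 0); split => // z f _ _.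
  by apply: eq_integral => x _; rewrite !big_ord0 sqrtr0 mul0r.
pose g' j (uw : measurableTypeR R * T) : R := if (j < N)%N then g j uw.2 else uw.1.
exists _, (measurableTypeR R * T)%type, (normal_prob (0 : R) 1 \x P)%E, g'; split.
  move=> j; rewrite /g'; case: (j < N)%N; last exact: measurable_fst.
  exact: measurableT_comp (mg j) _.
move=> z f cf f0.
have mS : measurable_fun [set: measurableTypeR R * T]
    (fun uw => f (\sum_(j < N) g j uw.2 * z j + (uw.1 : R) * z N)).
  apply: measurableT_comp; first exact: continuous_measurable_fun.
  apply: measurable_funD; last by apply: measurable_funM => //; exact: measurable_fst.
  apply: measurable_sum => j; apply: measurable_funM => //.
  exact: measurableT_comp (mg j) _.
transitivity (\int[(normal_prob (0 : R) 1 \x P)%E]_uw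
   (f (\sum_(j < N) g j uw.2 * z j + (uw.1 : R) * z N))%:E)%E.
  apply: eq_integral => uw _; rewrite big_ord_recr/= /g' ltnn.
  by congr (EFin (f (_ + _))); apply: eq_bigr => j _; rewrite ltn_ord.
rewrite fubini_tonelli1/=; last 2 first.
- exact/measurable_EFinP.
- by move=> x; rewrite lee_fin.
rewrite big_ord_recr/= addrC -[X in Num.sqrt (_ + X)]sqr_sqrtr; last first.
  by apply: sumr_ge0 => j _; exact: sqr_ge0.
rewrite -gaussian_convolution ?sqrtr_ge0//.
apply: eq_integral => u _; rewrite /fubini_F/=.
under [RHS]eq_integral do rewrite addrC (mulrC (z N)).
apply: (gP z (fun x => f (x + u * z N))) => // x.
apply: (@continuous_comp _ _ _ (fun x : R => x + u * z N) f); last exact: cf.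
by apply: cvgD; [exact: cvg_id|exact: cvg_cst].
Qed.

Lemma isotropic_gaussian_rV {R : realType} (N : nat) :
  exists (d : measure_display) (T : measurableType d) (P : probability T R) (g : 'I_N -> T -> R),
    (forall j, measurable_fun [set: T] (g j)) /\
    forall (z : 'rV[R]_N) (f : R -> R), continuous f -> (forall x, 0 <= f x) ->
    (\int[P]_w (f (\sum_j g j w * z 0 j))%:E =
     \int[normal_prob 0 1]_x (f (euclidean_norm z * (x : R)))%:E)%E.
Proof.
have [d [T [P [g [mg gP]]]]] := @isotropic_gaussian R N.
exists d, T, P, (fun j : 'I_N => g j); split => // z f cf f0.
pose z' k : R := oapp (fun j : 'I_N => z 0 j) 0 (insub k).
have zE (j : 'I_N) : z' j = z 0 j by rewrite /z' valK.
have := gP z' f cf f0.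
under eq_integral => w _.
  under eq_bigr do rewrite zE.
  over.
move=> ->; apply: eq_integral => x _.
by rewrite /euclidean_norm; under eq_bigr do rewrite zE.
Qed.

(** * Local nondeterminism *)

(** Compact support will isolate one point from the others, while the Lipschitz bound keeps the
    increments quadratically small. *)
Definition tent {R : realType} (v : R) : R := Num.max 0 (1 - `|v|).

Lemma tent_ge0 {R : realType} (v : R) : 0 <= tent v.
Proof. by rewrite /tent le_max lexx. Qed.

Lemma tent_le1 {R : realType} (v : R) : tent v <= 1.
Proof. by rewrite /tent ge_max ler01 gerBl normr_ge0. Qed.

Lemma tent_out {R : realType} (v : R) : 1 <= `|v| -> tent v = 0.
Proof. by move=> v1; apply/max_idPl; rewrite subr_le0. Qed.

Lemma tent_in {R : realType} (v : R) : `|v| <= 2^-1 -> 2^-1 <= tent v.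
Proof. by move=> v1; rewrite /tent le_max; apply/orP; right; lra. Qed.

Lemma tent_lip {R : realType} (a b : R) : `|tent a - tent b| <= `|a - b|.
Proof.
wlog ab : a b / tent b <= tent a.
  move=> H; have [/H//|/ltW/H] := leP (tent b) (tent a).
  by rewrite distrC (distrC b).
rewrite ger0_norm ?subr_ge0//.
have h1 : `|b| <= `|a| + `|a - b|.
  by have := ler_distD a 0 b; rewrite !sub0r !normrN.
have h2 := tent_ge0 b; have h3 : 1 - `|b| <= tent b by rewrite /tent le_max lexx orbT.
have [a1|a1] := leP 1 `|a|; first by rewrite (tent_out a1) in ab *; have := normr_ge0 (a - b); lra.
rewrite {1}/tent (max_idPr _); last by rewrite subr_ge0 ltW.
by lra.
Qed.

Lemma continuous_tent {R : realType} : continuous (@tent R).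
Proof.
move=> x; apply/cvgrPdist_le => e e0; apply/nbhs_ballP; exists e => //= y.
by rewrite /ball/= => /ltW; exact: le_trans (tent_lip _ _).
Qed.

Lemma measurable_tent {R : realType} : measurable_fun [set: R] (@tent R).
Proof. by apply: continuous_measurable_fun; exact: continuous_tent. Qed.

(** The integrand is at most [Num.min 1 (z ^+ 2)] and vanishes outside two intervals of length 2,
    hence the 4. *)
Lemma integral_tent_diff {R : realType} (z : R) :
  (\int[lebesgue_measure]_v ((tent ((v : R) - z) - tent (v : R)) ^+ 2)%:E <=
   (4 * Num.min 1 (z ^+ 2))%:E)%E.
Proof.
set c := Num.min 1 (z ^+ 2).
have c0 : 0 <= c by rewrite le_min ler01 sqr_ge0.
have itv2 (a : R) : lebesgue_measure `[a - 1, a + 1]%classic = 2%:E :> \bar R.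
  by rewrite lebesgue_measure_itv/= lte_fin ltrD2l gtrN// -EFinB; congr EFin; ring.
have mi (a : R) : measurable_fun [set: R] (fun v : R => (\1_(`[a - 1, a + 1]%classic) v)%:E : \bar R).
  by apply/measurable_EFinP; exact: measurable_indic.
apply: (@le_trans _ _ (\int[lebesgue_measure]_v (c%:E * ((\1_(`[z - 1, z + 1]%classic) (v : R))%:E +
   (\1_(`[0 - 1, 0 + 1]%classic) (v : R))%:E)))%E).
  apply: ge0_le_integral => //.
  - by move=> v _; rewrite lee_fin sqr_ge0.
  - apply/measurable_EFinP; apply: measurable_funX; apply: measurable_funB.
      by apply: (measurableT_comp measurable_tent); exact: measurable_funB.
    exact: measurable_tent.
  - by apply: emeasurable_funM => //; apply: emeasurable_funD; exact: mi.
  - move=> v _; rewrite -EFinD -EFinM lee_fin.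
    have hc : (tent ((v : R) - z) - tent (v : R)) ^+ 2 <= c.
      rewrite le_min -real_normK ?num_real//; apply/andP; split.
        rewrite expr_le1//.
        have := tent_ge0 ((v : R) - z); have := tent_le1 ((v : R) - z).
        have := tent_ge0 (v : R); have := tent_le1 (v : R).
        by rewrite ler_norml; lra.
      rewrite -[leRHS]real_normK ?num_real// ler_sqr ?nnegrE//.
      rewrite (le_trans (tent_lip _ _))// (_ : (v : R) - z - v = - z) ?normrN//; ring.
    have [vz|vz] := boolP ((v : R) \in `[z - 1, z + 1]).
      rewrite indicE mem_set//= (le_trans hc)// ler_peMr//.
      by rewrite lerDl ler0n.
    have [v0|v0] := boolP ((v : R) \in `[0 - 1, 0 + 1]).
      rewrite [\1_`[0 - 1, 0 + 1] _]indicE mem_set//= (le_trans hc)// ler_peMr//.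
      by rewrite lerDr ler0n.
    rewrite !tent_out ?subrr ?expr0n/= ?mulr_ge0 ?addr_ge0//.
      by rewrite leNgt; apply: contra v0 => /ltW; rewrite ler_norml in_itv/=; lra.
    by rewrite leNgt; apply: contra vz => /ltW; rewrite ler_norml in_itv/=; lra.
rewrite ge0_integralZl_EFin//; last 2 first.
- by move=> v _; rewrite -EFinD lee_fin addr_ge0.
- by apply: emeasurable_funD; exact: mi.
rewrite ge0_integralD//; [|exact: mi|exact: mi].
rewrite !integral_indic//= !setIT !itv2 -EFinD -EFinM lee_fin.
by lra.
Qed.

Lemma integral_expR_mixture {R : realType} (a b : R) : 0 < a -> 0 < b ->
  (\int[lebesgue_measure]_t (Num.min (expR (a * (t : R))) (expR (- (b * (t : R)))))%:E <=
   (a^-1 + b^-1)%:E)%E.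
Proof.
move=> a0 b0.
have mpdf (c : R) : measurable_fun [set: R] (fun x => (exponential_pdf c x)%:E).
  by apply/measurable_EFinP; exact: measurable_exponential_pdf.
have mpdfN (c : R) : measurable_fun [set: R] (fun x => (exponential_pdf c (- x))%:E).
  by apply: (measurableT_comp (mpdf c)); exact: measurable_funN.
have ppdf (c x : R) : 0 < c -> (0 <= (exponential_pdf c x)%:E)%E.
  by move=> c0; rewrite lee_fin exponential_pdf_ge0// ltW.
apply: (@le_trans _ _ (\int[lebesgue_measure]_t
   ((a^-1)%:E * (exponential_pdf a (- (t : R)))%:E + (b^-1)%:E * (exponential_pdf b (t : R))%:E))%E).
  apply: ge0_le_integral => //.
  - apply/measurable_EFinP; apply: measurable_minr; apply: measurableT_comp => //.
    by apply: measurableT_comp => //; exact: measurable_funM.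
  - by apply: emeasurable_funD; apply: emeasurable_funM => //; [exact: mpdfN|exact: mpdf].
  - move=> t _; rewrite -!EFinM -EFinD lee_fin.
    have h (c x : R) : 0 < c -> 0 <= c^-1 * exponential_pdf c x.
      by move=> c0; rewrite mulr_ge0 ?invr_ge0 ?exponential_pdf_ge0// ltW.
    have e (c x : R) : 0 < c -> 0 <= x -> c^-1 * exponential_pdf c x = expR (- c * x).
      by move=> c0 x0; rewrite exponential_pdfE// mulrA mulVf ?gt_eqF// mul1r.
    have [t0|t0] := leP 0 (t : R).
      by rewrite (e b)// ge_min; apply/orP; right; rewrite mulNr lerDr h.
    rewrite e//; last by rewrite oppr_ge0 ltW.
    by rewrite mulrNN ge_min; apply/orP; left; rewrite lerDl h.
have ia : (\int[lebesgue_measure]_t (exponential_pdf a (- (t : R)))%:E = 1)%E.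
  by rewrite (@ge0_integral_lebesgueN _ (fun x : R => (exponential_pdf a x)%:E)) ?integral_exponential_pdf// => x; exact: ppdf.
rewrite ge0_integralD//; last 4 first.
- by move=> t _; rewrite mule_ge0// ?ppdf// lee_fin invr_ge0 ltW.
- by apply: emeasurable_funM => //; exact: mpdfN.
- by move=> t _; rewrite mule_ge0// ?ppdf// lee_fin invr_ge0 ltW.
- by apply: emeasurable_funM => //; exact: mpdf.
have ai : 0 <= a^-1 by rewrite invr_ge0 ltW.
have bi : 0 <= b^-1 by rewrite invr_ge0 ltW.
rewrite !ge0_integralZl_EFin// ?ia ?integral_exponential_pdf//.
- by rewrite !mule1 -EFinD.
- by move=> t _; exact: ppdf.
- exact: mpdf.
- by move=> t _; exact: ppdf.
- exact: mpdfN.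
Qed.

(* Substituting t + ln s for t scales the integral below by [s `^ (2 * alpha)]. *)
Lemma scale_mixture {R : realType} (alpha K : R) (Psi : R -> \bar R) :
  0 < alpha < 1 -> measurable_fun [set: R] Psi -> (forall s, 0 <= Psi s)%E ->
  (forall s, Psi s <= (K * Num.min 1 (s ^+ 2))%:E)%E ->
  exists C : R, 0 <= C /\ forall s, 0 <= s ->
    (\int[lebesgue_measure]_t ((expR (2 * alpha * (t : R)))%:E * Psi (s * expR (- (t : R)))%R) =
     (C * s `^ (2 * alpha))%:E)%E.
Proof.
move=> /andP[a0 a1] mPsi Psi0 PsiK.
have mI (s : R) : measurable_fun [set: R] (fun t : R => (expR (2 * alpha * t))%:E * Psi (s * expR (- t))%R)%E.
  apply: emeasurable_funM.
    by apply/measurable_EFinP; apply: measurableT_comp => //; exact: measurable_funM.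
  apply: (measurableT_comp mPsi); apply: measurable_funM => //.
  by apply: measurableT_comp => //; exact: measurable_funN.
have pI (s t : R) : (0 <= (expR (2 * alpha * t))%:E * Psi (s * expR (- t))%R)%E.
  by rewrite mule_ge0// lee_fin expR_ge0.
have K0 : 0 <= K.
  have := le_trans (Psi0 1) (PsiK 1); rewrite lee_fin expr1n.
  by rewrite (_ : Num.min 1 1 = 1 :> R) ?mulr1//; exact: min_idPl.
set I := (\int[lebesgue_measure]_t ((expR (2 * alpha * (t : R)))%:E * Psi (expR (- (t : R)))%R))%E.
have I0 : (0 <= I)%E.
  by apply: integral_ge0 => t _; have := pI 1 t; rewrite mul1r.
(* Here [0 < alpha < 1] is used: the integrand decays at rate [2 * alpha] towards minus infinity and
   [2 - 2 * alpha] towards plus infinity. *)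
have IK : (I <= (K * ((2 * alpha)^-1 + (2 - 2 * alpha)^-1))%:E)%E.
  rewrite EFinM; apply: (@le_trans _ _ (K%:E * \int[lebesgue_measure]_t
      (Num.min (expR ((2 * alpha) * (t : R))) (expR (- ((2 - 2 * alpha) * (t : R)))))%:E)%E); last first.
    by apply: lee_wpmul2l; [rewrite lee_fin|apply: integral_expR_mixture; lra].
  have mm : measurable_fun [set: R] (fun t : R =>
      (Num.min (expR ((2 * alpha) * t)) (expR (- ((2 - 2 * alpha) * t))))%:E).
    apply/measurable_EFinP; apply: measurable_minr; apply: measurableT_comp => //.
    by apply: measurableT_comp => //; exact: measurable_funM.
  rewrite -ge0_integralZl_EFin//.
  apply: ge0_le_integral => //.
  - by move=> t _; have := pI 1 t; rewrite mul1r.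
  - by have := mI 1; under eq_fun do rewrite mul1r.
  - by apply: emeasurable_funM.
  - move=> t _; rewrite (@le_trans _ _ ((expR (2 * alpha * t))%:E *
       (K * Num.min 1 (expR (- (t : R)) ^+ 2))%:E)%E)//.
      by apply: lee_wpmul2l => //; rewrite lee_fin expR_ge0.
    rewrite -!EFinM lee_fin mulrCA ler_wpM2l// minr_pMr ?expR_ge0// mulr1.
    rewrite -expRM_natr -expRD.
    by rewrite (_ : 2 * alpha * (t : R) + - (t : R) * 2 = - ((2 - 2 * alpha) * (t : R)))//; ring.
exists (fine I); split; first exact: fine_ge0.
have If : I \is a fin_num by rewrite ge0_fin_numE// (le_lt_trans IK)// ltry.
move=> s; rewrite le_eqVlt => /predU1P[<-|s0].
  rewrite powR0 ?mulr0; last by rewrite gt_eqF// mulr_gt0.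
  have P0 : Psi 0 = 0%E.
    apply/eqP; rewrite eq_le Psi0 andbT (le_trans (PsiK 0))// expr0n.
    by rewrite (_ : Num.min 1 0 = 0 :> R) ?mulr0//; exact/min_idPr.
  by under eq_integral do rewrite mul0r P0 mule0; rewrite integral0.
have sE : expR (ln s) = s by rewrite lnK.
rewrite -(@ge0_integral_translate _ (fun t : R => (expR (2 * alpha * t))%:E * Psi (s * expR (- t))%R)%E (ln s))//.
transitivity (\int[lebesgue_measure]_t ((s `^ (2 * alpha))%:E *
    ((expR (2 * alpha * (t : R)))%:E * Psi (expR (- (t : R)))%R)))%E.
  apply: eq_integral => t _.
  have -> : s * expR (- ((t : R) + ln s)) = expR (- (t : R)).
    by rewrite opprD expRD (expRN (ln s)) sE mulrCA divff ?gt_eqF// mulr1.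
  rewrite muleA -EFinM; congr (EFin _ * _)%E.
  by rewrite /powR gt_eqF// -expRD; congr expR; ring.
rewrite ge0_integralZl_EFin//.
- by rewrite -/I -{1}(fineK If) -EFinM mulrC.
- by move=> t _; have := pI 1 t; rewrite mul1r.
- by have := mI 1; under eq_fun do rewrite mul1r.
- exact: powR_ge0.
Qed.

(** Expanding the squares of the differences, the terms in [F j ^+ 2] cancel because the [a j] sum
    to 0. Only differences have to be square integrable; the features used below are not so
    themselves. *)
Lemma integral_sqr_sum0 d {M : measurableType d} {R : realType} (m : {measure set M -> \bar R})
    (n : nat) (F : 'I_n -> M -> R) (D : 'I_n -> 'I_n -> R) (a : 'I_n -> R) :
  (forall j, measurable_fun [set: M] (F j)) ->
  (forall j k, (\int[m]_y ((F j y - F k y) ^+ 2)%:E = (D j k)%:E)%E) ->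
  \sum_j a j = 0 ->
  (\int[m]_y ((\sum_j a j * F j y) ^+ 2)%:E =
   (- 2^-1 * \sum_j \sum_k a j * a k * D j k)%:E)%E.
Proof.
move=> mF FD a0.
have iD j k : m.-integrable [set: M] (fun y => ((F j y - F k y) ^+ 2)%:E).
  apply/integrableP; split.
    by apply/measurable_EFinP; apply: measurable_funX; exact: measurable_funB.
  under eq_integral do rewrite gee0_abs ?lee_fin ?sqr_ge0//.
  by rewrite FD ltry.
have iDa (p : 'I_n * 'I_n) : m.-integrable [set: M]
    (fun y => (- 2^-1 * (a p.1 * a p.2))%:E * ((F p.1 y - F p.2 y) ^+ 2)%:E)%E.
  exact: integrableZl.
transitivity (\int[m]_y (\sum_(p : 'I_n * 'I_n)
    (- 2^-1 * (a p.1 * a p.2))%:E * ((F p.1 y - F p.2 y) ^+ 2)%:E))%E.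
  apply: eq_integral => y _.
  under [RHS]eq_bigr do rewrite -EFinM.
  rewrite sumEFin; congr EFin.
  rewrite -(pair_bigA _ (fun j k => - 2^-1 * (a j * a k) * (F j y - F k y) ^+ 2))/=.
  pose S1 := \sum_j a j * F j y; pose S2 := \sum_j a j * F j y ^+ 2.
  transitivity (\sum_j (a j * F j y * S1 - 2^-1 * S2 * a j - 2^-1 * (a j * F j y ^+ 2) * \sum_k a k)).
    by rewrite !sumrB -mulr_suml -mulr_sumr a0 -/S1 big1 ?mulr0 ?subr0 ?expr2// => j _; rewrite mulr0.
  apply: eq_bigr => j _; rewrite /S1 /S2 !mulr_sumr mulr_suml -!sumrB.
  by apply: eq_bigr => k _; field.
rewrite integral_sum//.
under eq_bigr do rewrite integralZl// FD -EFinM.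
rewrite sumEFin; congr EFin.
rewrite -(pair_bigA _ (fun j k => - 2^-1 * (a j * a k) * D j k))/= mulr_sumr.
by apply: eq_bigr => j _; rewrite mulr_sumr; apply: eq_bigr => k _; field.
Qed.

Lemma measurable_tent_sqr d {M : measurableType d} {R : realType} (f g : M -> R) :
  measurable_fun [set: M] f -> measurable_fun [set: M] g ->
  measurable_fun [set: M] (fun y => ((tent (f y) - tent (g y)) ^+ 2)%:E).
Proof.
move=> mf mg; apply/measurable_EFinP; apply: measurable_funX; apply: measurable_funB.
  exact: (measurableT_comp measurable_tent).
exact: (measurableT_comp measurable_tent).
Qed.

Definition tent_diff {R : realType} (z : R) : \bar R :=
  (\int[lebesgue_measure]_v ((tent ((v : R) - z) - tent (v : R)) ^+ 2)%:E)%E.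

Lemma tent_diff_ge0 {R : realType} (z : R) : (0 <= tent_diff z)%E.
Proof. by apply: integral_ge0 => v _; rewrite lee_fin sqr_ge0. Qed.

Lemma measurable_tent_diff {R : realType} : measurable_fun [set: R] (@tent_diff R).
Proof.
have := @measurable_fun_fubini_tonelli_F _ _ (measurableTypeR R) (measurableTypeR R) R
  (@lebesgue_measure R) (fun zv => ((tent (zv.2 - zv.1) - tent zv.2) ^+ 2)%:E).
apply.
- apply: measurable_tent_sqr; last exact: measurable_snd.
  by apply: measurable_funB; [exact: measurable_snd|exact: measurable_fst].
- by move=> x; rewrite lee_fin sqr_ge0.
Qed.

Lemma tent_diff_shift {R : realType} (a b : R) :
  (\int[lebesgue_measure]_v ((tent ((v : R) - a) - tent ((v : R) - b)) ^+ 2)%:E =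
   tent_diff (a - b))%E.
Proof.
rewrite -(@ge0_integral_translate _ (fun v : R => ((tent (v - a) - tent (v - b)) ^+ 2)%:E) b).
- apply: eq_integral => v _; congr (EFin ((tent _ - tent _) ^+ 2)); ring.
- by apply: measurable_tent_sqr; exact: measurable_funB.
- by move=> x; rewrite lee_fin sqr_ge0.
Qed.

(** The projection of a vector of length [s] on a random Gaussian direction has the law of [s * x].
    This is thus the mean squared increment as a function of the length alone. *)
Definition gauss_tent_diff {R : realType} (s : R) : \bar R :=
  (\int[normal_prob 0 1]_x tent_diff (s * (x : R))%R)%E.

Lemma gauss_tent_diff_le {R : realType} (s : R) :
  (gauss_tent_diff s <= (4 * Num.min 1 (s ^+ 2))%:E)%E.
Proof.
have mt : measurable_fun [set: R] (fun x : R => tent_diff (s * x)).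
  by apply: (measurableT_comp measurable_tent_diff); exact: measurable_funM.
have mx : measurable_fun [set: R] (fun x : R => (x ^+ 2)%:E : \bar R).
  by apply/measurable_EFinP; exact: measurable_funX.
rewrite minr_pMr// mulr1 EFin_min le_min; apply/andP; split.
  apply: (@le_trans _ _ (\int[normal_prob (0 : R) 1]_(x in [set: R]) 4%:E)%E).
    apply: ge0_le_integral => //; first by move=> x _; exact: tent_diff_ge0.
    move=> x _; apply: (le_trans (integral_tent_diff _)).
    by rewrite lee_fin ler_piMr// ge_min lexx.
  by rewrite integral_cst//= probability_setT mule1.
apply: (@le_trans _ _ (\int[normal_prob 0 1]_x ((4 * s ^+ 2)%:E * ((x : R) ^+ 2)%:E))%E).
  apply: ge0_le_integral => //; first by move=> x _; exact: tent_diff_ge0.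
    by apply: emeasurable_funM.
  move=> x _; apply: (le_trans (integral_tent_diff _)).
  rewrite -EFinM lee_fin (_ : 4 * s ^+ 2 * (x : R) ^+ 2 = 4 * (s * (x : R)) ^+ 2); last by ring.
  by apply: ler_wpM2l => //; rewrite ge_min lexx orbT.
rewrite ge0_integralZl_EFin//.
- by rewrite [X in (_ * X)%E](_ : _ = 1%E) ?mule1//; exact: gauss_moment2.
- by move=> x _; rewrite lee_fin sqr_ge0.
- by rewrite mulr_ge0// sqr_ge0.
Qed.

Lemma measurable_gauss_tent_diff {R : realType} : measurable_fun [set: R] (@gauss_tent_diff R).
Proof.
have := @measurable_fun_fubini_tonelli_F _ _ (measurableTypeR R) (measurableTypeR R) R
  (normal_prob 0 1) (fun zv => tent_diff (zv.1 * zv.2)).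
apply; last by move=> x; exact: tent_diff_ge0.
apply: (measurableT_comp measurable_tent_diff).
by apply: measurable_funM; [exact: measurable_fst|exact: measurable_snd].
Qed.

Lemma gauss_tent_diff_ge0 {R : realType} (s : R) : (0 <= gauss_tent_diff s)%E.
Proof. by apply: integral_ge0 => x _; exact: tent_diff_ge0. Qed.

Lemma product_sigma_finite d1 d2 (T1 : measurableType d1) (T2 : measurableType d2)
    (R : realType) (m1 : {sigma_finite_measure set T1 -> \bar R})
    (m2 : {sigma_finite_measure set T2 -> \bar R}) : sigma_finite setT (m1 \x m2)%E.
Proof.
have /sigma_finiteP[F [FT Fnd Foo]] := sigma_finiteT m1.
have /sigma_finiteP[G [GT Gnd Goo]] := sigma_finiteT m2.
exists (fun n => F n `*` G n) => [|n].
  apply/seteqP; split=> // -[x y] _.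
  have : setT x by []. rewrite FT => -[i _ Fi].
  have : setT y by []. rewrite GT => -[j _ Gj].
  exists (maxn i j) => //; split=> /=.
    by move: (x) Fi; apply/subsetPset/Fnd/leq_maxl.
  by move: (y) Gj; apply/subsetPset/Gnd/leq_maxr.
have [mF Fn] := Foo n; have [mG Gn] := Goo n.
split; first exact: measurableX.
by rewrite product_measure1E// lte_mul_pinfty// ge0_fin_numE.
Qed.

(* [\x] carries a sigma-finite structure in the library only for probabilities,
   hence the explicit packing. *)
Section fubini_tonelli1_sigma_finite.
Context d1 d2 (T1 : measurableType d1) (T2 : measurableType d2) (R : realType).
Context (m1 : {measure set T1 -> \bar R}) (m2 : {sigma_finite_measure set T2 -> \bar R}).
Hypothesis sm1 : sigma_finite setT m1.

Let m : set T1 -> \bar R := m1.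
HB.instance Definition _ := Measure.on m.
HB.instance Definition _ := Measure_isSigmaFinite.Build _ _ _ m sm1.

Lemma fubini_tonelli1_sigma_finite (f : T1 * T2 -> \bar R) :
  measurable_fun setT f -> (forall u, (0 <= f u)%E) ->
  (\int[m1 \x m2]_u f u = \int[m1]_y \int[m2]_z f (y, z))%E.
Proof. exact: (@fubini_tonelli1 _ _ _ _ _ m m2 f). Qed.

End fubini_tonelli1_sigma_finite.

Lemma fubini_tonelli_pair d1 d2 d3 (T1 : measurableType d1) (T2 : measurableType d2)
    (T3 : measurableType d3) (R : realType) (m1 : {sigma_finite_measure set T1 -> \bar R})
    (m2 : {sigma_finite_measure set T2 -> \bar R}) (m3 : {sigma_finite_measure set T3 -> \bar R})
    (f : T1 * T2 * T3 -> \bar R) :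
  measurable_fun setT f -> (forall u, (0 <= f u)%E) ->
  (\int[(m1 \x m2) \x m3]_u f u = \int[m1 \x m2]_y \int[m3]_z f (y, z))%E.
Proof. exact: (fubini_tonelli1_sigma_finite m3 (product_sigma_finite m1 m2)). Qed.

Section local_nondeterminism.
Context {R : realType} (N : nat).
Context d {T : measurableType d} (P : probability T R) (g : 'I_N -> T -> R).
Hypothesis mg : forall j, measurable_fun [set: T] (g j).
Hypothesis gP : forall (z : 'rV[R]_N) (f : R -> R), continuous f -> (forall x, 0 <= f x) ->
    (\int[P]_w (f (\sum_j g j w * z 0 j))%:E =
     \int[normal_prob 0 1]_x (f (euclidean_norm z * (x : R)))%:E)%E.

Let proj (z : 'rV[R]_N) w := \sum_j g j w * z 0 j.

Let mproj z : measurable_fun [set: T] (proj z).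
Proof. by apply: measurable_sum => j; exact: measurable_funM. Qed.

Let projB y z w : proj y w - proj z w = proj (y - z) w.
Proof. by rewrite /proj -sumrB; apply: eq_bigr => j _; rewrite !mxE mulrBr. Qed.

Let tent_diff_proj (z : 'rV[R]_N) (t : R) :
  (\int[P]_w tent_diff (t * proj z w)%R = gauss_tent_diff (euclidean_norm z * t)%R)%E.
Proof.
rewrite /gauss_tent_diff /tent_diff.
rewrite (@fubini_tonelli _ _ T (measurableTypeR R) R P lebesgue_measure
  (fun wv => ((tent ((wv.2 : R) - t * proj z wv.1) - tent (wv.2 : R)) ^+ 2)%:E))/=; last 2 first.
- apply: measurable_tent_sqr; last exact: measurable_snd.
  apply: measurable_funB; first exact: measurable_snd.
  by apply: measurable_funM => //; exact: measurableT_comp (mproj z) _.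
- by move=> x; rewrite lee_fin sqr_ge0.
rewrite (@fubini_tonelli _ _ (measurableTypeR R) (measurableTypeR R) R (normal_prob 0 1) lebesgue_measure
  (fun wv => ((tent ((wv.2 : R) - euclidean_norm z * t * (wv.1 : R)) - tent (wv.2 : R)) ^+ 2)%:E))/=; last 2 first.
- apply: measurable_tent_sqr; last exact: measurable_snd.
  apply: measurable_funB; first exact: measurable_snd.
  by apply: measurable_funM => //; exact: measurable_fst.
- by move=> x; rewrite lee_fin sqr_ge0.
apply: eq_integral => v _.
rewrite (gP z (f := fun u => (tent ((v : R) - t * u) - tent (v : R)) ^+ 2)).
- apply: eq_integral => x _; congr (EFin ((tent _ - _) ^+ 2)); ring.
- move=> u; apply: (@continuous_comp _ _ _ (fun u => tent ((v : R) - t * u) - tent (v : R)) (fun x => x ^+ 2)); last exact: sqr_continuous.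
  apply: (@cvgB _ R^o); last exact: cvg_cst.
  apply: (@continuous_comp _ _ _ (fun u => (v : R) - t * u) (@tent R)); last exact: continuous_tent.
  by apply: (@cvgB _ R^o); [exact: cvg_cst|exact: continuous_scale].
- by move=> u; exact: sqr_ge0.
Qed.

(* As 1_(|u| < 1) <= 2 exp (- u^2 / 2), this bounds the probability that [|proj z| < e]. *)
Let proj_small (z : 'rV[R]_N) (e : R) : 0 < e -> 0 < euclidean_norm z ->
  (\int[P]_w (2 * expR (- ((proj z w / e) ^+ 2 / 2)))%:E <= (2 * e / euclidean_norm z)%:E)%E.
Proof.
move=> e0 z0; set D := euclidean_norm z.
rewrite (gP z (f := fun u => 2 * expR (- ((u / e) ^+ 2 / 2)))); last 2 first.
- move=> u; apply: cvgM; first exact: cvg_cst.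
  apply: (cvg_comp _ expR); last exact: continuous_expR.
  apply: (@cvgN _ R^o); apply: cvgM; last exact: cvg_cst.
  apply: (cvg_comp (fun u => u / e) (fun x => x ^+ 2)); last exact: sqr_continuous.
  by apply: cvgM; [exact: cvg_id|exact: cvg_cst].
- by move=> u; rewrite mulr_ge0// expR_ge0.
under eq_integral => x _.
  rewrite (_ : - ((D * (x : R) / e) ^+ 2 / 2) =
    - (0 + 2 * 0 * (x : R) + (D / e) ^+ 2 * x ^+ 2) / 2); last by field; rewrite gt_eqF.
  rewrite EFinM.
  over.
have De : 0 < D / e by rewrite divr_gt0.
rewrite ge0_integralZl_EFin//; last first.
  apply/measurable_EFinP; apply: measurableT_comp => //; apply: measurable_funM => //.
  apply: measurableT_comp => //; apply: measurable_funD => //; first exact: measurable_funD.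
  by apply: measurable_funM => //; exact: measurable_funX.
rewrite integral_gaussian_quadratic; last by rewrite (lt_le_trans _ (sqr_ge0 _)).
rewrite expr0n mul0r subr0 oppr0 mul0r expR0 mulr1 -EFinM lee_fin -mulrA ler_wpM2l//.
rewrite -[leRHS]invrK invf_div lef_pV2 ?posrE ?sqrtr_gt0//; last by rewrite ltr_pwDl// sqr_ge0.
by rewrite -[leLHS](gtr0_norm De) -sqrtr_sqr ler_wsqrtr// lerDr.
Qed.

Lemma euclidean_norm_ge0 n (z : 'rV[R]_n) : 0 <= euclidean_norm z.
Proof. exact: sqrtr_ge0. Qed.

(** A point of the base space is a logarithmic scale, a direction and a position. The exponential
    factor gives the squared distance of two features the homogeneity [2 * alpha], which makes it a
    multiple of the variance of the increment of the field. *)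
Let feature (alpha : R) (x : 'rV[R]_N) (y : measurableTypeR R * T * measurableTypeR R) : R :=
  expR (alpha * (y.1.1 : R)) * tent ((y.2 : R) - expR (- (y.1.1 : R)) * proj x y.1.2).

Let mfeature alpha x : measurable_fun setT (feature alpha x).
Proof.
have m1 : measurable_fun [set: measurableTypeR R * T * measurableTypeR R] (fun y => y.1.1 : R).
  exact: measurableT_comp measurable_fst measurable_fst.
have m2 : measurable_fun [set: measurableTypeR R * T * measurableTypeR R] (fun y => y.1.2).
  exact: measurableT_comp measurable_snd measurable_fst.
apply: measurable_funM.
  by apply: measurableT_comp => //; exact: measurable_funM.
apply: (measurableT_comp measurable_tent); apply: measurable_funB; first exact: measurable_snd.
apply: measurable_funM; last exact: measurableT_comp (mproj x) m2.
by apply: measurableT_comp => //; exact: measurable_funN.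
Qed.

Let feature_dist (alpha : R) (x y : 'rV[R]_N) :
  (\int[(@lebesgue_measure R \x P) \x lebesgue_measure]_u ((feature alpha x u - feature alpha y u) ^+ 2)%:E =
   \int[lebesgue_measure]_t ((expR (2 * alpha * (t : R)))%:E *
      gauss_tent_diff (euclidean_norm (x - y) * expR (- (t : R)))%R))%E.
Proof.
have mF : measurable_fun [set: measurableTypeR R * T * measurableTypeR R]
    (fun u => ((feature alpha x u - feature alpha y u) ^+ 2)%:E : \bar R).
  apply/measurable_EFinP; apply: measurable_funX.
  by apply: measurable_funB; exact: mfeature.
have sqE (t v : R) w : (feature alpha x (t, w, v) - feature alpha y (t, w, v)) ^+ 2 =
   expR (2 * alpha * t) * (tent (v - expR (- t) * proj x w) - tent (v - expR (- t) * proj y w)) ^+ 2.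
  rewrite /feature/= -mulrBr exprMn -expRM_natr; congr (expR _ * _); ring.
have mt (t : R) (w : T) : measurable_fun [set: R] (fun v : R =>
    ((tent (v - expR (- t) * proj x w) - tent (v - expR (- t) * proj y w)) ^+ 2)%:E).
  by apply: measurable_tent_sqr; exact: measurable_funB.
have inE (t : R) w : (\int[lebesgue_measure]_v ((feature alpha x (t, w, (v : R)) -
     feature alpha y (t, w, v)) ^+ 2)%:E =
   (expR (2 * alpha * t))%:E * tent_diff (expR (- t) * proj (x - y) w)%R)%E.
  under eq_integral do rewrite sqE EFinM.
  rewrite ge0_integralZl_EFin ?expR_ge0//; last 2 first.
  - by move=> v _; rewrite lee_fin sqr_ge0.
  - exact: mt.
  by rewrite tent_diff_shift -mulrBr projB.
have md (t : R) : measurable_fun [set: T] (fun w => tent_diff (expR (- t) * proj (x - y) w)).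
  by apply: (measurableT_comp measurable_tent_diff); exact: measurable_funM.
transitivity (\int[(@lebesgue_measure R \x P)]_tw (\int[lebesgue_measure]_v
   ((feature alpha x (tw, v) - feature alpha y (tw, v)) ^+ 2)%:E))%E.
  have F0 u : (0 <= ((feature alpha x u - feature alpha y u) ^+ 2)%:E)%E by rewrite lee_fin sqr_ge0.
  exact: (fubini_tonelli_pair _ _ _ mF F0).
transitivity (\int[(@lebesgue_measure R \x P)]_tw ((expR (2 * alpha * (tw.1 : R)))%:E *
    tent_diff (expR (- (tw.1 : R)) * proj (x - y) tw.2)%R))%E.
  by apply: eq_integral => -[t w] _; rewrite inE.
have m2 : measurable_fun [set: measurableTypeR R * T] (fun y => y.2) by exact: measurable_snd.
rewrite fubini_tonelli1/=; last 2 first.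
- apply: emeasurable_funM.
    by apply/measurable_EFinP; apply: measurableT_comp => //; exact: measurable_funM.
  apply: (measurableT_comp measurable_tent_diff); apply: measurable_funM.
    by apply: measurableT_comp => //; exact: measurable_funN.
  exact: measurableT_comp (mproj _) m2.
- by move=> u; rewrite mule_ge0// ?tent_diff_ge0// lee_fin expR_ge0.
apply: eq_integral => t _; rewrite /fubini_F/=.
rewrite ge0_integralZl_EFin ?expR_ge0//; last by move=> w _; exact: tent_diff_ge0.
by rewrite tent_diff_proj.
Qed.

Let feature_norm (alpha : R) : 0 < alpha < 1 -> exists C : R, forall x y,
  (\int[(@lebesgue_measure R \x P) \x lebesgue_measure]_u ((feature alpha x u - feature alpha y u) ^+ 2)%:E =
   (C * euclidean_norm (x - y) `^ (2 * alpha))%:E)%E.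
Proof.
move=> a01; have [C [_ CP]] := scale_mixture a01 measurable_gauss_tent_diff
  (@gauss_tent_diff_ge0 R) (@gauss_tent_diff_le R).
by exists C => x y; rewrite feature_dist CP// euclidean_norm_ge0.
Qed.

(** At scales comparable to [delta / n] at least half of the directions separate the projection of
    [x i] from all others by more than the tents reach, and only the term of [x i] survives. The
    factor 8 is 4 from the square of [tent >= 1 / 2], times 2 from the directions. *)
Let feature_lower (alpha : R) (n : nat) (x : 'I_n -> 'rV[R]_N) (a : 'I_n -> R) (i : 'I_n) (delta : R) :
  0 < alpha -> 0 < delta -> (forall j, j != i -> delta <= euclidean_norm (x i - x j)) ->
  ((8^-1 * ((8 * n%:R)^-1 / expR 1) `^ (2 * alpha) * a i ^+ 2 * delta `^ (2 * alpha))%:E <=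
   \int[(@lebesgue_measure R \x P) \x lebesgue_measure]_u
     ((\sum_j a j * feature alpha (x j) u) ^+ 2)%:E)%E.
Proof.
move=> a0 d0 xd.
have n0 : 0 < n%:R :> R by rewrite ltr0n (leq_ltn_trans (leq0n i)).
(* Each [j] then excludes directions of probability at most [2 * e / delta = (2 * n%:R)^-1], so all
   of them together at most one half. *)
pose e := delta / (4 * n%:R); have e0 : 0 < e by rewrite divr_gt0// mulr_gt0.
(* For [t <= s] the scaling [expR (- t)] is at least [2 / e], so projections separated by [e] come
   to lie at distance at least 2. *)
pose s := ln (e / 2); have sE : expR s = e / 2 by rewrite lnK// posrE divr_gt0.
pose f j w := 2 * expR (- ((proj (x i - x j) w / e) ^+ 2 / 2)).
have f0 j w : 0 <= f j w by rewrite mulr_ge0// expR_ge0.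
have mf j : measurable_fun [set: T] (f j).
  apply: measurable_funM => //; apply: measurableT_comp => //; apply: measurableT_comp => //.
  by apply: measurable_funM => //; apply: measurable_funX; exact: measurable_funM.
(* A minorant of the indicator of the good directions: [f j w] is at least 1 as soon as the
   projection of [x i - x j] is below [e], and then [h w] is 0. *)
pose h w := Num.max 0 (1 - \sum_(j < n | j != i) f j w).
have h0 w : 0 <= h w by rewrite /h le_max lexx.
have mh : measurable_fun [set: T] h.
  apply: measurable_maxr => //; apply: measurable_funB => //.
  under eq_fun do rewrite big_mkcond.
  by apply: measurable_sum => j; case: (j != i).
have inth : ((2^-1)%:E <= \int[P]_w (h w)%:E)%E.
  have sumf : (\int[P]_w (\sum_(j < n | j != i) f j w)%:E <= (2^-1)%:E)%E.
    under eq_integral do rewrite -sumEFin -big_filter.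
    rewrite ge0_integral_sum//; last 2 first.
    - by move=> j; exact/measurable_EFinP.
    - by move=> j w _; rewrite lee_fin.
    rewrite big_filter.
    apply: (@le_trans _ _ (\sum_(j < n | j != i) ((2 * n%:R)^-1)%:E)%E).
      apply: lee_sum => j ji; have dj := xd j ji.
      have nj : 0 < euclidean_norm (x i - x j) by exact: lt_le_trans dj.
      apply: (le_trans (proj_small e0 nj)); rewrite lee_fin ler_pdivrMr//.
      rewrite (@le_trans _ _ ((2 * n%:R)^-1 * delta))// ?ler_wpM2l// ?invr_ge0 ?mulr_ge0//.
      by rewrite /e le_eqVlt; apply/orP; left; apply/eqP; field; rewrite gt_eqF.
    rewrite sumEFin lee_fin (@le_trans _ _ (\sum_(j < n) (2 * n%:R)^-1))//.
      by rewrite [leLHS]big_mkcond ler_sum// => j _; case: ifP => // _; rewrite invr_ge0 mulr_ge0.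
    rewrite sumr_const card_ord -mulr_natl le_eqVlt; apply/orP; left; apply/eqP; field.
    by rewrite gt_eqF.
  have msf : measurable_fun [set: T] (fun w => (\sum_(j < n | j != i) f j w)%:E : \bar R).
    apply/measurable_EFinP; under eq_fun do rewrite big_mkcond.
    by apply: measurable_sum => j; case: (j != i).
  have : (1 <= \int[P]_w (h w)%:E + \int[P]_w (\sum_(j < n | j != i) f j w)%:E)%E.
    rewrite -ge0_integralD//.
    + rewrite (@le_trans _ _ (\int[P]_(w in [set: T]) 1%:E)%E)//.
        by rewrite integral_cst//= probability_setT mule1.
      apply: ge0_le_integral => //.
      * by apply: emeasurable_funD => //; exact/measurable_EFinP.
      * move=> w _; rewrite -EFinD lee_fin.
        have : 1 - \sum_(j < n | j != i) f j w <= h w by rewrite le_max lexx orbT.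
        by lra.
    + by move=> w _; rewrite lee_fin.
    + exact/measurable_EFinP.
    + by move=> w _; rewrite lee_fin sumr_ge0.
  have : (0 <= \int[P]_w (\sum_(j < n | j != i) f j w)%:E)%E.
    by apply: integral_ge0 => w _; rewrite lee_fin sumr_ge0.
  have : (0 <= \int[P]_w (h w)%:E)%E by apply: integral_ge0 => w _; rewrite lee_fin.
  case: (\int[P]_w (h w)%:E)%E => [u| |]//; last by move=> *; rewrite leey.
  move: sumf; case: (\int[P]_w (\sum_(j < n | j != i) f j w)%:E)%E => [v| |]//.
  by rewrite -EFinD !lee_fin => h1 _ _ h2; lra.
pose K := a i ^+ 2 * expR (2 * alpha * (s - 1)) / 4.
have K0 : 0 <= K by rewrite divr_ge0// mulr_ge0 ?sqr_ge0// expR_ge0.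
pose c (tw : measurableTypeR R * T) : R := expR (- (tw.1 : R)) * proj (x i) tw.2.
pose I1 (t : R) : R := \1_(`[s - 1, s]%classic) t.
pose I2 (v : R) : R := \1_(`[- 2^-1, 2^-1]%classic) v.
have I20 t : 0 <= I2 t by rewrite /I2.
have mI1 : measurable_fun [set: R] I1 by exact: measurable_indic.
have mI2 : measurable_fun [set: R] I2 by exact: measurable_indic.
pose G (u : measurableTypeR R * T * measurableTypeR R) : R :=
  K * I1 u.1.1 * h u.1.2 * I2 ((u.2 : R) - c u.1).
have m1 : measurable_fun [set: measurableTypeR R * T * measurableTypeR R] (fun y => y.1.1 : R).
  exact: measurableT_comp measurable_fst measurable_fst.
have m2 : measurable_fun [set: measurableTypeR R * T * measurableTypeR R] (fun y => y.1.2).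
  exact: measurableT_comp measurable_snd measurable_fst.
have mG : measurable_fun setT (fun u => (G u)%:E : \bar R).
  apply/measurable_EFinP; apply: measurable_funM; last first.
    apply: (measurableT_comp mI2); apply: measurable_funB; first exact: measurable_snd.
    apply: measurable_funM; last exact: measurableT_comp (mproj (x i)) m2.
    by apply: measurableT_comp => //; exact: measurable_funN.
  apply: measurable_funM; last exact: measurableT_comp mh m2.
  by apply: measurable_funM => //; exact: measurableT_comp mI1 m1.
have G0 u : (0 <= (G u)%:E)%E.
  rewrite lee_fin /G; apply: mulr_ge0; last exact: I20.
  by apply: mulr_ge0; [exact: mulr_ge0|exact: h0].
have GF (u : measurableTypeR R * T * measurableTypeR R) :
    G u <= (\sum_j a j * feature alpha (x j) u) ^+ 2.
  case: u => -[t w] v; rewrite /G/=.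
  have [tI|tI] := boolP ((t : R) \in `[s - 1, s]); last first.
    by rewrite /I1 indicE memNset ?mulr0 ?mul0r ?sqr_ge0//=; exact/negP.
  have [vI|vI] := boolP ((v : R) - c (t, w) \in `[- 2^-1, 2^-1]); last first.
    by rewrite /I2 indicE memNset ?mulr0 ?sqr_ge0//=; exact/negP.
  rewrite /I1 /I2 !indicE !mem_set//= !mulr1.
  move: tI vI; rewrite !in_itv/= => /andP[t1 t2] /andP[v1 v2].
  have [good|] := boolP [forall j : 'I_n, (j != i) ==> (e <= `|proj (x i - x j) w|)]; last first.
    rewrite negb_forall => /existsP[j]; rewrite negb_imply -ltNge => /andP[ji je].
    suff -> : h w = 0 by rewrite mulr0 sqr_ge0.
    apply/max_idPl; rewrite subr_le0 (bigD1 j)//=.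
    rewrite (@le_trans _ _ (f j w))//; last by rewrite lerDl sumr_ge0.
    have p1 : (proj (x i - x j) w / e) ^+ 2 <= 1.
      rewrite -real_normK ?num_real// expr_le1// normrM normfV (gtr0_norm e0).
      by rewrite ler_pdivrMr// mul1r ltW.
    by have := expR_ge1Dx (- ((proj (x i - x j) w / e) ^+ 2 / 2)); rewrite /f; lra.
  have h1 : h w <= 1 by rewrite ge_max ler01 gerBl sumr_ge0.
  rewrite (@le_trans _ _ K)//; first by rewrite ler_piMr.
  have et : 2 / e <= expR (- (t : R)).
    by rewrite -[leLHS]invrK invf_div -sE -expRN ler_expR lerN2.
  rewrite (bigD1 i)//= [X in _ + X]big1 ?addr0; last first.
    move=> j ji; rewrite /feature/= tent_out ?mulr0//.
    have /implyP/(_ ji) gj := forallP good j.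
    have h2 : 2 <= expR (- (t : R)) * `|proj (x i - x j) w|.
      rewrite (@le_trans _ _ (2 / e * e))//; first by rewrite divfK ?gt_eqF.
      by rewrite ler_pM// divr_ge0// ltW.
    have h3 : `|expR (- (t : R)) * proj (x i - x j) w| <=
       `|(v : R) - expR (- (t : R)) * proj (x j) w| + `|(v : R) - expR (- (t : R)) * proj (x i) w|.
      by rewrite -projB mulrBr (le_trans (ler_distD (v : R) _ _))// addrC lerD2l distrC.
    move: h3; rewrite normrM (ger0_norm (expR_ge0 _)).
    have : `|(v : R) - expR (- (t : R)) * proj (x i) w| <= 2^-1 by rewrite ler_norml v1 v2.
    by lra.
  rewrite /feature/= exprMn exprMn /K -mulrA ler_wpM2l ?sqr_ge0//.
  have tn : 2^-1 <= tent ((v : R) - expR (- (t : R)) * proj (x i) w).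
    by apply: tent_in; rewrite ler_norml v1 v2.
  have e4 : 4^-1 = (2^-1) ^+ 2 :> R by field.
  rewrite e4 ler_pM ?expR_ge0 ?sqr_ge0//.
    rewrite -expRM_natr ler_expR (_ : alpha * (t : R) * 2 = 2 * alpha * (t : R)); last by ring.
    by rewrite ler_wpM2l// mulr_ge0// ltW.
  by rewrite ler_sqr ?nnegrE// (le_trans _ tn).
apply: (@le_trans _ _ (\int[(@lebesgue_measure R \x P) \x lebesgue_measure]_u (G u)%:E)%E); last first.
  apply: ge0_le_integral => //.
  - apply/measurable_EFinP; apply: measurable_funX; apply: measurable_sum => j.
    by apply: measurable_funM => //; exact: mfeature.
  - by move=> u _; rewrite lee_fin GF.
have -> : (\int[(@lebesgue_measure R \x P) \x lebesgue_measure]_u (G u)%:E =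
    \int[(@lebesgue_measure R \x P)]_tw (\int[lebesgue_measure]_v (G (tw, v))%:E))%E.
  exact: (fubini_tonelli_pair _ _ _ mG G0).
have intI2 (r : R) : (\int[lebesgue_measure]_v (I2 ((v : R) - r))%:E = 1)%E.
  rewrite (@ge0_integral_translate _ (fun v : R => (I2 v)%:E))//.
  - rewrite /I2 integral_indic//= setIT lebesgue_measure_itv/= lte_fin.
    by rewrite ifT; [rewrite -EFinB; congr EFin; field|lra].
  - exact/measurable_EFinP.
have intI1 : (\int[lebesgue_measure]_t (I1 (t : R))%:E = 1)%E.
  rewrite /I1 integral_indic//= setIT lebesgue_measure_itv/= lte_fin.
  by rewrite ifT; [rewrite -EFinB; congr EFin; ring|lra].
have -> : (\int[(@lebesgue_measure R \x P)]_tw (\int[lebesgue_measure]_v (G (tw, v))%:E) =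
    \int[(@lebesgue_measure R \x P)]_tw ((I1 tw.1)%:E * (K%:E * (h tw.2)%:E)))%E.
  apply: eq_integral => -[t w] _.
  under eq_integral do rewrite /G EFinM.
  transitivity (\int[lebesgue_measure]_v ((K * I1 t * h w)%:E * (I2 ((v : R) - c (t, w)))%:E))%E => //.
  rewrite ge0_integralZl_EFin//.
  - by rewrite intI2 mule1/= -!EFinM; congr EFin; ring.
  - by move=> v _; rewrite lee_fin.
  - apply/measurable_EFinP; apply: (measurableT_comp mI2).
    exact: measurable_funB.
  - by apply: mulr_ge0 => //; exact: mulr_ge0.
rewrite fubini_tonelli1/=; last 2 first.
- apply: emeasurable_funM; first by apply/measurable_EFinP; exact: measurableT_comp mI1 _.
  apply: emeasurable_funM => //.
  by apply/measurable_EFinP; exact: measurableT_comp mh _.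
- by move=> u; rewrite !mule_ge0// lee_fin.
rewrite /fubini_F/=.
under eq_integral => t _.
  rewrite ge0_integralZl_EFin//; last 2 first.
  - by move=> w _; rewrite mule_ge0// lee_fin.
  - by apply: emeasurable_funM => //; exact/measurable_EFinP.
  rewrite ge0_integralZl_EFin//; last 2 first.
  - by move=> w _; rewrite lee_fin.
  - exact/measurable_EFinP.
  over.
rewrite ge0_integralZr//; last 3 first.
- exact/measurable_EFinP.
- by move=> t _; rewrite lee_fin.
- by rewrite mule_ge0 ?lee_fin//; apply: integral_ge0 => w _; rewrite lee_fin.
rewrite intI1 mul1e.
apply: (@le_trans _ _ (K%:E * (2^-1)%:E)%E); last by apply: lee_wpmul2l; rewrite ?lee_fin.
rewrite -EFinM lee_fin /K.
have -> : expR (2 * alpha * (s - 1)) = (((8 * n%:R)^-1 / expR 1) * delta) `^ (2 * alpha).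
  rewrite /powR gt_eqF; last by rewrite mulr_gt0// divr_gt0 ?expR_gt0// invr_gt0 mulr_gt0.
  congr (expR (_ * _)); rewrite -[LHS]expRK; congr ln; rewrite expRD expRN sE /e.
  by field; rewrite !gt_eqF ?expR_gt0.
rewrite (@powRM _ _ delta) ?(ltW d0)//.
by rewrite le_eqVlt; apply/orP; left; apply/eqP; field.
Qed.

Lemma strong_local_nondeterminism_aux (alpha : R) (n : nat) : (0 < N)%N -> 0 < alpha < 1 ->
  exists2 c : R, 0 < c & forall (x : 'I_n -> 'rV[R]_N) (a : 'I_n -> R) (i : 'I_n) (delta : R),
    \sum_j a j = 0 -> 0 < delta -> (forall j, j != i -> delta <= euclidean_norm (x i - x j)) ->
    c * a i ^+ 2 * delta `^ (2 * alpha) <=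
    - 2^-1 * \sum_j \sum_k a j * a k * euclidean_norm (x j - x k) `^ (2 * alpha).
Proof.
move=> N0 a01; have /andP[a0 a1] := a01.
have [C FC] := feature_norm a01.
pose c' (n : nat) : R := 8^-1 * ((8 * n%:R)^-1 / expR 1) `^ (2 * alpha).
have c'0 m : (0 < m)%N -> 0 < c' m.
  move=> m0; rewrite mulr_gt0// powR_gt0// divr_gt0 ?expR_gt0// invr_gt0 mulr_gt0// ltr0n.
  by [].
have main (m : nat) (x : 'I_m -> 'rV[R]_N) (a : 'I_m -> R) (i : 'I_m) (delta : R) :
    \sum_j a j = 0 -> 0 < delta -> (forall j, j != i -> delta <= euclidean_norm (x i - x j)) ->
    c' m * a i ^+ 2 * delta `^ (2 * alpha) <=
    C * (- 2^-1 * \sum_j \sum_k a j * a k * euclidean_norm (x j - x k) `^ (2 * alpha)).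
  move=> as0 d0 xd; have := feature_lower a a0 d0 xd.
  rewrite (integral_sqr_sum0 (fun j => @mfeature alpha (x j)) (fun j k => FC (x j) (x k)) as0) lee_fin.
  move=> /le_trans; apply; rewrite le_eqVlt; apply/orP; left; apply/eqP.
  rewrite mulrCA; congr (_ * _); rewrite mulr_sumr; apply: eq_bigr => j _.
  by rewrite mulr_sumr; apply: eq_bigr => k _; rewrite mulrCA.
(* The mixture constant comes without a sign. The lower bound for two points at distance 1, which
   exist because [0 < N], forces it to be positive. *)
have C0 : 0 < C.
  pose x (j : 'I_2) : 'rV[R]_N := if j == ord0 then 0 else delta_mx 0 (Ordinal N0).
  pose a (j : 'I_2) : R := if j == ord0 then 1 else - 1.
  have nx : euclidean_norm (delta_mx 0 (Ordinal N0) : 'rV[R]_N) = 1.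
    rewrite /euclidean_norm (bigD1 (Ordinal N0))//= mxE !eqxx expr1n big1 ?addr0 ?sqrtr1// => j jN.
    by rewrite mxE (negbTE jN) andbF expr0n.
  have nN (z : 'rV[R]_N) : euclidean_norm (- z) = euclidean_norm z.
    by congr Num.sqrt; apply: eq_bigr => j _; rewrite mxE sqrrN.
  have x0 : x ord0 = 0 by [].
  have x1 : x (lift ord0 ord0) = delta_mx 0 (Ordinal N0) by [].
  have y0 : a ord0 = 1 by [].
  have y1 : a (lift ord0 ord0) = -1 by [].
  have sum2 (F : 'I_2 -> R) : \sum_j F j = F ord0 + F (lift ord0 ord0).
    by rewrite big_ord_recl big_ord1.
  have as0 : \sum_j a j = 0 by rewrite sum2 y0 y1 subrr.
  have xd j : j != ord0 -> 1 <= euclidean_norm (x ord0 - x j).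
    by rewrite x0 sub0r nN /x => /negbTE ->; rewrite nx.
  have nz : euclidean_norm (0 : 'rV[R]_N) = 0.
    by rewrite /euclidean_norm big1 ?sqrtr0// => j _; rewrite mxE expr0n.
  have sum22 (F : 'I_2 -> 'I_2 -> R) : \sum_j \sum_k F j k = F ord0 ord0 +
      F ord0 (lift ord0 ord0) + (F (lift ord0 ord0) ord0 + F (lift ord0 ord0) (lift ord0 ord0)).
    by rewrite sum2; congr (_ + _); exact: sum2.
  have := @main 2%N x a ord0 1 as0 ltr01 xd.
  rewrite (sum22 (fun j k => a j * a k * euclidean_norm (x j - x k) `^ (2 * alpha))) x0 x1 y0 y1 !subr0 sub0r !subrr nN nx !powR1 nz.
  rewrite powR0 ?gt_eqF ?mulr_gt0// => h.
  by have := c'0 2%N isT; nra.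
have [->|n0] := posnP n; first by exists 1 => // x a [].
exists (c' n / C); first by rewrite divr_gt0// c'0.
move=> x a i delta as0 d0 xd.
have := main n x a i delta as0 d0 xd.
move: (- 2^-1 * _) => V h; rewrite -(ler_pM2l C0) (le_trans _ h)// le_eqVlt.
by apply/orP; left; apply/eqP; field; rewrite gt_eqF.
Qed.

End local_nondeterminism.

(* As the [a j] sum to 0, the right-hand side is the variance of [\sum_j a j * B (x j)]. *)
Lemma strong_local_nondeterminism {R : realType} (N : nat) (alpha : R) (n : nat) :
  (0 < N)%N -> 0 < alpha < 1 ->
  exists2 c : R, 0 < c & forall (x : 'I_n -> 'rV[R]_N) (a : 'I_n -> R) (i : 'I_n) (delta : R),
    \sum_j a j = 0 -> 0 < delta -> (forall j, j != i -> delta <= euclidean_norm (x i - x j)) ->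
    c * a i ^+ 2 * delta `^ (2 * alpha) <=
    - 2^-1 * \sum_j \sum_k a j * a k * euclidean_norm (x j - x k) `^ (2 * alpha).
Proof.
have [d [T [P [g [mg gP]]]]] := @isotropic_gaussian_rV R N.
exact: (strong_local_nondeterminism_aux mg gP).
Qed.

Lemma integrable_mul d {T : measurableType d} {R : realType} (m : {measure set T -> \bar R})
    (Y Z : T -> R) : measurable_fun [set: T] Y -> measurable_fun [set: T] Z ->
  m.-integrable [set: T] (fun w => (Y w ^+ 2)%:E) ->
  m.-integrable [set: T] (fun w => (Z w ^+ 2)%:E) ->
  m.-integrable [set: T] (fun w => (Y w * Z w)%:E).
Proof.
move=> mY mZ iY iZ; apply: (le_integrable measurableT _ _ (integrableD measurableT iY iZ)).
  by apply/measurable_EFinP; exact: measurable_funM.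
move=> w _; rewrite -EFinD !abse_EFin lee_fin [leRHS]ger0_norm ?addr_ge0 ?sqr_ge0//.
rewrite ler_norml; apply/andP; split.
  by have := sqr_ge0 (Y w + Z w); rewrite sqrrD; have := sqr_ge0 (Y w); have := sqr_ge0 (Z w); nra.
by have := sqr_ge0 (Y w - Z w); rewrite sqrrB; have := sqr_ge0 (Y w); have := sqr_ge0 (Z w); nra.
Qed.

Lemma EFin_Rintegral_integrable d {T : measurableType d} {R : realType}
    (m : {measure set T -> \bar R}) (f : T -> R) :
  m.-integrable [set: T] (fun w => (f w)%:E) ->
  (\int[m]_w (f w)%:E = (\int[m]_w f w)%:E)%E.
Proof. by move=> fi; rewrite /Rintegral fineK//; exact: integrable_fin_num. Qed.

Lemma integral_sum_sqr d {T : measurableType d} {R : realType} (m : {measure set T -> \bar R})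
    (n : nat) (U : 'I_n -> T -> R) (c : 'I_n -> R) :
  (forall j, measurable_fun [set: T] (U j)) ->
  (forall j, m.-integrable [set: T] (fun w => (U j w ^+ 2)%:E)) ->
  (\int[m]_w ((\sum_j c j * U j w) ^+ 2)%:E =
   (\sum_j \sum_k c j * c k * \int[m]_w (U j w * U k w)%R)%:E)%E.
Proof.
move=> mU iU.
have iUU j k := integrable_mul (mU j) (mU k) (iU j) (iU k).
have iUC j k : m.-integrable [set: T] (fun w => ((c j * c k)%:E * (U j w * U k w)%:E)%E).
  exact: integrableZl (iUU j k).
under eq_integral => w _.
  rewrite (_ : (_ ^+ 2)%:E = \sum_j \sum_k ((c j * c k)%:E * (U j w * U k w)%:E)%E); last first.
    rewrite expr2 mulr_suml -sumEFin; apply: eq_bigr => j _.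
    rewrite mulr_sumr -sumEFin; apply: eq_bigr => k _.
    by rewrite -EFinM; congr EFin; ring.
  over.
rewrite integral_sum//; last by move=> j; exact: integrable_sum.
rewrite -sumEFin; apply: eq_bigr => j _; rewrite integral_sum// -sumEFin.
apply: eq_bigr => k _.
by rewrite integralZl// EFin_Rintegral_integrable.
Qed.

Lemma measurable_increments d {T : measurableType d} {R : realType} (K : Type)
    (B : T -> K -> R) (n : nat) (p : nat -> K) (r : R) :
  (forall x, measurable_fun [set: T] (fun w => B w x)) ->
  measurable [set w | forall l, (l < n)%N -> `|B w (p l.+1) - B w (p 0%N)| <= r].
Proof.
move=> mB; rewrite (_ : mkset _ = \bigcap_l (if (l < n)%N then
    [set w | `|B w (p l.+1) - B w (p 0%N)| <= r] else setT)).
  apply: bigcapT_measurable => l; case: ifP => // _.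
  rewrite -[X in measurable X]setTI.
  apply: (@measurable_fun_ler _ _ _ _ _ (cst r)) => //.
  apply: measurableT_comp => //; exact: measurable_funB.
apply/seteqP; split => w /= hw l; last by move=> ln; have := hw l I; rewrite ln.
by move=> _; case: ifP => //; exact: hw.
Qed.

(** The measurability proof is run on [T] with the sigma-algebra generated by [B]; independence of
    the components is stated for events of this kind. *)
Lemma sigma_of_field_increments d {T : measurableType d} {R : realType} (K : Type)
    (B : T -> K -> R) (n : nat) (p : nat -> K) (r : R) :
  sigma_of_field B [set w | forall l, (l < n)%N -> `|B w (p l.+1) - B w (p 0%N)| <= r].
Proof.
pose G := \bigcup_t preimage_set_system setT (fun w => B w t) measurable.
apply: (@measurable_increments _ (g_sigma_algebraType G) R K B n p r) => x _ Y mY.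
by apply: sub_sigma_algebra; exists x => //; exists Y.
Qed.

(** * Small ball probabilities *)

Section fbm_increments.
Context d {T : measurableType d} {R : realType} (P : probability T R) (N : nat).
Context (alpha : R) (a0 : 0 < alpha) (B : T -> 'rV[R]_N -> R) (fB : real_fbm P alpha B).

Lemma real_fbm_gaussian x : gaussian_variable P (fun w => B w x).
Proof.
have [gB _ _] := fB; have := gB 1%N (fun=> x) (fun=> 1).
by under eq_fun do rewrite big_ord1 mul1r.
Qed.

Lemma real_fbm_measurable x : measurable_fun [set: T] (fun w => B w x).
Proof. by case: (real_fbm_gaussian x). Qed.

Lemma real_fbm_integrable x : P.-integrable [set: T] (fun w => (B w x)%:E).
Proof. by have [m [s [_ + _ _ _]]] := gaussian_variableP (real_fbm_gaussian x). Qed.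

Lemma real_fbm_integrable_sqr x : P.-integrable [set: T] (fun w => (B w x ^+ 2)%:E).
Proof.
have [m [s [_ _ _ E2 _]]] := gaussian_variableP (real_fbm_gaussian x).
apply/integrableP; split.
  by apply/measurable_EFinP; apply: measurable_funX; exact: real_fbm_measurable.
under eq_integral do rewrite abse_EFin ger0_norm ?sqr_ge0//.
by rewrite E2 ltry.
Qed.

Lemma real_fbm_mean x : (\int[P]_w (B w x)%:E = 0)%E.
Proof. by case: fB => _ /(_ x) + _; rewrite unlock. Qed.

Lemma real_fbm_covariance x y : \int[P]_w (B w x * B w y) =
  2^-1 * (euclidean_norm x `^ (2 * alpha) + euclidean_norm y `^ (2 * alpha)
               - euclidean_norm (x - y) `^ (2 * alpha)).
Proof. by case: fB => _ _ /(_ x y); rewrite unlock /Rintegral => ->. Qed.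

(** The one-point terms of the covariance cancel because the coefficients sum to 0. *)
Lemma real_fbm_variance n (x : 'I_n -> 'rV[R]_N) (a : 'I_n -> R) : \sum_j a j = 0 ->
  (\int[P]_w ((\sum_j a j * B w (x j)) ^+ 2)%:E =
   (- 2^-1 * \sum_j \sum_k a j * a k * euclidean_norm (x j - x k) `^ (2 * alpha))%:E)%E.
Proof.
move=> as0.
rewrite (integral_sum_sqr a (fun j => real_fbm_measurable (x j)) (fun j => real_fbm_integrable_sqr (x j))).
congr EFin.
pose e j := euclidean_norm (x j) `^ (2 * alpha).
transitivity (\sum_j \sum_k (2^-1 * (a j * e j) * a k + 2^-1 * a j * (a k * e k)
   - 2^-1 * (a j * a k * euclidean_norm (x j - x k) `^ (2 * alpha)))).
  apply: eq_bigr => j _; apply: eq_bigr => k _; rewrite real_fbm_covariance -/(e j) -/(e k).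
  by move: (e j) (e k) (euclidean_norm _ `^ _) => u v z; ring.
under eq_bigr do rewrite sumrB big_split/= -!mulr_sumr as0 mulr0 add0r.
by rewrite sumrB -mulr_suml -mulr_sumr as0 mulr0 mul0r sub0r -mulr_sumr mulNr.
Qed.

Lemma real_fbm_increment_cos (r : R) n (x : 'I_n -> 'rV[R]_N) (a : 'I_n -> R) : \sum_j a j = 0 ->
  \int[P]_w cos (\sum_j r * a j * B w (x j)) = expR (- (r ^+ 2 *
     (- 2^-1 * \sum_j \sum_k a j * a k * euclidean_norm (x j - x k) `^ (2 * alpha)) / 2)).
Proof.
move=> as0; have [gB _ _] := fB.
apply: gaussian_centered_cos; first exact: gB.
- under eq_integral => w _.
    rewrite -sumEFin; under eq_bigr do rewrite EFinM; over.
  rewrite integral_sum//; last by move=> j; apply: integrableZl => //; exact: real_fbm_integrable.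
  rewrite big1// => j _; rewrite integralZl//; last exact: real_fbm_integrable.
  by rewrite real_fbm_mean mule0.
- have ras0 : \sum_j r * a j = 0 by rewrite -mulr_sumr as0 mulr0.
  rewrite real_fbm_variance//; congr EFin.
  rewrite mulrCA; congr (_ * _); rewrite mulr_sumr; apply: eq_bigr => j _.
  by rewrite mulr_sumr; apply: eq_bigr => k _; ring.
Qed.

(** Divided by [r], the increments from [p 0] form a Gaussian vector, and the event says that its
    entries lie between -1 and 1. Nondeterminism supplies the conditional variances that the
    elimination asks for. *)
Lemma real_fbm_small_ball (c r : R) (n : nat) (p : nat -> 'rV[R]_N) (delta : nat -> R) :
  (forall (x : 'I_n.+1 -> 'rV[R]_N) (a : 'I_n.+1 -> R) (i : 'I_n.+1) (e : R),
    \sum_j a j = 0 -> 0 < e -> (forall j, j != i -> e <= euclidean_norm (x i - x j)) ->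
    c * a i ^+ 2 * e `^ (2 * alpha) <=
    - 2^-1 * \sum_j \sum_k a j * a k * euclidean_norm (x j - x k) `^ (2 * alpha)) ->
  0 < c -> 0 < r ->
  (forall l, (l < n)%N -> 0 <= delta l) ->
  (forall l k, (l < n)%N -> (k <= l)%N -> delta l <= euclidean_norm (p l.+1 - p k)) ->
  (P [set w | forall l, (l < n)%N -> (`|B w (p l.+1) - B w (p 0%N)| <= r)%R] <=
   (expR (n%:R / 2) * \prod_(l < n) (Num.sqrt (1 + c * delta l `^ (2 * alpha) / r ^+ 2))^-1)%:E)%E.
Proof.
move=> lnd c0 r0 dl0 dlp.
have mB := real_fbm_measurable.
pose U (l : 'I_n) w := (B w (p l.+1) - B w (p 0%N)) / r.
have mU l : measurable_fun [set: T] (U l) by apply: measurable_funM => //; exact: measurable_funB.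
pose S j k := \int[P]_w (U j w * U k w).
pose F (u e : 'rV[R]_n) := \sum_j \sum_k u 0 j * e 0 k * S j k.
(* Combinations of increments from [p 0] are combinations of values with coefficient sum 0: [p 0]
   receives minus the sum of the others. *)
pose a (u : 'rV[R]_n) (j : 'I_n.+1) : R := if unlift ord0 j is Some l then u 0 l else - \sum_l u 0 l.
have a0E u : a u ord0 = - \sum_l u 0 l by rewrite /a unlift_none.
have aE u (l : 'I_n) : a u (lift ord0 l) = u 0 l by rewrite /a liftK.
have as0 u : \sum_j a u j = 0.
  by rewrite big_ord_recl a0E (eq_bigr _ (fun l _ => aE u l)) addNr.
have UE (u : 'rV[R]_n) w : \sum_l u 0 l * U l w = \sum_(j < n.+1) r^-1 * a u j * B w (p j).
  rewrite (_ : \sum_(j < n.+1) _ = r^-1 * a u ord0 * B w (p 0%N) +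
      \sum_(l < n) r^-1 * u 0 l * B w (p l.+1)); last first.
    by rewrite big_ord_recl; congr (_ + _); apply: eq_bigr => l _; rewrite aE lift0.
  rewrite a0E.
  rewrite mulrN mulNr mulr_sumr mulr_suml -sumrN -big_split/=.
  by apply: eq_bigr => l _; rewrite /U; field; rewrite gt_eqF.
have iU2 l : P.-integrable [set: T] (fun w => (U l w ^+ 2)%:E).
  apply/integrableP; split; first by apply/measurable_EFinP; exact: measurable_funX.
  under eq_integral do rewrite abse_EFin ger0_norm ?sqr_ge0//.
  under eq_integral => w _.
    rewrite (_ : U l w = \sum_l' (delta_mx 0 l : 'rV[R]_n) 0 l' * U l' w); last first.
      rewrite (bigD1 l)//= mxE !eqxx mul1r big1 ?addr0// => l' /negbTE ll'.
      by rewrite mxE ll' andbF mul0r.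
    rewrite UE; over.
  by rewrite real_fbm_variance ?ltry// -mulr_sumr as0 mulr0.
have FE (u : 'rV[R]_n) : F u u = r^-1 ^+ 2 * (- 2^-1 * \sum_j \sum_k a u j * a u k *
    euclidean_norm (p j - p k) `^ (2 * alpha)).
  have := integral_sum_sqr (fun j => u 0 j) mU iU2.
  under eq_integral do rewrite UE.
  rewrite real_fbm_variance; last by rewrite -mulr_sumr as0 mulr0.
  move=> [] h; rewrite [LHS](esym h) mulrCA; congr (_ * _); rewrite mulr_sumr.
  by apply: eq_bigr => j _; rewrite mulr_sumr; apply: eq_bigr => k _; ring.
pose v (l : 'I_n) := c * delta l `^ (2 * alpha) / r ^+ 2.
have v0 l : 0 <= v l by rewrite divr_ge0 ?sqr_ge0// mulr_ge0 ?powR_ge0// ltW.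
have F0 u : 0 <= F u u.
  by rewrite -lee_fin -(integral_sum_sqr _ mU iU2) integral_ge0// => w _; rewrite lee_fin sqr_ge0.
have := @gaussian_elimination _ _ _ P n U F v mU.
have FC u e : F u e = F e u.
  rewrite /F exchange_big/=; apply: eq_bigr => j _; apply: eq_bigr => k _.
  rewrite (mulrC (u 0 k)); congr (_ * _); rewrite /S; apply: eq_Rintegral => w _; exact: mulrC.
have FD (u e : 'rV[R]_n) t f : F (u + t *: e) f = F u f + t * F e f.
  rewrite /F mulr_sumr -big_split/=; apply: eq_bigr => j _.
  rewrite mulr_sumr -big_split/=; apply: eq_bigr => k _.
  by rewrite !mxE; ring.
have cosF (u : 'rV[R]_n) : \int[P]_w cos (\sum_j u 0 j * U j w) = expR (- (F u u / 2)).
  under eq_Rintegral do rewrite UE.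
  by rewrite real_fbm_increment_cos// FE.
have vF (j : 'I_n) (u : 'rV[R]_n) : u 0 j = 1 -> (forall l : 'I_n, (j < l)%N -> u 0 l = 0) -> v j <= F u u.
  (* Nondeterminism is stated for positive distances; for [delta j = 0] the bound [v j] is 0
     anyway. *)
  move=> uj ul; have [dj0|dj0] := eqVneq (delta j) 0.
    by rewrite /v dj0 powR0 ?mulr0 ?mul0r// gt_eqF// mulr_gt0.
  have dj : 0 < delta j by rewrite lt_neqAle eq_sym dj0 dl0.
  (* [delta j] controls no distance to points after [p j.+1]. These are moved to [p 0], which leaves
     the variance unchanged since their coefficients vanish. *)
  pose x (k : 'I_n.+1) := if (k <= j.+1)%N then p k else p 0%N.
  have xj : x (lift ord0 j) = p j.+1 by rewrite /x lift0 leqnn.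
  have xd k : k != lift ord0 j -> delta j <= euclidean_norm (x (lift ord0 j) - x k).
    move=> kj; rewrite xj /x; case: ifPn => [kj1|_]; last by rewrite dlp.
    rewrite dlp// -ltnS ltn_neqAle kj1 andbT; apply: contra kj => /eqP kj.
    by apply/eqP/val_inj; exact: (etrans kj (esym (lift0 j))).
  have h := lnd x (a u) (lift ord0 j) (delta j) (as0 u) dj xd.
  have ax k : a u k = 0 \/ x k = p k.
    rewrite /x; case: ifPn => [_|]; [by right|rewrite -ltnNge => jk].
    case: (unliftP ord0 k) jk => [l ->|->]//; rewrite lift0 ltnS => jl.
    by left; rewrite aE ul.
  have sE : \sum_j \sum_k a u j * a u k * euclidean_norm (x j - x k) `^ (2 * alpha) =
      \sum_j \sum_k a u j * a u k * euclidean_norm (p j - p k) `^ (2 * alpha).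
    apply: eq_bigr => k _; apply: eq_bigr => l _.
    have mz (s t y z : R) : s = 0 \/ t = 0 -> s * t * y = s * t * z.
      by move=> [->|->]; rewrite ?(mulr0, mul0r).
    have [k0|->] := ax k; first by apply: mz; left.
    by have [l0|->] := ax l; first by apply: mz; right.
  move: h; rewrite sE aE uj expr1n mulr1 => h.
  rewrite FE /v [leLHS]mulrC exprVn; apply: ler_wpM2l h.
  by rewrite invr_ge0 sqr_ge0.
move=> /(_ FC FD F0 cosF v0 vF) h.
have mG : measurable_fun [set: T] (fun w => \prod_j expR (- (U j w ^+ 2 / 2))).
  apply: measurable_prod => j _.
  apply: measurableT_comp => //; apply: measurableT_comp => //.
  by apply: measurable_funM => //; exact: measurable_funX.
have G1 w : `|\prod_j expR (- (U j w ^+ 2 / 2))| <= 1.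
  rewrite ger0_norm; last by apply: prodr_ge0 => j _; exact: expR_ge0.
  apply: prodr_ile1 => j _; rewrite expR_ge0 -expR0 ler_expR oppr_le0.
  by rewrite divr_ge0// sqr_ge0.
have mA := measurable_increments n p r mB.
(* On the event every [U j ^+ 2] is at most 1, so the indicator is at most the product of the [n]
   factors [expR ((1 - U j ^+ 2) / 2)]. *)
apply: (@le_trans _ _ ((expR (n%:R / 2))%:E * \int[P]_w (\prod_j expR (- (U j w ^+ 2 / 2)))%:E)%E); last first.
  rewrite EFinM lee_wpmul2l ?lee_fin ?expR_ge0//.
  by rewrite -(EFin_Rintegral P mG G1) lee_fin.
rewrite -ge0_integralZl_EFin ?expR_ge0//; last 2 first.
- by move=> w _; rewrite lee_fin prodr_ge0// => j _; exact: expR_ge0.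
- exact/measurable_EFinP.
rewrite -(setIT (mkset _)) -integral_indic//.
apply: ge0_le_integral => //.
- by apply/measurable_EFinP; exact: measurable_indic.
- by apply/measurable_EFinP; exact: measurable_funM.
move=> w _; rewrite -EFinM lee_fin indicE.
have [wA|_] := boolP (w \in _); last first.
  by rewrite mulr_ge0 ?expR_ge0// prodr_ge0// => j _; exact: expR_ge0.
rewrite -expR_sum -expRD (_ : _%:R = expR 0); last by rewrite expR0.
rewrite ler_expR sumrN (_ : _ / 2 = \sum_(j < n) 2^-1); last by rewrite sumr_const card_ord mulr_natl.
rewrite subr_ge0 ler_sum// => l _; rewrite ler_pdivrMr// mulVf//.
move: wA; rewrite inE => /(_ l (ltn_ord l)) wl.
rewrite -real_normK ?num_real// expr_le1// /U normrM normfV (gtr0_norm r0).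
by rewrite ler_pdivrMr// mul1r.
Qed.

End fbm_increments.

(* Comparable to [min 1 (r / |z| ^ alpha) ^ t], without a junk value at [z = 0]. *)
Definition decay {R : realType} (N : nat) (alpha t r : R) (z : 'rV[R]_N) : R :=
  (1 + euclidean_norm z `^ (2 * alpha) / r ^+ 2) `^ (- (t / 2)).

Section small_ball.
Context d {T : measurableType d} {R : realType} (P : probability T R) (N D : nat).
Context (alpha : R) (X : T -> 'rV[R]_N -> 'rV[R]_D) (fX : fbm P alpha X).

Lemma decay_ge0 (t r : R) (z : 'rV[R]_N) : 0 <= decay alpha t r z.
Proof. exact: powR_ge0. Qed.

Lemma fbm_measurable x i : measurable_fun [set: T] (fun w => X w x 0 i).
Proof. by have [/(_ i)/real_fbm_measurable + _ _] := fX; exact. Qed.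

(** Independence raises the bound for one component to the power [D], and [t <= D%:R] allows the
    weaker exponent. Summing over all earlier points, rather than selecting the nearest, leaves
    terms that can be integrated one by one. *)
Lemma fbm_small_ball (t : R) (n : nat) :
  (0 < N)%N -> 0 < alpha < 1 -> 0 < t <= D%:R ->
  exists2 C : R, 0 < C & forall (p : nat -> 'rV[R]_N) (r : R), 0 < r ->
    (P [set w | forall l i, (l < n)%N -> (`|X w (p l.+1) 0 i - X w (p 0%N) 0 i| <= r)%R] <=
     (C * \prod_(l < n) \sum_(k < l.+1) decay alpha t r (p l.+1 - p k))%:E)%E.
Proof.
move=> N0 a01 /andP[t0 tD]; have /andP[a0 a1] := a01.
have [c c0 lnd] := strong_local_nondeterminism (R := R) n.+1 N0 a01.
(* Then [c' * (1 + u) <= 1 + c * u], so the constant can be taken out of the power. *)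
pose c' := Num.min 1 c; have c'0 : 0 < c' by rewrite lt_min ltr01.
have [c'1 c'c] : c' <= 1 /\ c' <= c by rewrite !ge_min lexx lexx orbT.
exists (expR (n%:R / 2) ^+ D * (c' `^ (- (t / 2))) ^+ n).
  by rewrite mulr_gt0// exprn_gt0 ?expR_gt0// powR_gt0.
move=> p r r0.
pose dl (l : nat) : R := euclidean_norm (p l.+1 -
  p [arg min_(k < (ord0 : 'I_l.+1)) euclidean_norm (p l.+1 - p k)]%O).
have dl0 l : 0 <= dl l by exact: euclidean_norm_ge0.
have dlE l : exists k : 'I_l.+1, dl l = euclidean_norm (p l.+1 - p k) by eexists.
have dlp l k : (k <= l)%N -> dl l <= euclidean_norm (p l.+1 - p k).
  move=> kl; rewrite /dl; case: arg_minP => // i _ /(_ (Ordinal (kl : (k < l.+1)%N)) isT); exact.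
pose A i := [set w | forall l, (l < n)%N -> `|X w (p l.+1) 0 i - X w (p 0%N) 0 i| <= r].
have [fB ind _] := fX.
have -> : [set w | forall l i, (l < n)%N -> `|X w (p l.+1) 0 i - X w (p 0%N) 0 i| <= r] =
    \bigcap_(i in [set` [set: 'I_D]%SET]) A i.
  by apply/seteqP; split => [w h i _ l ln|w h l i ln]; [exact: h|apply: (h i) => //=; rewrite inE].
rewrite ind; last by move=> i _; exact: (@sigma_of_field_increments _ _ _ _ (fun w x => X w x 0 i)).
pose E := expR (n%:R / 2) * \prod_(l < n) (Num.sqrt (1 + c * dl l `^ (2 * alpha) / r ^+ 2))^-1.
apply: (@le_trans _ _ (\prod_(i in [set: 'I_D]%SET) E%:E)%E).
  suff /andP[] : (0 <= \prod_(i in [set: 'I_D]%SET) P (A i) <= \prod_(i in [set: 'I_D]%SET) E%:E)%E by [].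
  apply: (big_ind2 (fun x y => (0 <= x <= y)%E)); first by rewrite lee_fin ler01 lexx.
    move=> x1 x2 y1 y2 /andP[x10 x12] /andP[y10 y12].
    by rewrite mule_ge0//= lee_pmul.
  move=> i _; rewrite measure_ge0/=.
  by apply: (real_fbm_small_ball a0 (fB i) lnd) => // l k _; exact: dlp.
rewrite prodEFin lee_fin prodr_const cardsT card_ord /E exprMn -mulrA ler_wpM2l ?exprn_ge0 ?expR_ge0//.
rewrite -prodrXl (_ : _ ^+ n = \prod_(l < n) c' `^ (- (t / 2))); last by rewrite prodr_const card_ord.
rewrite -big_split/=.
apply: ler_prod => l _; rewrite exprn_ge0 ?invr_ge0 ?sqrtr_ge0//=.
have [k kE] := dlE l.
pose u := dl l `^ (2 * alpha) / r ^+ 2.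
have u0 : 0 <= u by rewrite divr_ge0 ?sqr_ge0// powR_ge0.
rewrite -mulrA -/u.
have cu1 : 1 <= 1 + c * u by rewrite lerDl mulr_ge0// ltW.
have cu0 : 0 < 1 + c * u by exact: lt_le_trans cu1.
rewrite -powR12_sqrt ?(ltW cu0)// -powRN -powR_mulrn ?powR_ge0// -powRrM.
apply: (@le_trans _ _ ((1 + c * u) `^ (- (t / 2)))).
  by rewrite ler_powR//; lra.
apply: (@le_trans _ _ ((c' * (1 + u)) `^ (- (t / 2)))).
  rewrite !powRN lef_pV2 ?posrE ?powR_gt0 ?mulr_gt0 ?ltr_wpDr//.
  rewrite ge0_ler_powR ?nnegrE ?divr_ge0 ?(ltW t0) ?(ltW cu0) ?mulr_ge0 ?(ltW c'0) ?addr_ge0//.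
    by rewrite mulrDr mulr1 lerD// ler_wpM2r.
  by rewrite mulr_ge0// ltW.
rewrite powRM ?(ltW c'0) ?addr_ge0// ler_wpM2l ?powR_ge0//.
have -> : (1 + u) `^ (- (t / 2)) = decay alpha t r (p l.+1 - p k) by rewrite /decay -kE.
by rewrite (bigD1 k)//= lerDl sumr_ge0// => j _; exact: decay_ge0.
Qed.

End small_ball.

(** * Mesh moments *)

(** Through [pickle_inv] a sum over a countable type becomes a series over [nat], to which monotone
    convergence and the interchange of series apply. *)
Lemma esum_countable {R : realType} (K : countType) (a : K -> \bar R) : (forall i, 0 <= a i)%E ->
  (\esum_(i in [set: K]) a i = \sum_(0 <= n <oo) oapp a 0 (@pickle_inv K n))%E.
Proof.
move=> a0; have h0 n : (0 <= oapp a 0 (@pickle_inv K n))%E by case: pickle_inv => /=.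
rewrite nneseries_esumT//.
transitivity (\esum_(n in range (@pickle K)) oapp a 0%E (@pickle_inv K n))%E.
  rewrite esum_image; last by move=> i j _ _; exact: (pcan_inj pickleK_inv).
  by apply: eq_esum => i _; rewrite pickleK_inv.
rewrite esum_mkcond; apply: eq_esum => n _; case: ifPn => //.
rewrite notin_setE /= => nK; case E: (@pickle_inv K n) => [i|]//=.
by case: nK; exists i => //; move: (@pickle_invK K n); rewrite /ocancel E.
Qed.

Lemma measurable_esum d {T : measurableType d} {R : realType} (K : countType)
    (f : K -> T -> \bar R) : (forall i, measurable_fun setT (f i)) -> (forall i x, 0 <= f i x)%E ->
  measurable_fun setT (fun x => \esum_(i in [set: K]) f i x)%E.
Proof.
move=> mf f0; under eq_fun => x do rewrite esum_countable//.
apply: (@ge0_emeasurable_sum _ _ _ _ (fun n x => oapp (f^~ x) 0%E (@pickle_inv K n)) xpredT) => n.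
  by move=> x _ _; case: pickle_inv => /=.
by case: (@pickle_inv K n) => [i|] /=.
Qed.

Lemma integral_esum d {T : measurableType d} {R : realType} (m : {measure set T -> \bar R})
    (K : countType) (f : K -> T -> \bar R) :
  (forall i, measurable_fun setT (f i)) -> (forall i x, 0 <= f i x)%E ->
  (\int[m]_x (\esum_(i in [set: K]) f i x) = \esum_(i in [set: K]) \int[m]_x f i x)%E.
Proof.
move=> mf f0; under eq_integral => x _ do rewrite esum_countable//.
rewrite integral_nneseries//.
- rewrite esum_countable; last by move=> i; exact: integral_ge0.
  apply: eq_eseriesr => n _; case: (@pickle_inv K n) => [i|] //=.
  by rewrite integral0.
- by move=> n; case: (@pickle_inv K n) => [i|] /=.
- by move=> n x _; case: (@pickle_inv K n) => [i|] /=.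
Qed.

Lemma exchange_esum {R : realType} (K L : countType) (a : K -> L -> \bar R) :
  (forall i j, 0 <= a i j)%E ->
  (\esum_(i in [set: K]) \esum_(j in [set: L]) a i j =
   \esum_(j in [set: L]) \esum_(i in [set: K]) a i j)%E.
Proof.
move=> a0.
pose b n m := oapp (fun i => oapp (a i) 0%E (@pickle_inv L m)) 0%E (@pickle_inv K n).
have b0 n m : (0 <= b n m)%E by rewrite /b; case: (@pickle_inv K n) => //= i; case: (@pickle_inv L m) => /=.
transitivity (\sum_(0 <= n <oo) \sum_(0 <= m <oo) b n m)%E.
  rewrite esum_countable; last by move=> i; exact: esum_ge0.
  apply: eq_eseriesr => n _; rewrite /b; case: (@pickle_inv K n) => [i|]//=; last by rewrite eseries0.
  by rewrite esum_countable.
rewrite nneseries_interchange//.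
rewrite [RHS]esum_countable; last by move=> i; exact: esum_ge0.
apply: eq_eseriesr => m _; rewrite /b; case: (@pickle_inv L m) => [j|]/=.
  by rewrite esum_countable.
by rewrite eseries0// => n _ _; case: pickle_inv.
Qed.

Lemma esum_single {R : realType} (K : choiceType) (a : K -> \bar R) (i : K) :
  (forall j, 0 <= a j)%E -> (forall j, j != i -> a j = 0%E) ->
  (\esum_(j in [set: K]) a j = a i)%E.
Proof.
move=> a0 ai; rewrite -[RHS](@esum_set1 _ _ i a)// [RHS]esum_mkcond.
apply: eq_esum => j _.
by case: ifPn => //; rewrite notin_setE /= => /eqP/ai.
Qed.

Lemma ge_esum {R : realType} (K : choiceType) (a : K -> \bar R) (i : K) :
  (forall j, 0 <= a j)%E -> (a i <= \esum_(j in [set: K]) a j)%E.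
Proof.
move=> a0; rewrite -[leLHS](@esum_set1 _ _ i a)// esum_mkcond.
by apply: le_esum => j _; case: ifP.
Qed.

Lemma esumZl {R : realType} (K : countType) (c : R) (a : K -> \bar R) : 0 <= c ->
  (forall i, 0 <= a i)%E ->
  (\esum_(i in [set: K]) (c%:E * a i) = c%:E * \esum_(i in [set: K]) a i)%E.
Proof.
move=> c0 a0; rewrite !esum_countable//; last by move=> i; rewrite mule_ge0.
rewrite -nneseriesZl//; last by move=> n _; case: pickle_inv => /=.
by apply: eq_eseriesr => n _; case: pickle_inv => //=; rewrite mule0.
Qed.

Section disjoint_family.
Context d {T : measurableType d} {R : realType} (m : {measure set T -> \bar R}).
Context (K : countType) (E : K -> set T).
Hypothesis mE : forall i, measurable (E i).
Hypothesis tE : forall i j x, E i x -> E j x -> i = j.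

Lemma esum_integral_le (g : T -> \bar R) : measurable_fun setT g -> (forall x, 0 <= g x)%E ->
  (\esum_(i in [set: K]) \int[m]_(x in E i) g x <= \int[m]_x g x)%E.
Proof.
move=> mg g0.
under eq_esum => i _ do rewrite integral_mkcond.
rewrite -integral_esum; last 2 first.
- by move=> i; apply/measurable_restrict => //; rewrite setTI; exact: measurable_funS mg.
- by move=> i x; rewrite patchE; case: ifP.
have r0 i x : (0 <= (g \_ (E i)) x)%E by rewrite patchE; case: ifP.
apply: ge0_le_integral => //.
- by move=> x _; apply: esum_ge0.
- apply: measurable_esum => // i.
  by apply/measurable_restrict => //; rewrite setTI; exact: measurable_funS mg.
move=> x _; have [[i Ei]|nE] := pselect (exists i, E i x).
  rewrite (@esum_single _ _ _ i)//; first by rewrite patchE; case: ifP.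
  move=> j ji; rewrite patchE memNset// => Ej; move/eqP: ji; apply.
  exact: tE Ej Ei.
rewrite esum1// => i _; rewrite patchE memNset// => Ei; apply: nE; by exists i.
Qed.

Lemma le_esum_integral (g : T -> \bar R) : measurable_fun setT g -> (forall x, 0 <= g x)%E ->
  (forall x, exists i, E i x) ->
  (\int[m]_x g x <= \esum_(i in [set: K]) \int[m]_(x in E i) g x)%E.
Proof.
move=> mg g0 cE.
under eq_esum => i _ do rewrite integral_mkcond.
have r0 i x : (0 <= (g \_ (E i)) x)%E by rewrite patchE; case: ifP.
have mr i : measurable_fun setT (g \_ (E i)).
  by apply/measurable_restrict => //; rewrite setTI; exact: measurable_funS mg.
rewrite -integral_esum//.
apply: ge0_le_integral => //; first exact: measurable_esum.
move=> x _; have [i Ei] := cE x; apply: (le_trans _ (ge_esum i (r0^~ x))).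
by rewrite patchE mem_set.
Qed.

Lemma esum_measure_le (A : set T) : measurable A -> (forall i, E i `<=` A) ->
  (\esum_(i in [set: K]) m (E i) <= m A)%E.
Proof.
move=> mA EA; rewrite -(setIT A) -integral_indic//.
apply: le_trans (esum_integral_le _ _); last 2 first.
- by apply/measurable_EFinP; exact: measurable_indic.
- by move=> x; rewrite lee_fin.
apply: le_esum => i _; rewrite integral_indic// setIidr//; exact: EA.
Qed.

End disjoint_family.

Lemma powR_exprC {R : realType} (x y : R) m : 0 <= x -> (x ^+ m) `^ y = (x `^ y) ^+ m.
Proof. by move=> x0; rewrite -powR_mulrn// powRAC powR_mulrn// powR_ge0. Qed.

Lemma powR_pred {R : realType} (x q : R) : 0 <= x -> q != 0 -> x `^ q = x `^ (q - 1) * x.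
Proof.
move=> x0 q0; have [->|xn0] := eqVneq x 0; first by rewrite powR0// mulr0.
by rewrite -[X in _ * X]powRr1// -powRD ?subrK// (negbTE q0).
Qed.

Lemma poweR_le_mul {R : realType} (x : \bar R) (M q : R) : 1 <= q -> (0 <= x <= M%:E)%E ->
  (x `^ q <= (M `^ (q - 1))%:E * x)%E.
Proof.
move=> q1; case: x => [x| |]//; last by case/andP; rewrite ?leye_eq// leNye.
move=> /andP[x0 xM]; rewrite lee_fin in x0; rewrite lee_fin in xM.
rewrite poweR_EFin -EFinM lee_fin.
have q0 : q != 0 by rewrite gt_eqF// (lt_le_trans ltr01).
by rewrite powR_pred// ler_wpM2r// ge0_ler_powR ?nnegrE ?subr_ge0// (le_trans x0).
Qed.

Lemma powR_sum_le {R : realType} (E : finType) (x : E -> R) (q : R) : 0 < q -> (forall e, 0 <= x e) ->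
  (\sum_e x e) `^ q <= #|E|%:R `^ q * \sum_e x e `^ q.
Proof.
move=> q0 x0; have s0 : 0 <= \sum_e x e `^ q by apply: sumr_ge0 => e _; exact: powR_ge0.
have [e0 _|E0] := pickP (@predT E); last first.
  rewrite big_pred0// powR0 ?gt_eqF// mulr_ge0 ?powR_ge0//.
case: (@arg_maxP _ _ E e0 xpredT x isT) => e _ xe.
apply: (@le_trans _ _ ((#|E|%:R * x e) `^ q)).
  rewrite ge0_ler_powR ?nnegrE ?(ltW q0) ?sumr_ge0 ?mulr_ge0//.
  rewrite mulr_natl -sumr_const ler_sum// => i _; exact: xe.
rewrite powRM// ler_wpM2l ?powR_ge0// (bigD1 e)//= lerDl sumr_ge0// => i _.
exact: powR_ge0.
Qed.

(** The power [q] of [m (E i)] is at most the power [q - 1] of [m A] times [m (E i)], and the masses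
    of disjoint pieces add up to at most [m A]. *)
Lemma esum_poweR_le d {T : measurableType d} {R : realType} (m : probability T R)
    (K : countType) (E : K -> set T) (A : set T) (q : R) : 1 <= q ->
  (forall i, measurable (E i)) -> (forall i j x, E i x -> E j x -> i = j) ->
  measurable A -> (forall i, E i `<=` A) ->
  (\esum_(i in [set: K]) (m (E i) `^ q) <= m A `^ q)%E.
Proof.
move=> q1 mE tE mA EA.
have mAE : m A = (fine (m A))%:E by rewrite fineK// fin_num_measure.
have A0 : 0 <= fine (m A) by exact: fine_ge0.
have q0 : q != 0 by rewrite gt_eqF// (lt_le_trans ltr01).
apply: (@le_trans _ _ (\esum_(i in [set: K]) ((fine (m A) `^ (q - 1))%:E * m (E i)))%E).
  apply: le_esum => i _; apply: poweR_le_mul => //.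
  by rewrite measure_ge0/= -mAE le_measure// inE.
rewrite esumZl ?powR_ge0//.
apply: (@le_trans _ _ ((fine (m A) `^ (q - 1))%:E * m A)%E).
  by rewrite lee_wpmul2l ?lee_fin ?powR_ge0//; exact: esum_measure_le.
by rewrite mAE poweR_EFin -EFinM lee_fin/= -powR_pred.
Qed.

Lemma measure_le_sum_finType d {T : measurableType d} {R : realType} (m : {measure set T -> \bar R})
    (E : finType) (A : set T) (F : E -> set T) : measurable A -> (forall e, measurable (F e)) ->
  (forall x, A x -> exists e, F e x) -> (m A <= \sum_e m (F e))%E.
Proof.
move=> mA mF AF.
have mI (B : set T) : measurable B -> measurable_fun setT (fun x => (\1_B x)%:E : \bar R).
  by move=> mB; apply/measurable_EFinP; exact: measurable_indic.
have iE (B : set T) : measurable B -> m B = (\int[m]_x (\1_B x)%:E)%E.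
  by move=> mB; rewrite integral_indic// setIT.
rewrite iE//; under eq_bigr => e _ do rewrite iE//.
rewrite -ge0_integral_sum//; last by move=> e; exact: mI.
apply: ge0_le_integral => //.
- exact: mI.
- by apply: emeasurable_sum => e; exact: mI.
move=> x _; rewrite sumEFin lee_fin [\1_A x]indicE.
have [|_] := boolP (x \in A); last by apply: sumr_ge0.
rewrite inE => /AF[e Fe]; rewrite (bigD1 e)//= [\1_(F e) x]indicE mem_set// lerDl.
exact: sumr_ge0.
Qed.

(** The power [q] of a sum over [E] costs the power [q] of its cardinality. The second factor arises
    because each of the [#|E|] terms is bounded by the sum over all [j], so [f i] need not be
    injective. Summing over [i] inside a fixed [B j] then uses that the [G i] are disjoint. *)
Lemma moment_refine d {T : measurableType d} {R : realType} (m : probability T R)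
    (K L : countType) (E : finType) (G : K -> set T) (B : L -> set T) (f : K -> E -> L) (q : R) :
  1 <= q -> (forall i, measurable (G i)) -> (forall j, measurable (B j)) ->
  (forall i j x, G i x -> G j x -> i = j) ->
  (forall i x, G i x -> exists e, B (f i e) x) ->
  (\esum_(i in [set: K]) (m (G i) `^ q) <=
   (#|E|%:R `^ q * #|E|%:R)%:E * \esum_(j in [set: L]) (m (B j) `^ q))%E.
Proof.
move=> q1 mG mB tG GB; have q0 : 0 < q by rewrite (lt_le_trans ltr01).
have mGB i j : measurable (G i `&` B j) by exact: measurableI.
have step i : (m (G i) `^ q <=
    (#|E|%:R `^ q * #|E|%:R)%:E * \esum_(j in [set: L]) (m (G i `&` B j) `^ q))%E.
  pose x e := fine (m (G i `&` B (f i e))).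
  have xE e : m (G i `&` B (f i e)) = (x e)%:E by rewrite fineK// fin_num_measure.
  have x0 e : 0 <= x e by exact: fine_ge0.
  have mGE : m (G i) = (fine (m (G i)))%:E by rewrite fineK// fin_num_measure.
  have : (m (G i) <= \sum_e m (G i `&` B (f i e)))%E.
    by apply: measure_le_sum_finType => // y Gy; have [e Be] := GB i y Gy; exists e.
  under eq_bigr do rewrite xE.
  rewrite sumEFin mGE lee_fin => Gx.
  apply: (@le_trans _ _ ((#|E|%:R `^ q * \sum_e x e `^ q)%:E)).
    rewrite poweR_EFin lee_fin (le_trans _ (powR_sum_le q0 x0))//.
    by rewrite ge0_ler_powR ?nnegrE ?(ltW q0) ?fine_ge0 ?sumr_ge0.
  rewrite EFinM EFinM -muleA lee_wpmul2l ?lee_fin ?powR_ge0//.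
  rewrite -sumEFin.
  apply: (@le_trans _ _ (\sum_(e : E) \esum_(j in [set: L]) (m (G i `&` B j) `^ q))%E).
    apply: lee_sum => e _; rewrite -poweR_EFin -xE.
    by apply: (@ge_esum _ _ (fun j => m (G i `&` B j) `^ q)%E) => j; exact: poweR_ge0.
  by rewrite sumr_const mule_natl.
apply: (le_trans (le_esum (fun i _ => step i))).
rewrite esumZl ?mulr_ge0 ?powR_ge0//; last first.
  by move=> i; apply: esum_ge0 => j _; exact: poweR_ge0.
rewrite lee_wpmul2l ?lee_fin ?mulr_ge0 ?powR_ge0//.
rewrite exchange_esum; last by move=> i j; exact: poweR_ge0.
apply: le_esum => j _; apply: esum_poweR_le => //.
- by move=> i i' x [Gi _] [Gi' _]; exact: tG Gi Gi'.
Qed.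

Section mesh.
Context {R : realType} (n : nat).

Definition mesh_index (r : R) (x : 'rV[R]_n) : 'rV[int]_n := \row_j Num.floor (x 0 j / r).

Lemma mesh_cubeP (r : R) i x : 0 < r -> mesh_cube r i x <-> mesh_index r x = i.
Proof.
move=> r0; split=> [xi|<- j].
  apply/rowP => j; rewrite mxE; apply/eqP; rewrite floor_eq.
  by rewrite ler_pdivlMr// ltr_pdivrMr//; exact: xi.
by rewrite mxE -ler_pdivlMr// -ltr_pdivrMr// floor_itv.
Qed.

Lemma mesh_cube_inj (r : R) (i j : 'rV[int]_n) x : 0 < r -> mesh_cube r i x -> mesh_cube r j x -> i = j.
Proof. by move=> r0 /(mesh_cubeP _ _ r0) <- /(mesh_cubeP _ _ r0). Qed.

Lemma mesh_cube_index (r : R) x : 0 < r -> mesh_cube r (mesh_index r x) x.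
Proof. by move=> r0; apply/mesh_cubeP. Qed.

Lemma continuous_measurable_rV (f : 'rV[R]_n -> R) : continuous f ->
  measurable_fun [set: borel_rV R n] f.
Proof.
move=> /continuousP cf; apply: (measurability _ (RGenOpens.measurableE R)).
move=> _ [_ [a [b ->] <-]]; rewrite setTI.
by apply: sub_sigma_algebra; apply: cf; exact: interval_open.
Qed.

Lemma measurable_preimage_mesh_cube d {T : measurableType d} (f : T -> 'rV[R]_n) (r : R) i :
  (forall j, measurable_fun [set: T] (fun x => f x 0 j)) -> measurable (f @^-1` mesh_cube r i).
Proof.
move=> mf.
rewrite (_ : _ @^-1` _ = \bigcap_(j in [set: 'I_n])
    ((fun x => f x 0 j) @^-1` `[(i 0 j)%:~R * r, (i 0 j + 1)%:~R * r[)).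
  apply: fin_bigcap_measurable => //= j _.
  by rewrite -[X in measurable X]setTI; exact: mf.
apply/seteqP; split => [x xi j _|x xi j] /=; first by rewrite in_itv/=; exact: xi.
by have := xi j Logic.I; rewrite /= in_itv.
Qed.

Lemma measurable_rV_coord j : measurable_fun [set: borel_rV R n] (fun x : 'rV[R]_n => x 0 j).
Proof. exact: (continuous_measurable_rV (@coord_continuous _ _ _ _ _)). Qed.

Lemma measurable_mesh_cube (r : R) i : measurable (mesh_cube r i : set (borel_rV R n)).
Proof. exact: (@measurable_preimage_mesh_cube _ (borel_rV R n) id r i measurable_rV_coord). Qed.

End mesh.

Lemma sum_le_esum {R : realType} (E : finType) (K : choiceType) (c : E -> K) (a : K -> \bar R) :
  injective c -> (forall j, 0 <= a j)%E ->
  (\sum_e a (c e) <= \esum_(j in [set: K]) a j)%E.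
Proof.
move=> cI a0.
pose b j e := (if j == c e then a j else 0)%E.
have b0 j e : (0 <= b j e)%E by rewrite /b; case: ifP.
rewrite (_ : \sum_e _ = \sum_e \esum_(j in [set: K]) b j e)%E; last first.
  apply: eq_bigr => e _; rewrite (esum_single (i := c e))// /b ?eqxx//.
  by move=> j /negbTE ->.
rewrite -esum_sum//; apply: le_esum => j _.
have [[e <-]|nE] := pselect (exists e, c e = j).
  rewrite (bigD1 e)//= big1 ?adde0 /b ?eqxx// => e' /negbTE e'e.
  by rewrite (inj_eq cI) eq_sym e'e.
rewrite big1// => e _; rewrite /b; case: eqP => // je.
by case: nE; exists e.
Qed.

(** An interval of length 2 meets at most three cells of the unit mesh; this is the origin of the
    index type ['I_3] in the coverings below. *)
Lemma floor_window {R : realType} (a b : R) : a <= b <= a + 2 ->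
  0 <= Num.floor b - Num.floor a < 3.
Proof.
move=> /andP[ab ba]; rewrite subr_ge0 le_floor//= ltrBlDr floor_lt_int intrD.
by have := floorD1_gt a; rewrite intrD; lra.
Qed.

Section mesh_moment.
Context {R : realType} (n : nat) (nu : probability (borel_rV R n) R) (q : R) (q1 : 1 < q).

Let q0 : 0 < q. Proof. exact: lt_trans q1. Qed.
Let pq0 : 0 < q - 1. Proof. by rewrite subr_gt0. Qed.

Definition mesh_momentR (r : R) : R := fine (mesh_moment nu q r).

Lemma mesh_moment_le1 (r : R) : 0 < r -> (mesh_moment nu q r <= 1)%E.
Proof.
move=> r0; rewrite -[leRHS](@poweRe1 R 1%E)// (_ : 1 `^ 1 = nu setT `^ q)%E.
  apply: esum_poweR_le => //; first exact: ltW.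
  - exact: measurable_mesh_cube.
  - by move=> i j x; exact: mesh_cube_inj.
by rewrite probability_setT !poweR_EFin !powR1.
Qed.

Lemma mesh_moment_ge0 (r : R) : (0 <= mesh_moment nu q r)%E.
Proof. by apply: esum_ge0 => i _; exact: poweR_ge0. Qed.

Lemma mesh_momentE (r : R) : 0 < r -> mesh_moment nu q r = (mesh_momentR r)%:E.
Proof.
move=> r0; rewrite fineK// ge0_fin_numE ?mesh_moment_ge0//.
exact: le_lt_trans (mesh_moment_le1 r0) (ltry _).
Qed.

Lemma mesh_momentR_le1 (r : R) : 0 < r -> mesh_momentR r <= 1.
Proof. by move=> r0; rewrite -lee_fin -mesh_momentE// mesh_moment_le1. Qed.

Lemma mesh_momentR_gt0 (r : R) : 0 < r -> 0 < mesh_momentR r.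
Proof.
move=> r0; rewrite lt_neqAle -[0 <= _]lee_fin -mesh_momentE// mesh_moment_ge0 andbT.
apply/negP => /eqP M0.
have C0 i : nu (mesh_cube r i) = 0%E.
  have : (nu (mesh_cube r i) `^ q <= 0)%E.
    rewrite (_ : 0%E = mesh_moment nu q r); last by rewrite mesh_momentE// -M0.
    by apply: (@ge_esum _ _ (fun i => nu (mesh_cube r i) `^ q)%E) => j; exact: poweR_ge0.
  rewrite le_eqVlt => /orP[/eqP|]; first exact: poweR_eq0_eq0.
  by rewrite ltNge poweR_ge0.
have := @le_esum_integral _ _ _ nu _ (mesh_cube r) (@measurable_mesh_cube R n r) (cst 1%E).
move=> /(_ (measurable_cst _) (fun=> lee01)).
rewrite integral_cst//= mul1e probability_setT esum1; last first.
  move=> i _; rewrite integral_cst//= ?mul1e; last exact: measurable_mesh_cube.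
  exact: C0.
rewrite leNgt lte01; apply: contraPP => _ cE.
by suff : false by []; apply: cE => x; exists (mesh_index r x); exact: mesh_cube_index.
Qed.

Lemma mesh_moment_compare (r r' : R) : 0 < r -> 0 < r' -> r <= 2 * r' ->
  mesh_momentR r <= #|{ffun 'I_n -> 'I_3}|%:R `^ q * #|{ffun 'I_n -> 'I_3}|%:R * mesh_momentR r'.
Proof.
move=> r0 r'0 rr'; rewrite -lee_fin EFinM -!mesh_momentE//.
pose f (i : 'rV[int]_n) (e : {ffun 'I_n -> 'I_3}) : 'rV[int]_n :=
  \row_j (Num.floor ((i 0 j)%:~R * r / r') + (e j)%:Z).
apply: (@moment_refine _ (borel_rV R n) R nu _ _ {ffun 'I_n -> 'I_3} (mesh_cube r) (mesh_cube r') f) => //.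
- exact: ltW.
- exact: measurable_mesh_cube.
- exact: measurable_mesh_cube.
- by move=> i j x; exact: mesh_cube_inj.
move=> i x xi.
pose k j := Num.floor (x 0 j / r') - Num.floor ((i 0 j)%:~R * r / r').
have k03 j : 0 <= k j < 3.
  have /andP[x1 x2] := xi j; apply: floor_window.
  rewrite ler_pM2r ?invr_gt0// x1/= ler_pdivrMr// mulrDl divfK ?gt_eqF//.
  by move: x2; rewrite intrD mulrDl mul1r; lra.
exists [ffun j => inord `|k j|%N]; apply/mesh_cubeP => //; apply/rowP => j.
rewrite !mxE ffunE; have /andP[k0 k3] := k03 j.
rewrite inordK; last by rewrite -ltz_nat gez0_abs.
by rewrite gez0_abs// /k addrC subrK.
Qed.

(* Each cube [C] has [nu C <= l + l ^ (1 - q) (nu C) ^ q]; sum this over the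
   [O(r ^ - n)] cubes that carry half of the mass. *)
Lemma mesh_moment_lower : exists2 c : R, 0 < c & forall r, 0 < r <= 1 ->
  c * r `^ (n%:R * (q - 1)) <= mesh_momentR r.
Proof.
pose K (L : nat) : set (borel_rV R n) := [set x | forall j, (`|x 0 j| < L%:R)%R].
have mK L : measurable (K L).
  rewrite (_ : K L = \bigcap_(j in [set: 'I_n]) ((fun x : 'rV[R]_n => `|x 0 j|) @^-1` `]-oo, L%:R[)).
    apply: fin_bigcap_measurable => //= j _; rewrite -[X in measurable X]setTI.
    apply: (measurableT_comp _ (measurable_rV_coord j)) => //.
  by apply/seteqP; split=> x /= xK j;
    [move=> _; rewrite /= in_itv/=; exact: xK|have := xK j Logic.I; rewrite /= in_itv].
have [L nuL] : exists L : nat, ((2^-1)%:E <= nu (K L))%E.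
  have KT : \bigcup_L K L = setT.
    apply/seteqP; split => // x _; exists (Num.trunc (\sum_j `|x 0 j|)).+1 => // j.
    apply: le_lt_trans (truncnS_gt _); rewrite (bigD1 j)//= lerDl.
    by apply: sumr_ge0 => i _; exact: normr_ge0.
  have KS : {homo K : i j / (i <= j)%N >-> (i <= j)%O}.
    move=> i j ij; apply/subsetPset => x xi k; apply: (lt_le_trans (xi k)).
    by rewrite ler_nat.
  have nuT : nu (\bigcup_L K L) = 1%E by rewrite KT; exact: probability_setT.
  have cvgK : nu (K L) @[L --> \oo] --> 1%E.
    by rewrite -nuT; exact: (nondecreasing_cvg_mu mK (bigcupT_measurable _ mK) KS).
  apply: contrapT => nL.
  have : (limn (fun L => nu (K L)) <= (2^-1)%:E)%E.
    apply: lime_le; first by apply/cvg_ex; eexists; exact: cvgK.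
    by near=> L; rewrite /= leNgt; apply/negP => Lt; apply: nL; exists L; exact: ltW.
  by rewrite (cvg_lim _ cvgK)// lee_fin; lra.
pose A := ((2 * (L.+1)%:R) ^+ n : R).
have A0 : 0 < A by rewrite exprn_gt0// mulr_gt0.
exists (4^-1 * (4 * A) `^ (- (q - 1))); first by rewrite mulr_gt0// powR_gt0// mulr_gt0.
move=> r /andP[r0 r1].
pose b := (Num.trunc (L%:R / r)).+1.
have bL : L%:R / r < b%:R by exact: truncnS_gt.
have br : b%:R <= L.+1%:R / r.
  rewrite /b -!natr1 mulrDl lerD//; first by rewrite truncn_le divr_ge0// ltW.
  by rewrite mul1r invf_ge1.
pose c (e : {ffun 'I_n -> 'I_(2 * b)}) : 'rV[int]_n := \row_j ((e j)%:Z - b%:Z).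
have cI : injective c.
  move=> e e' /rowP ee'; apply/ffunP => j; apply/val_inj; have := ee' j.
  by rewrite !mxE => /addIr [].
pose N : R := #|{ffun 'I_n -> 'I_(2 * b)}|%:R.
have NE : N = (2 * b%:R) ^+ n by rewrite /N card_ffun !card_ord natrX natrM.
have N0 : 0 < N by rewrite NE exprn_gt0// mulr_gt0.
have NA : N <= A * r `^ (- n%:R).
  rewrite NE powRN powR_mulrn ?(ltW r0)// /A -exprVn -exprMn lerXn2r ?nnegrE ?mulr_ge0 ?invr_ge0 ?(ltW r0)//.
  by rewrite -mulrA ler_wpM2l.
(* Mass lost below the threshold is at most [N * l = 1 / 4], out of the mass at least 1/2 carried by
   the [N] cubes; the rest must come from the moment. *)
pose l := (4 * N)^-1.
have l0 : 0 < l by rewrite invr_gt0 mulr_gt0.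
have h1 : ((2^-1)%:E <= \sum_e nu (mesh_cube r (c e)))%E.
  apply: (le_trans nuL); apply: measure_le_sum_finType => //.
    by move=> e; exact: measurable_mesh_cube.
  move=> x xK.
  have hj j : exists o : 'I_(2 * b), o%:Z = Num.floor (x 0 j / r) + b%:Z.
    have : `|x 0 j / r| < b%:R.
      by rewrite (lt_trans _ bL)// normrM normfV (gtr0_norm r0) ltr_pM2r ?invr_gt0//; exact: xK.
    rewrite ltr_norml => /andP[xb1 xb2].
    have f1 : 0 <= Num.floor (x 0 j / r) + b%:Z.
      by rewrite -lerBlDr sub0r floor_ge_int mulrNz -pmulrn ltW.
    have f2 : Num.floor (x 0 j / r) < b%:Z by rewrite floor_lt_int.
    move: (Num.floor (x 0 j / r)) f1 f2 => z f1 f2.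
    have f3 : (`|(z + b%:Z)%R| < 2 * b)%N.
      by rewrite -ltz_nat gez0_abs// mul2n -addnn PoszD ltrD2r.
    by exists (Ordinal f3); rewrite /= gez0_abs.
  have [k kE] := choice hj.
  exists (finfun k); apply/mesh_cubeP => //; apply/rowP => j.
  by rewrite !mxE ffunE kE addrK.
have xl (x : R) : 0 <= x -> x <= l + l `^ (- (q - 1)) * x `^ q.
  move=> x0; have [xl|lx] := lerP x l.
    by rewrite (le_trans xl)// lerDl mulr_ge0// powR_ge0.
  rewrite (@le_trans _ _ (l `^ (- (q - 1)) * x `^ q))//; last by rewrite lerDr ltW.
  rewrite powRN ler_pdivlMl ?powR_gt0// [leRHS]powR_pred ?gt_eqF// ler_wpM2r//.
  by rewrite ge0_ler_powR ?nnegrE ?(ltW pq0)// ltW.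
have h2 : 2^-1 <= N * l + l `^ (- (q - 1)) * mesh_momentR r.
  pose x e := fine (nu (mesh_cube r (c e))).
  have xE e : nu (mesh_cube r (c e)) = (x e)%:E.
    by rewrite fineK// fin_num_measure//; exact: measurable_mesh_cube.
  have x0 e : 0 <= x e by exact: fine_ge0.
  move: h1; under eq_bigr do rewrite xE; rewrite sumEFin lee_fin => /le_trans; apply.
  apply: (@le_trans _ _ (\sum_e (l + l `^ (- (q - 1)) * x e `^ q))).
    by apply: ler_sum => e _; exact: xl.
  rewrite big_split/= sumr_const -mulr_natl lerD2l -mulr_sumr ler_wpM2l ?powR_ge0//.
  rewrite -lee_fin -mesh_momentE// -sumEFin.
  under eq_bigr do rewrite -poweR_EFin -xE.
  apply: (@sum_le_esum _ _ _ c (fun i => nu (mesh_cube r i) `^ q)%E) => // j.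
  exact: poweR_ge0.
have h3 : 4^-1 <= l `^ (- (q - 1)) * mesh_momentR r.
  have Nl : N * l = 4^-1 by rewrite /l; field; rewrite gt_eqF.
  by move: h2; rewrite Nl; lra.
have lE : l `^ (- (q - 1)) = (4 * N) `^ (q - 1).
  by rewrite /l -powR_inv1 ?mulr_ge0 ?(ltW N0)// -powRrM mulrNN mul1r.
pose u := (4 * A) `^ (q - 1); pose v := r `^ (n%:R * (q - 1)).
have u0 : 0 < u by rewrite powR_gt0// mulr_gt0.
have v0 : 0 < v by rewrite powR_gt0.
have h4 : 4^-1 <= u * v^-1 * mesh_momentR r.
  rewrite (le_trans h3)// lE ler_wpM2r ?(ltW (mesh_momentR_gt0 r0))//.
  rewrite /u /v -powRN -mulNr powRrM -powRM ?powR_ge0 ?mulr_ge0 ?(ltW A0)//.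
  rewrite ge0_ler_powR ?nnegrE ?(ltW pq0) ?mulr_ge0 ?(ltW N0) ?powR_ge0 ?(ltW A0)//.
  by rewrite -mulrA ler_wpM2l.
rewrite powRN -/u -/v (@le_trans _ _ (u * v^-1 * mesh_momentR r * u^-1 * v))//.
  by rewrite ler_wpM2r ?(ltW v0)// ler_wpM2r// invr_ge0 ltW.
by rewrite le_eqVlt; apply/orP; left; apply/eqP; field; rewrite !gt_eqF.
Unshelve. all: by end_near. Qed.

End mesh_moment.

(** * Generalized dimensions *)

Section gdim_characterization.
Context {R : realType} (n : nat) (nu : probability (borel_rV R n) R) (q : R) (q1 : 1 < q).

Let q0 : 0 < q. Proof. exact: lt_trans q1. Qed.
Let pq0 : 0 < q - 1. Proof. by rewrite subr_gt0. Qed.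
Let M := mesh_momentR nu q.
Let M0 r : 0 < r -> 0 < M r := @mesh_momentR_gt0 R n nu q q1 r.
Let M1 r : 0 < r -> M r <= 1 := @mesh_momentR_le1 R n nu q q1 r.

Let ratioE (r : R) : 0 < r -> moment_ratio nu q r = (ln (M r) / ((q - 1) * ln r))%:E.
Proof. by move=> r0; rewrite /moment_ratio mesh_momentE// lne_EFin ?M0// EFinM. Qed.

(** As [ln r < 0], bounds on the ratio and on the moment point in opposite directions: upper bounds
    on the dimension are lower bounds on [M]. *)
Let ratio_le (r s : R) : 0 < r < 1 ->
  (ln (M r) / ((q - 1) * ln r) <= s) = (r `^ (s * (q - 1)) <= M r).
Proof.
move=> /andP[r0 r1]; have lr : (q - 1) * ln r < 0 by rewrite nmulr_llt0 ?ln_lt0// r0.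
rewrite ler_ndivrMr// -[M r in RHS]lnK ?posrE ?M0// /powR (gt_eqF r0) ler_expR.
by rewrite mulrA.
Qed.

Let ratio_ge (r s : R) : 0 < r < 1 ->
  (s <= ln (M r) / ((q - 1) * ln r)) = (M r <= r `^ (s * (q - 1))).
Proof.
move=> /andP[r0 r1]; have lr : (q - 1) * ln r < 0 by rewrite nmulr_llt0 ?ln_lt0// r0.
rewrite ler_ndivlMr// -[M r in RHS]lnK ?posrE ?M0// /powR (gt_eqF r0) ler_expR.
by rewrite mulrA.
Qed.

Let nearE (Q : R -> Prop) (V : set R) : 0^'+ V -> (forall r, V r -> Q r) ->
  exists2 e : R, 0 < e < 1 & forall r, 0 < r < e -> Q r.
Proof.
move=> [e /= e0 eV] VQ.
exists (Num.min e 1 / 2).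
  rewrite divr_gt0 ?lt_min ?e0//= ltr_pdivrMr// mul1r.
  by rewrite gt_min; apply/orP; right; lra.
move=> r /andP[r0 re]; apply/VQ/eV => //=.
rewrite sub0r normrN gtr0_norm// (lt_trans re)// ltr_pdivrMr// gt_min.
by apply/orP; left; lra.
Qed.

(** Below some [e] the bound is the definition of the lower limit. For [e <= r <= 1] the bound
    [M r <= 1] suffices, and it fixes the constant. *)
Lemma lower_gdim_gtP (s : R) : 0 <= s -> (s%:E < lower_gdim q nu)%E ->
  exists2 C : R, 0 < C & forall r, 0 < r <= 1 -> M r <= C * r `^ (s * (q - 1)).
Proof.
move=> s0; rewrite /lower_gdim limf_einfE => /ereal_sup_gt[_ [V V0 <-] sV].
have [e /andP[e0 e1] eV] : exists2 e : R, 0 < e < 1 & forall r, 0 < r < e ->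
    (s%:E <= moment_ratio nu q r)%E.
  apply: (nearE V0) => r Vr; rewrite (le_trans (ltW sV))//.
  by apply: ereal_inf_lbound; exists r.
exists (e `^ (- (s * (q - 1)))); first exact: powR_gt0.
move=> r /andP[r0 r1]; have [re|er] := ltP r e.
  have r01 : 0 < r < 1 by rewrite r0 (lt_trans re).
  have := eV r; rewrite r0 re => /(_ isT); rewrite ratioE// lee_fin ratio_ge// => /le_trans; apply.
  rewrite ler_peMl ?powR_ge0// powRN invf_ge1 ?powR_gt0//.
  apply: (@le_trans _ _ (1 `^ (s * (q - 1)))); last by rewrite powR1.
  by rewrite ge0_ler_powR ?nnegrE ?mulr_ge0 ?(ltW pq0)//; exact: ltW.
rewrite (le_trans (M1 r0))// powRN mulrC ler_pdivlMr ?powR_gt0// mul1r.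
by rewrite ge0_ler_powR ?nnegrE ?mulr_ge0 ?(ltW pq0)//; exact: ltW.
Qed.

Lemma lower_gdim_geP (t C e : R) : 0 < e ->
  (forall r, 0 < r < e -> M r <= C * r `^ (t * (q - 1))) -> (t%:E <= lower_gdim q nu)%E.
Proof.
move=> e0 MC; apply/lee_addgt0Pr => x x0.
pose C' := Num.max C 1; have C'0 : 0 < C' by rewrite lt_max ltr01 orbT.
(* Below [e'] the constant [C'] is absorbed by the loss [x] in the exponent. *)
pose e' := Num.min e (Num.min 1 (C' `^ (- (x * (q - 1))^-1))).
have e'0 : 0 < e' by rewrite !lt_min e0 ltr01 powR_gt0.
have xq : 0 < x * (q - 1) by rewrite mulr_gt0.
rewrite -leeBlDr// -EFinB /lower_gdim limf_einfE.
apply: (@le_trans _ _ (ereal_inf [set moment_ratio nu q r | r in `]0, e'[%classic])); last first.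
  apply: ereal_sup_ubound.
  exists `]0, e'[%classic => //; exists e' => //= r /=.
  by rewrite sub0r normrN in_itv/= => + r0; rewrite gtr0_norm// r0.
apply: le_ereal_inf_tmp => _ [r + <-]; rewrite /= in_itv/= !lt_min => /and4P[r0 re r1 rC].
rewrite ratioE// lee_fin ratio_ge ?r0//.
apply: (@le_trans _ _ (C' * r `^ (t * (q - 1)))).
  by rewrite (le_trans (MC r _)) ?r0// ler_wpM2r ?powR_ge0// le_max lexx.
rewrite mulrBl powRD; last by rewrite (gt_eqF r0) ?implybT.
rewrite mulrC ler_wpM2l ?powR_ge0// powRN -[leLHS]invrK lef_pV2 ?posrE ?invr_gt0 ?powR_gt0//.
rewrite (@le_trans _ _ ((C' `^ (- (x * (q - 1))^-1)) `^ (x * (q - 1))))//.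
  by rewrite ge0_ler_powR ?nnegrE ?powR_ge0//; exact: ltW.
by rewrite -powRrM mulNr mulVf ?gt_eqF// powR_inv1// ltW.
Qed.

Lemma upper_gdim_ltP (s : R) : (upper_gdim q nu < s%:E)%E ->
  exists2 e : R, 0 < e < 1 & forall r, 0 < r < e -> r `^ (s * (q - 1)) <= M r.
Proof.
rewrite /upper_gdim limf_esupE => /ereal_inf_lt[_ [V V0 <-] sV].
have [e /andP[e0 e1] eV] : exists2 e : R, 0 < e < 1 & forall r, 0 < r < e ->
    (moment_ratio nu q r <= s%:E)%E.
  apply: (nearE V0) => r Vr; rewrite (le_trans _ (ltW sV))//.
  by apply: ereal_sup_ubound; exists r.
exists e; first by rewrite e0.
move=> r /andP[r0 re]; have := eV r; rewrite r0 re => /(_ isT).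
by rewrite ratioE// lee_fin ratio_le// r0 (lt_trans re).
Qed.

Lemma upper_gdim_leP (t c e : R) : 0 < e -> 0 < c ->
  (forall r, 0 < r < e -> c * r `^ (t * (q - 1)) <= M r) -> (upper_gdim q nu <= t%:E)%E.
Proof.
move=> e0 c0 Mc; apply/lee_addgt0Pr => x x0.
pose e' := Num.min e (Num.min 1 (c `^ ((x * (q - 1))^-1))).
have e'0 : 0 < e' by rewrite !lt_min e0 ltr01 powR_gt0.
have xq : 0 < x * (q - 1) by rewrite mulr_gt0.
rewrite -EFinD /upper_gdim limf_esupE.
apply: (@le_trans _ _ (ereal_sup [set moment_ratio nu q r | r in `]0, e'[%classic])).
  apply: ereal_inf_lbound.
  exists `]0, e'[%classic => //; exists e' => //= r /=.
  by rewrite sub0r normrN in_itv/= => + r0; rewrite gtr0_norm// r0.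
apply: ge_ereal_sup => _ [r + <-]; rewrite /= in_itv/= !lt_min => /and4P[r0 re r1 rC].
rewrite ratioE// lee_fin ratio_le ?r0//.
apply: le_trans (Mc r _); last by rewrite r0.
rewrite mulrDl powRD; last by rewrite (gt_eqF r0) ?implybT.
rewrite mulrC ler_wpM2r ?powR_ge0//.
rewrite (@le_trans _ _ ((c `^ ((x * (q - 1))^-1)) `^ (x * (q - 1))))//.
  by rewrite ge0_ler_powR ?nnegrE ?powR_ge0//; exact: ltW.
by rewrite -powRrM mulVf ?gt_eqF// powRr1// ltW.
Qed.

Lemma lower_gdim_ge0 : (0 <= lower_gdim q nu)%E.
Proof.
apply: (@lower_gdim_geP 0 1 1) => // r /andP[r0 _].
by rewrite mul0r powRr0 mulr1 M1.
Qed.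

Lemma upper_gdim_le_dim : (upper_gdim q nu <= n%:R%:E)%E.
Proof.
have [c c0 cM] := mesh_moment_lower nu q1.
by apply: (@upper_gdim_leP _ c 1) => // r /andP[r0 r1]; rewrite cM// r0 ltW.
Qed.

Lemma lower_gdim_le_upper : (lower_gdim q nu <= upper_gdim q nu)%E.
Proof.
rewrite /lower_gdim /upper_gdim limf_einfE limf_esupE.
apply: ge_ereal_sup => _ [V V0 <-]; apply: le_ereal_inf_tmp => _ [W W0 <-].
have [r [Vr Wr]] := filter_ex (filterI V0 W0).
apply: (@le_trans _ _ (moment_ratio nu q r)).
  by apply: ereal_inf_lbound; exists r.
by apply: ereal_sup_ubound; exists r.
Qed.

(** The least index with [b ^+ m < r] is lowered by one. Consecutive powers differ by a factor at
    most 2 because [b >= 1 / 2], which is what [mesh_moment_compare] tolerates. *)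
Let geometric_bracket (b r : R) (m0 : nat) : 2^-1 <= b < 1 -> 0 < r < b ^+ m0 ->
  exists2 m : nat, (m0 <= m)%N & r <= b ^+ m <= 2 * r.
Proof.
move=> /andP[b2 b1] /andP[r0 rb]; have b0 : 0 < b by rewrite (lt_le_trans _ b2).
have [k kr] : exists k, b ^+ k < r.
  have bn : `|b| < 1 by rewrite gtr0_norm.
  have /cvgrPdist_lt/(_ r r0)[k _ /(_ k (leqnn k))] := cvg_expr bn.
  by rewrite /= sub0r normrN gtr0_norm ?exprn_gt0// => ?; exists k.
have [m mr mmin] := ex_minnP (ex_intro (fun k => is_true (b ^+ k < r)) k kr).
have m0m : (m0 < m)%N.
  rewrite ltnNge; apply/negP => mm0; have : b ^+ m0 <= b ^+ m.
    by rewrite ler_wiXn2l// ltW.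
  by move: mr rb; lra.
case: m => // m in mr mmin m0m *.
exists m => //; apply/andP; split.
  by rewrite leNgt; apply/negP => /mmin; rewrite ltnn.
by move: mr; rewrite exprS; have : 0 < b ^+ m; [exact: exprn_gt0|nra].
Qed.

Lemma lower_gdim_ge_seq (b t C : R) : 2^-1 <= b < 1 -> 0 <= t -> 0 <= C ->
  (\forall m \near \oo, M (b ^+ m) <= C * (b ^+ m) `^ (t * (q - 1))) ->
  (t%:E <= lower_gdim q nu)%E.
Proof.
move=> b12 t0 C0 [m0 _ MC]; have /andP[b2 b1] := b12.
have b0 : 0 < b by rewrite (lt_le_trans _ b2).
pose D : R := #|{ffun 'I_n -> 'I_3}|%:R `^ q * #|{ffun 'I_n -> 'I_3}|%:R.
have D0 : 0 <= D by rewrite mulr_ge0// powR_ge0.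
apply: (@lower_gdim_geP t (D * (C * 2 `^ (t * (q - 1)))) (b ^+ m0)); first exact: exprn_gt0.
move=> r rb; have [m m0m /andP[rm mr]] := geometric_bracket b12 rb.
have /andP[r0 _] := rb; have bm0 : 0 < b ^+ m by exact: exprn_gt0.
have := @mesh_moment_compare R n nu q q1 r (b ^+ m) r0 bm0.
rewrite -/D => /(_ _)/le_trans; apply; first by lra.
rewrite -mulrA ler_wpM2l// (le_trans (MC m m0m))// -mulrA ler_wpM2l//.
by rewrite -powRM ?(ltW r0)// ge0_ler_powR ?nnegrE ?mulr_ge0 ?(ltW r0)// ltW.
Qed.

Lemma upper_gdim_le_seq (b t c : R) : 2^-1 <= b < 1 -> 0 <= t -> 0 < c ->
  (\forall m \near \oo, c * (b ^+ m) `^ (t * (q - 1)) <= M (b ^+ m)) ->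
  (upper_gdim q nu <= t%:E)%E.
Proof.
move=> b12 t0 c0 [m0 _ Mc]; have /andP[b2 b1] := b12.
have b0 : 0 < b by rewrite (lt_le_trans _ b2).
pose D : R := #|{ffun 'I_n -> 'I_3}|%:R `^ q * #|{ffun 'I_n -> 'I_3}|%:R.
have D0 : 0 < D.
  have E0 : 0 < #|{ffun 'I_n -> 'I_3}|%:R :> R by rewrite card_ffun !card_ord natrX exprn_gt0.
  by rewrite mulr_gt0// powR_gt0.
have tq : 0 <= t * (q - 1) by rewrite mulr_ge0// ltW.
apply: (@upper_gdim_leP t (D^-1 * c) (b ^+ m0)); first exact: exprn_gt0.
  by rewrite mulr_gt0// invr_gt0.
move=> r rb; have [m m0m /andP[rm mr]] := geometric_bracket b12 rb.
have /andP[r0 _] := rb; have bm0 : 0 < b ^+ m by exact: exprn_gt0.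
have := @mesh_moment_compare R n nu q q1 (b ^+ m) r bm0 r0 mr.
rewrite -/D -ler_pdivrMl// => /(le_trans _); apply.
rewrite -mulrA ler_wpM2l ?invr_ge0 ?(ltW D0)// (le_trans _ (Mc m m0m))// ler_wpM2l ?(ltW c0)//.
by rewrite ge0_ler_powR ?nnegrE// ltW.
Qed.

End gdim_characterization.

(** * Image measures, joint measurability and Borel-Cantelli *)

Section image_probability.
Context {R : realType} (N D : nat) (mu : probability (borel_rV R N) R).

Lemma continuous_measurable_rV_rV (f : 'rV[R]_N -> 'rV[R]_D) : continuous f ->
  measurable_fun [set: borel_rV R N] (f : borel_rV R N -> borel_rV R D).
Proof.
move=> /continuousP cf; apply: (@measurability _ _ (borel_rV R N) (borel_rV R D) setT _ open erefl).
move=> _ [U oU <-]; rewrite setTI; apply: sub_sigma_algebra; exact: cf.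
Qed.

(** [image_measure] is a plain set function, whereas mesh moments are studied for [probability]
    structures. The almost sure statements below quantify over every such [nu] that coincides with
    the image. *)
Lemma image_probability (f : 'rV[R]_N -> 'rV[R]_D) : continuous f ->
  exists nu : probability (borel_rV R D) R, (nu : set _ -> \bar R) = image_measure mu f.
Proof.
move=> /continuous_measurable_rV_rV mf.
pose F : {mfun borel_rV R N >-> borel_rV R D} :=
  HB.pack (f : borel_rV R N -> borel_rV R D) (isMeasurableFun.Build _ _ _ _ _ mf).
by exists (distribution mu F).
Qed.

End image_probability.

(** With [x] replaced by the corner of its dyadic cube, the field is evaluated at countably many
    points, each on a measurable piece; continuity of the paths gives the pointwise limit. *)
Lemma measurable_joint d {T : measurableType d} {R : realType} (n : nat) (X : T -> 'rV[R]_n -> R) :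
  (forall x, measurable_fun [set: T] (fun w => X w x)) -> (forall w, continuous (X w)) ->
  measurable_fun [set: T * borel_rV R n] (fun wx => X wx.1 wx.2).
Proof.
move=> mX cX.
pose r (m : nat) : R := 2^-1 ^+ m.
have r0 m : 0 < r m by rewrite exprn_gt0// invr_gt0.
pose c m (i : 'rV[int]_n) : 'rV[R]_n := \row_j ((i 0 j)%:~R * r m).
apply: (@measurable_fun_cvg _ (T * borel_rV R n)%type R setT
  (fun m wx => X wx.1 (c m (mesh_index (r m) wx.2))) (fun wx => X wx.1 wx.2)).
  move=> m _ Y mY; rewrite setTI.
  rewrite (_ : _ @^-1` _ = \bigcup_(i : 'rV[int]_n)
    ((fun wx => X wx.1 (c m i)) @^-1` Y `&` snd @^-1` mesh_cube (r m) i)); last first.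
    apply/seteqP; split => [[w x] /= Yx|[w x] [i _ [/= Yx /(mesh_cubeP _ _ (r0 m)) xi]]].
      by exists (mesh_index (r m) x) => //; split => //=; exact: mesh_cube_index.
    by rewrite /= xi.
  apply: countable_bigcupT_measurable; first exact: countableP.
  move=> i; apply: measurableI.
    rewrite -[X in measurable X]setTI.
    exact: (measurableT_comp (mX (c m i)) (@measurable_fst _ _ T (borel_rV R n))).
  rewrite -[X in measurable X]setTI.
  by apply: (@measurable_snd _ _ T (borel_rV R n)) => //; exact: measurable_mesh_cube.
move=> [w x] _ /=; apply: (@cvg_comp _ _ _ (fun m => c m (mesh_index (r m) x)) (X w)); last exact: cX.
apply/cvgrPdist_lt => e e0.
have rc : r m @[m --> \oo] --> 0 by apply: cvg_expr; rewrite gtr0_norm ?invr_gt0// invf_lt1//; lra.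
have /cvgrPdist_lt/(_ e e0) := rc; apply: filterS => m; rewrite sub0r normrN gtr0_norm// => re.
rewrite [ltLHS]mx_normrE; apply/bigmax_ltP; split => // -[i j] _ /=; rewrite !mxE.
have /andP[x1 x2] := mesh_cube_index x (r0 m) j.
rewrite mxE in x1; rewrite mxE in x2; rewrite (ord1 i) ger0_norm ?subr_ge0//.
by move: x2; rewrite intrD mulrDl mul1r; lra.
Qed.

Lemma real_fbm_increment_sqr d {T : measurableType d} {R : realType} (P : probability T R) (N : nat)
    (alpha : R) (B : T -> 'rV[R]_N -> R) (x y : 'rV[R]_N) : 0 < alpha -> real_fbm P alpha B ->
  (\int[P]_w ((B w x - B w y) ^+ 2)%:E = (euclidean_norm (x - y) `^ (2 * alpha))%:E)%E.
Proof.
move=> a0 fB.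
have sum2 (F : 'I_2 -> R) : \sum_j F j = F ord0 + F (lift ord0 ord0) by rewrite big_ord_recl big_ord1.
pose z (j : 'I_2) := if j == ord0 then x else y.
pose a (j : 'I_2) : R := if j == ord0 then 1 else -1.
have as0 : \sum_j a j = 0 by rewrite sum2 /a/= subrr.
have := real_fbm_variance fB z as0.
under eq_integral do rewrite sum2 /a /z/= mul1r mulN1r.
move=> ->; congr EFin.
have nz : euclidean_norm (0 : 'rV[R]_N) `^ (2 * alpha) = 0.
  rewrite /euclidean_norm big1 ?sqrtr0 ?powR0// ?gt_eqF ?mulr_gt0// => j _.
  by rewrite mxE expr0n.
have nN (u : 'rV[R]_N) : euclidean_norm (- u) = euclidean_norm u.
  by congr Num.sqrt; apply: eq_bigr => j _; rewrite mxE sqrrN.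
rewrite sum2 [in X in _ * X]sum2 /a /z/= sum2/= !subrr nz -(opprB x y) nN.
by move: (_ `^ _) => u; field.
Qed.

(** Borel-Cantelli in expectation form: the series has finite mean, hence is almost surely finite,
    and its tails eventually stay below 1. *)
Lemma ae_eventually_le1 d {T : measurableType d} {R : realType} (P : probability T R)
    (g : nat -> T -> \bar R) (C e : R) :
  (forall m, measurable_fun [set: T] (g m)) -> (forall m w, 0 <= g m w)%E ->
  0 <= C -> 0 <= e < 1 -> (forall m, \int[P]_w g m w <= (C * e ^+ m)%:E)%E ->
  {ae P, forall w, \forall m \near \oo, (g m w <= 1)%E}.
Proof.
move=> mg g0 C0 /andP[e0 e1] gC.
pose S w := (\sum_(0 <= m <oo) g m w)%E.
have S0 w : (0 <= S w)%E by exact: nneseries_ge0.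
have mS : measurable_fun [set: T] S.
  by apply: ge0_emeasurable_sum => // m w _ _.
have iS : P.-integrable [set: T] S.
  apply/integrableP; split => //.
  under eq_integral do rewrite gee0_abs//.
  rewrite integral_nneseries//.
  apply: (@le_lt_trans _ _ (\sum_(0 <= m <oo) (C * e ^+ m)%:E)%E).
    by apply: lee_nneseries => m _ *; [exact: integral_ge0|exact: gC].
  have en : `|e| < 1 by rewrite ger0_norm.
  have cs := @cvg_geometric_series _ C e en.
  have cs' : (fun n => \sum_(0 <= m < n) (C * e ^+ m)%:E)%E @ \oo --> (C * (1 - e)^-1)%:E.
    rewrite (_ : (fun n => _) = EFin \o series (geometric C e)).
      by apply: cvg_EFin; [exact: nearW|exact: cs].
    by apply/funext => n; rewrite /= -sumEFin.
  by rewrite (cvg_lim _ cs') ?ltry.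
have := integrable_ae measurableT iS; apply: filterS => w /(_ Logic.I) Sw.
have : (S w < +oo)%E by rewrite -ge0_fin_numE.
move=> Sfin; have tl := nneseries_tail_cvg Sfin (fun k _ => g0 k w).
have n1 : nbhs (0%R%:E : \bar R) [set y : \bar R | (y < 1)%E].
  by apply: open_nbhs_nbhs; split; [exact: open_ereal_lt_ereal|rewrite /= lte01].
have : \forall m \near \oo, (\sum_(m <= k <oo) g k w < 1)%E := tl _ n1.
apply: filterS => m /= /ltW; apply: le_trans.
rewrite (nneseries_split m 1) ?addn1 ?big_nat1 ?leeDl//.
by apply: nneseries_ge0.
Unshelve. all: by end_near. Qed.

(** * Upper bounds *)

Section upper_comparison.
Context d {T : measurableType d} {R : realType} (P : probability T R) (N D : nat).
Context (alpha : R) (a01 : 0 < alpha < 1) (X : T -> 'rV[R]_N -> 'rV[R]_D) (fX : fbm P alpha X).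
Context (mu : probability (borel_rV R N) R) (q : R) (q1 : 1 < q).

Let mX x i : measurable_fun [set: T] (fun w => X w x 0 i).
Proof. exact: fbm_measurable fX x i. Qed.

Let cX w i : continuous (fun x => X w x 0 i).
Proof.
have [_ _ c] := fX; move=> x.
by apply: (@cvg_comp _ _ _ (X w) (fun y : 'rV[R]_D => y 0 i)); [exact: c|exact: coord_continuous].
Qed.

Let mXj i : measurable_fun [set: T * borel_rV R N] (fun wx => X wx.1 wx.2 0 i).
Proof. exact: (@measurable_joint _ T R N (fun w x => X w x 0 i)). Qed.

Let corner (r : R) (i : 'rV[int]_N) : 'rV[R]_N := \row_j ((i 0 j)%:~R * r).

Let corner_dist (r : R) i x : 0 < r -> mesh_cube r i x ->
  euclidean_norm (x - corner r i) <= Num.sqrt N%:R * r.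
Proof.
move=> r0 xi; rewrite -[X in _ * X](gtr0_norm r0) -sqrtr_sqr -sqrtrM//.
rewrite ler_wsqrtr//.
rewrite (_ : N%:R * r ^+ 2 = \sum_(j < N) r ^+ 2); last by rewrite sumr_const card_ord mulr_natl.
apply: ler_sum => j _; rewrite !mxE.
have /andP[x1 x2] := xi j; rewrite intrD mulrDl mul1r in x2.
by rewrite ler_sqr ?nnegrE ?(ltW r0) ?subr_ge0//; lra.
Qed.

Let far (r s : R) (i : 'rV[int]_N) : set (T * borel_rV R N) :=
  [set wx | mesh_cube r i wx.2 /\ exists k, s <= `|X wx.1 wx.2 0 k - X wx.1 (corner r i) 0 k|].

Let mfar r s i : measurable (far r s i).
Proof.
rewrite (_ : far r s i = (snd @^-1` mesh_cube r i) `&` \bigcup_(k in [set: 'I_D])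
   ((fun wx => `|X wx.1 wx.2 0 k - X wx.1 (corner r i) 0 k|) @^-1` `[s, +oo[)).
  apply: measurableI.
    rewrite -[X in measurable X]setTI.
    by apply: (@measurable_snd _ _ T (borel_rV R N)) => //; exact: measurable_mesh_cube.
  apply: fin_bigcup_measurable => //= k _; rewrite -[X in measurable X]setTI.
  apply: (_ : measurable_fun setT _) => //.
  apply: measurableT_comp => //; apply: measurable_funB; first exact: mXj.
  exact: (measurableT_comp (mX (corner r i) k) (@measurable_fst _ _ T (borel_rV R N))).
apply/seteqP; split => [[w x] [xi [k ks]]|[w x] [/= xi [k _ ks]]].
  by split => //; exists k => //=; rewrite in_itv/= ks.
by split => //=; exists k; move: ks; rewrite /= in_itv/= andbT.
Qed.

Let bad r s i w : \bar R := (\int[mu]_x (\1_(far r s i) (w, x))%:E)%E.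

Let mIfar r s i : measurable_fun [set: T * borel_rV R N] (fun wx => (\1_(far r s i) wx)%:E : \bar R).
Proof. by apply/measurable_EFinP; exact: measurable_indic. Qed.

Let mbad r s i : measurable_fun [set: T] (bad r s i).
Proof.
have := @measurable_fun_fubini_tonelli_F _ _ T (borel_rV R N) R mu _ (mIfar r s i).
by apply => wx; rewrite lee_fin.
Qed.

Let chebyshev x y (s : R) : 0 < s ->
  (\int[P]_w (\1_[set w | exists k, (s <= `|X w x 0 k - X w y 0 k|)%R] w)%:E <=
   (D%:R * euclidean_norm (x - y) `^ (2 * alpha) / s ^+ 2)%:E)%E.
Proof.
move=> s0; have /andP[a0 a1] := a01.
have mI k : measurable_fun [set: T] (fun w => (X w x 0 k - X w y 0 k) ^+ 2).
  by apply: measurable_funX; exact: measurable_funB.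
apply: (@le_trans _ _ (\int[P]_w (\sum_k ((s ^- 2)%:E * ((X w x 0 k - X w y 0 k) ^+ 2)%:E)))%E).
  apply: ge0_le_integral => //.
  - apply/measurable_EFinP; apply: measurable_indic.
    rewrite (_ : mkset _ = \bigcup_(k in [set: 'I_D])
        ((fun w => `|X w x 0 k - X w y 0 k|) @^-1` `[s, +oo[)).
      apply: fin_bigcup_measurable => //= k _; rewrite -[X in measurable X]setTI.
      apply: (_ : measurable_fun setT _) => //.
      by apply: measurableT_comp => //; exact: measurable_funB.
    apply/seteqP; split => [w [k ks]|w [k _ ks]].
      by exists k => //=; rewrite in_itv/= ks.
    by exists k; move: ks; rewrite /= in_itv/= andbT.
  - apply: emeasurable_sum => k; apply: emeasurable_funM => //.
    exact/measurable_EFinP.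
  - move=> w _; under eq_bigr do rewrite -EFinM; rewrite sumEFin lee_fin indicE.
    have t0 k : 0 <= s ^- 2 * (X w x 0 k - X w y 0 k) ^+ 2.
      by rewrite mulr_ge0 ?sqr_ge0// invr_ge0 sqr_ge0.
    have [|_] := boolP (w \in _); last exact: sumr_ge0.
    rewrite inE => -[k ks]; rewrite (bigD1 k)//=.
    apply: (@le_trans _ _ (s ^- 2 * (X w x 0 k - X w y 0 k) ^+ 2)).
      rewrite mulrC ler_pdivlMr ?exprn_gt0// mul1r -[leRHS]real_normK ?num_real//.
      by rewrite ler_sqr ?nnegrE// ltW.
    by rewrite lerDl sumr_ge0.
rewrite ge0_integral_sum//; last 2 first.
- by move=> k; apply: emeasurable_funM => //; exact/measurable_EFinP.
- by move=> k w _; rewrite mule_ge0// lee_fin ?sqr_ge0// invr_ge0 sqr_ge0.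
have [fB _ _] := fX.
rewrite (eq_bigr (fun k : 'I_D => (s ^- 2 * euclidean_norm (x - y) `^ (2 * alpha))%:E)); last first.
  move=> k _; rewrite ge0_integralZl_EFin//.
  - by rewrite (real_fbm_increment_sqr x y a0 (fB k)) EFinM.
  - by move=> w _; rewrite lee_fin sqr_ge0.
  - exact/measurable_EFinP.
  - by rewrite invr_ge0 sqr_ge0.
rewrite sumEFin sumr_const card_ord lee_fin -mulr_natl le_eqVlt; apply/orP; left; apply/eqP.
by move: (_ `^ _) => u; field; rewrite gt_eqF.
Qed.

Let cst_delta (r s : R) := D%:R * (Num.sqrt N%:R * r) `^ (2 * alpha) / s ^+ 2.

Let cst_delta_ge0 r s : 0 < s -> 0 <= cst_delta r s.
Proof. by move=> s0; rewrite divr_ge0 ?sqr_ge0// mulr_ge0// powR_ge0. Qed.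

Let integral_bad r s i : 0 < r -> 0 < s ->
  (\int[P]_w bad r s i w <= (cst_delta r s)%:E * mu (mesh_cube r i))%E.
Proof.
move=> r0 s0; have /andP[a0 a1] := a01.
rewrite /bad.
rewrite (@fubini_tonelli _ _ T (borel_rV R N) R P mu (fun wx => (\1_(far r s i) wx)%:E))//=.
have mC := @measurable_mesh_cube R N r i.
have -> : mu (mesh_cube r i) = (\int[mu]_x (\1_(mesh_cube r i) x)%:E)%E.
  by rewrite integral_indic// setIT.
rewrite -ge0_integralZl_EFin ?cst_delta_ge0//; last first.
  by apply/measurable_EFinP; exact: measurable_indic.
apply: ge0_le_integral => //.
- by move=> x _; apply: integral_ge0 => w _; rewrite lee_fin.
- have := @measurable_fun_fubini_tonelli_G _ _ T (borel_rV R N) R P _ (mIfar r s i).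
  by apply => wx; rewrite lee_fin.
- by apply: emeasurable_funM => //; apply/measurable_EFinP; exact: measurable_indic.
move=> x _; have [xi|xi] := pselect (mesh_cube r i x); last first.
  rewrite integral0_eq; last by move=> w _; rewrite indicE memNset// => -[].
  by rewrite mule_ge0// lee_fin ?cst_delta_ge0.
rewrite [X in (_ * X)%E](_ : _ = 1%E) ?mule1; last by rewrite indicE mem_set.
rewrite (eq_integral (fun w => (\1_[set w | exists k, s <= `|X w x 0 k - X w (corner r i) 0 k|] w)%:E)); last first.
  move=> w _; congr EFin; rewrite [LHS]indicE [RHS]indicE; congr (nat_of_bool _)%:R.
  by apply/idP/idP; rewrite !inE; [case|split].
apply: (le_trans (chebyshev _ _ s0)); rewrite lee_fin ler_wpM2r ?invr_ge0 ?sqr_ge0//.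
rewrite ler_wpM2l// ge0_ler_powR ?nnegrE ?mulr_ge0 ?(ltW a0) ?sqrtr_ge0 ?(ltW r0)//.
exact: corner_dist.
Qed.

(** Since [bad] is at most the mass of the cube, each summand dominates the [q]-th power of [bad].
    Being linear in [bad], it has an expectation that Fubini and Chebyshev bound. *)
Let excess (r s : R) w : \bar R :=
  (\esum_(i in [set: 'rV[int]_N]) ((fine (mu (mesh_cube r i)) `^ (q - 1))%:E * bad r s i w))%E.

Let bad_ge0 r s i w : (0 <= bad r s i w)%E.
Proof. by apply: integral_ge0 => x _; rewrite lee_fin. Qed.

Let mexcess r s : measurable_fun [set: T] (excess r s).
Proof.
apply: measurable_esum => [i|i w]; last by rewrite mule_ge0 ?bad_ge0// lee_fin powR_ge0.
by apply: emeasurable_funM => //; exact: mbad.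
Qed.

Let integral_excess r s : 0 < r -> 0 < s ->
  (\int[P]_w excess r s w <= (cst_delta r s)%:E * mesh_moment mu q r)%E.
Proof.
move=> r0 s0.
rewrite integral_esum; last 2 first.
- by move=> i; apply: emeasurable_funM => //; exact: mbad.
- by move=> i w; rewrite mule_ge0 ?bad_ge0// lee_fin powR_ge0.
rewrite /mesh_moment -esumZl ?cst_delta_ge0//; last by move=> i; exact: poweR_ge0.
apply: le_esum => i _.
rewrite ge0_integralZl_EFin ?powR_ge0//.
apply: (@le_trans _ _ ((fine (mu (mesh_cube r i)) `^ (q - 1))%:E *
    ((cst_delta r s)%:E * mu (mesh_cube r i)))%E).
  by rewrite lee_wpmul2l ?lee_fin ?powR_ge0//; exact: integral_bad.
have mC := @measurable_mesh_cube R N r i.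
have -> : mu (mesh_cube r i) = (fine (mu (mesh_cube r i)))%:E by rewrite fineK// fin_num_measure.
rewrite poweR_EFin -!EFinM lee_fin /= [in leRHS]powR_pred ?fine_ge0// ?gt_eqF ?(lt_trans _ q1)//.
by rewrite mulrCA.
Qed.

(** Each cube is split into the points whose image stays within [s] of the image of the corner, and
    the others. The first part maps into a box of side [2 * s], covered by three cells in each
    direction; the second is charged to [excess]. *)
Let mesh_moment_excess (w : T) (nu : probability (borel_rV R D) R) (r s : R) : 0 < r -> 0 < s ->
  (nu : set _ -> \bar R) = image_measure mu (X w) ->
  (mesh_moment mu q r <= (2 `^ q)%:E *
    ((#|{ffun 'I_D -> 'I_3}|%:R `^ q * #|{ffun 'I_D -> 'I_3}|%:R)%:E * mesh_moment nu q s +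
     excess r s w))%E.
Proof.
move=> r0 s0 nuE; have q0 : 0 < q by rewrite (lt_trans _ q1).
pose near i : set (borel_rV R N) :=
  [set x | mesh_cube r i x /\ forall k, `|X w x 0 k - X w (corner r i) 0 k| < s].
pose away i : set (borel_rV R N) :=
  [set x | mesh_cube r i x /\ exists k, s <= `|X w x 0 k - X w (corner r i) 0 k|].
have mXw k : measurable_fun [set: borel_rV R N] (fun x => X w x 0 k).
  exact: continuous_measurable_rV.
have mC i := @measurable_mesh_cube R N r i.
have maway i : measurable (away i).
  rewrite (_ : away i = xsection (far r s i) w); first exact: measurable_xsection.
  by apply/seteqP; split => x; rewrite /xsection/= inE.
have nearE i : near i = mesh_cube r i `\` away i.
  apply/seteqP; split=> [x [xi xk]|x [xi nx]].
    by split=> // -[_ [k]]; rewrite leNgt xk.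
  by split => // k; rewrite ltNge; apply/negP => sk; apply: nx; split => //; exists k.
have mnear i : measurable (near i) by rewrite nearE; exact: measurableD.
have awayE i : mu (away i) = bad r s i w.
  transitivity (\int[mu]_x (\1_(away i) x)%:E)%E; first by rewrite integral_indic// setIT.
  exact: eq_integral.
have fE (A : set (borel_rV R N)) : measurable A -> mu A = (fine (mu A))%:E.
  by move=> mA; rewrite fineK// fin_num_measure.
have step i : (mu (mesh_cube r i) `^ q <= (2 `^ q)%:E * (mu (near i) `^ q +
    (fine (mu (mesh_cube r i)) `^ (q - 1))%:E * bad r s i w))%E.
  have split : (mu (mesh_cube r i) <= mu (near i) + mu (away i))%E.
    rewrite (_ : mesh_cube r i = near i `|` away i); last first.
      by rewrite nearE setDKU// => x [].
    exact: measureU2.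
  have : (mu (away i) <= mu (mesh_cube r i))%E by rewrite le_measure ?inE// => x [].
  move: split; rewrite -awayE (fE _ (mC i)) (fE _ (mnear i)) (fE _ (maway i)) -EFinD !lee_fin => cab bc.
  rewrite /=.
  set c := fine _ in cab bc *; set a := fine _ in cab *; set b' := fine _ in cab bc *.
  have [c0 a0 b0] : [/\ 0 <= c, 0 <= a & 0 <= b'] by split; exact: fine_ge0.
  have := @powR_sum_le R bool (fun e => if e then a else b') q q0.
  rewrite !big_bool card_bool => h.
  apply: (@le_trans _ _ ((a + b') `^ q)); first by rewrite ge0_ler_powR ?nnegrE ?addr_ge0 ?(ltW q0).
  apply: (le_trans (h _)); first by case.
  rewrite ler_wpM2l ?powR_ge0// lerD2l [leLHS]powR_pred ?gt_eqF// ler_wpM2r//.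
  by rewrite ge0_ler_powR ?nnegrE ?subr_ge0// ltW.
apply: (le_trans (le_esum (fun i _ => step i))).
have nn i : (0 <= (fine (mu (mesh_cube r i)) `^ (q - 1))%:E * bad r s i w)%E.
  by rewrite mule_ge0 ?bad_ge0// lee_fin powR_ge0.
rewrite esumZl ?powR_ge0//; last by move=> i; rewrite adde_ge0 ?poweR_ge0.
rewrite lee_wpmul2l ?lee_fin ?powR_ge0//.
rewrite esumD//; last by move=> i _; exact: poweR_ge0.
rewrite leeD2r// /mesh_moment.
under [in leRHS]eq_esum => j _ do rewrite nuE.
pose f (i : 'rV[int]_N) (e : {ffun 'I_D -> 'I_3}) : 'rV[int]_D :=
  \row_k (Num.floor (X w (corner r i) 0 k / s - 1) + (e k)%:Z).
apply: (@moment_refine _ (borel_rV R N) R mu _ _ _ near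
    (fun j => X w @^-1` mesh_cube s j) f) => //.
- exact: ltW.
- by move=> j; exact: (@measurable_preimage_mesh_cube R D _ (borel_rV R N)).
- by move=> i j x [xi _] [xj _]; exact: mesh_cube_inj xi xj.
move=> i x [xi xk].
pose z k := Num.floor (X w x 0 k / s) - Num.floor (X w (corner r i) 0 k / s - 1).
have z03 k : 0 <= z k < 3.
  apply: floor_window; have := xk k; rewrite ltr_norml => /andP[x1 x2].
  have e1 : (X w x 0 k - X w (corner r i) 0 k) / s < 1 by rewrite ltr_pdivrMr// mul1r.
  have e2 : -1 < (X w x 0 k - X w (corner r i) 0 k) / s by rewrite ltr_pdivlMr// mulN1r.
  by move: e1 e2; rewrite mulrBl; lra.
exists [ffun k => inord `|z k|%N]; apply/mesh_cubeP => //; apply/rowP => k.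
rewrite !mxE ffunE; have /andP[k0 k3] := z03 k.
rewrite inordK; last by rewrite -ltz_nat gez0_abs.
by rewrite gez0_abs// /z addrC subrK.
Qed.

Lemma upper_comparison (b : R) : 0 < b < alpha -> {ae P, forall w,
  forall nu : probability (borel_rV R D) R, (nu : set _ -> \bar R) = image_measure mu (X w) ->
  exists2 C : R, 0 < C & \forall m \near \oo,
    mesh_momentR mu q (2^-1 ^+ m) <= C * mesh_momentR nu q ((2^-1 `^ b) ^+ m)}.
Proof.
move=> /andP[b0 ba]; have /andP[a0 a1] := a01.
pose r (m : nat) : R := 2^-1 ^+ m; pose s (m : nat) : R := (2^-1 `^ b) ^+ m.
have r0 m : 0 < r m by rewrite exprn_gt0// invr_gt0.
have s0 m : 0 < s m by rewrite exprn_gt0// powR_gt0// invr_gt0.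
(* With this factor [g m w <= 1] says that the excess term is at most half of the moment of [mu],
   and it can be moved to the left-hand side. *)
pose A : R := (2 * 2 `^ q).
have A0 : 0 < A by rewrite mulr_gt0// powR_gt0.
pose g m w := ((A / mesh_momentR mu q (r m))%:E * excess (r m) (s m) w)%E.
have Mm0 m : 0 < mesh_momentR mu q (r m) by exact: mesh_momentR_gt0.
have c0 m : 0 <= A / mesh_momentR mu q (r m) by rewrite divr_ge0// ltW.
have ex0 r' s' w : (0 <= excess r' s' w)%E.
  by apply: esum_ge0 => i _; rewrite mule_ge0 ?bad_ge0// lee_fin powR_ge0.
(* The Chebyshev factor is a constant times [(r m)^(2 alpha) / (s m)^2] with [s m = (r m)^b];
   [b < alpha] makes it decay geometrically with this ratio. *)
pose e : R := 2^-1 `^ (2 * (alpha - b)).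
have e01 : 0 <= e < 1.
  rewrite powR_ge0/= (@lt_le_trans _ _ (1 `^ (2 * (alpha - b))))//; last by rewrite powR1.
  by rewrite gt0_ltr_powR ?nnegrE ?mulr_gt0 ?subr_gt0// invf_lt1//; lra.
have gC m : (\int[P]_w g m w <= (A * (D%:R * Num.sqrt N%:R `^ (2 * alpha)) * e ^+ m)%:E)%E.
  rewrite ge0_integralZl_EFin//.
  apply: (@le_trans _ _ ((A / mesh_momentR mu q (r m))%:E *
     ((cst_delta (r m) (s m))%:E * mesh_moment mu q (r m)))%E).
    by rewrite lee_wpmul2l ?lee_fin//; exact: integral_excess.
  rewrite mesh_momentE// -!EFinM lee_fin /cst_delta powRM ?sqrtr_ge0 ?(ltW (r0 m))//.
  have -> : r m `^ (2 * alpha) = e ^+ m * s m ^+ 2.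
    rewrite /r powR_exprC ?invr_ge0// /s -exprM mulnC exprM -exprMn; congr (_ ^+ _).
    rewrite /e -powR_mulrn ?powR_ge0// -powRrM -powRD; last by rewrite invr_eq0 (pnatr_eq0 R 2) implybT.
    by congr (_ `^ _); ring.
  rewrite le_eqVlt; apply/orP; left; apply/eqP.
  move: (Num.sqrt _ `^ _) (e ^+ m) => u v.
  by field; rewrite !gt_eqF.
have H : {ae P, forall w, \forall m \near \oo, (g m w <= 1)%E}.
  apply: (ae_eventually_le1 _ _ _ e01 gC).
  - by move=> m; apply: emeasurable_funM => //; exact: mexcess.
  - by move=> m w; rewrite mule_ge0// lee_fin.
  - by rewrite !mulr_ge0 ?(ltW A0)// powR_ge0.
apply: filterS H => w Hw nu nuE.
pose K : R := #|{ffun 'I_D -> 'I_3}|%:R `^ q * #|{ffun 'I_D -> 'I_3}|%:R.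
have K0 : 0 < K.
  have E0 : 0 < #|{ffun 'I_D -> 'I_3}|%:R :> R by rewrite card_ffun !card_ord natrX exprn_gt0.
  by rewrite mulr_gt0// powR_gt0.
exists (A * K); first by rewrite mulr_gt0.
apply: filterS Hw => m gm.
have := mesh_moment_excess (r0 m) (s0 m) nuE; rewrite -/K !mesh_momentE//.
move: gm (ex0 (r m) (s m) w); rewrite /g.
case: (excess (r m) (s m) w) => [u| |]//; last first.
  by rewrite gt0_muley ?lte_fin ?divr_gt0// leye_eq.
rewrite -EFinM !lee_fin => gu u0.
have : A * u <= mesh_momentR mu q (r m).
  by move: gu; rewrite mulrAC ler_pdivrMr// mul1r.
rewrite /A -/(r m) -/(s m).
move: (mesh_momentR mu q (r m)) (mesh_momentR nu q (s m)) (2 `^ q) => x y z.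
by lra.
Qed.

End upper_comparison.

Lemma measurable_mesh_index {R : realType} (n : nat) (r : R) (h : 'rV[int]_n -> R) : 0 < r ->
  measurable_fun [set: borel_rV R n] (fun y => h (mesh_index r y)).
Proof.
move=> r0 _ Y mY; rewrite setTI.
rewrite (_ : _ @^-1` _ = \bigcup_(i : 'rV[int]_n)
    (if `[< Y (h i) >] then mesh_cube r i else set0)); last first.
  apply/seteqP; split => [y /= Yy|y [i _]].
    exists (mesh_index r y) => //; case: asboolP => // _; exact: mesh_cube_index.
  by case: asboolP => // Yi /(mesh_cubeP _ _ r0) yi; rewrite /= yi.
apply: countable_bigcupT_measurable; first exact: countableP.
by move=> i; case: asboolP => // _; exact: measurable_mesh_cube.
Qed.

(** * Lower bound *)

Section weight.
Context {R : realType} (N : nat) (mu : probability (borel_rV R N) R) (q : R) (q1 : 1 < q).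
Context (a : R) (m : nat).

Let rho k : R := 2^-1 ^+ k.
Let rho0 k : 0 < rho k. Proof. by rewrite exprn_gt0// invr_gt0. Qed.
Let pq0 : 0 < q - 1. Proof. by rewrite subr_gt0. Qed.
Let q0 : 0 < q. Proof. exact: lt_trans q1. Qed.

Let v k (i : 'rV[int]_N) : R := fine (mu (mesh_cube (rho k) i)).

Let v0 k i : 0 <= v k i. Proof. exact: fine_ge0. Qed.

Let vE k i : mu (mesh_cube (rho k) i) = (v k i)%:E.
Proof. by rewrite fineK// fin_num_measure//; exact: measurable_mesh_cube. Qed.

Let v1 k i : v k i <= 1.
Proof. by rewrite -lee_fin -vE; apply: probability_le1; exact: measurable_mesh_cube. Qed.

(* [psi] is large where [mu] charges some dyadic cube more than [rho ^ a]. *)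
Definition psi (y : 'rV[R]_N) : R :=
  1 + \sum_(k < m) (rho k `^ (- a) * v k (mesh_index (rho k) y)) `^ (q - 1).

Definition theta (y : 'rV[R]_N) : R := psi y `^ (- (q - 1)^-1).

Lemma psi_ge1 y : 1 <= psi y.
Proof. by rewrite lerDl; apply: sumr_ge0 => k _; exact: powR_ge0. Qed.

Let psi_gt0 y : 0 < psi y. Proof. exact: lt_le_trans (psi_ge1 y). Qed.

Lemma theta_gt0 y : 0 < theta y. Proof. exact: powR_gt0. Qed.

Lemma theta_le1 y : theta y <= 1.
Proof.
rewrite /theta powRN invf_le1 ?powR_gt0//.
apply: (@le_trans _ _ (1 `^ (q - 1)^-1)); first by rewrite powR1.
by rewrite ge0_ler_powR ?nnegrE ?invr_ge0 ?(ltW pq0) ?(ltW (psi_gt0 y))// psi_ge1.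
Qed.

Lemma measurable_psi : measurable_fun [set: borel_rV R N] psi.
Proof.
apply: measurable_funD => //; apply: measurable_sum => k.
exact: (measurable_mesh_index (fun i => (rho k `^ (- a) * v k i) `^ (q - 1)) (rho0 k)).
Qed.

Lemma measurable_theta : measurable_fun [set: borel_rV R N] theta.
Proof. exact: (measurableT_comp (measurable_powR _) measurable_psi). Qed.

Lemma psi_le : exists B : R, forall y, psi y <= B.
Proof.
exists (1 + \sum_(k < m) (rho k `^ (- a)) `^ (q - 1)) => y.
rewrite lerD2l ler_sum// => k _.
rewrite ge0_ler_powR ?nnegrE ?mulr_ge0 ?powR_ge0 ?(ltW pq0)//.
by rewrite ler_piMr ?powR_ge0.
Qed.

(** A pointwise substitute for Hoelder's inequality: [psi] is [theta] to the power [- (q - 1)], so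
    for each threshold [l] one of the two terms is at least 1. The threshold is chosen after
    integration over a cell. *)
Lemma psi_theta (l : R) y : 0 < l -> 1 <= theta y / l + l `^ (q - 1) * psi y.
Proof.
move=> l0; have [lt|tl] := lerP l (theta y).
  rewrite -[leLHS]addr0 lerD ?mulr_ge0 ?powR_ge0 ?(ltW (psi_gt0 y))//.
  by rewrite ler_pdivlMr// mul1r.
rewrite -[leLHS]add0r lerD ?divr_ge0 ?(ltW (theta_gt0 y)) ?(ltW l0)//.
have -> : psi y = theta y `^ (- (q - 1)).
  by rewrite /theta -powRrM mulrNN mulVf ?gt_eqF// powRr1// ltW.
rewrite powRN ler_pdivlMr ?powR_gt0 ?theta_gt0// mul1r.
by rewrite ge0_ler_powR ?nnegrE ?(ltW pq0) ?(ltW (theta_gt0 y)) ?(ltW l0) ?(ltW tl).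
Qed.

(** On a cube of side [rho k] the [k]-th term is constant, a multiple of the power [q - 1] of the
    mass; integrating it restores the power [q]. *)
Lemma integral_psi : (\int[mu]_y (psi y)%:E <=
  (1 + \sum_(k < m) rho k `^ (- a * (q - 1)) * mesh_momentR mu q (rho k))%:E)%E.
Proof.
pose f k y : R := (rho k `^ (- a) * v k (mesh_index (rho k) y)) `^ (q - 1).
have mf k : measurable_fun [set: borel_rV R N] (f k).
  exact: (measurable_mesh_index (fun i => (rho k `^ (- a) * v k i) `^ (q - 1)) (rho0 k)).
have f0 k y : 0 <= f k y by exact: powR_ge0.
under eq_integral do rewrite EFinD.
rewrite ge0_integralD//; last 2 first.
- by move=> y _; rewrite lee_fin; apply: sumr_ge0 => k _; exact: f0.
- by apply/measurable_EFinP; apply: measurable_sum => k; exact: mf.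
rewrite integral_cst//= mul1e probability_setT EFinD leeD2l//.
under eq_integral do rewrite -sumEFin.
rewrite ge0_integral_sum//; last 2 first.
- by move=> k; apply/measurable_EFinP; exact: mf.
- by move=> k y _; rewrite lee_fin; exact: f0.
rewrite -sumEFin; apply: lee_sum => k _.
have h := @le_esum_integral _ (borel_rV R N) R mu _ (mesh_cube (rho k))
  (fun i => @measurable_mesh_cube R N (rho k) i) (fun y => (f k y)%:E).
apply: (le_trans (h _ _ _)).
- by apply/measurable_EFinP; exact: mf.
- by move=> y; rewrite lee_fin.
- by move=> y; exists (mesh_index (rho k) y); exact: mesh_cube_index.
rewrite EFinM -mesh_momentE// /mesh_moment -esumZl ?powR_ge0//; last by move=> i; exact: poweR_ge0.
apply: le_esum => i _.
rewrite (eq_integral (fun=> ((rho k `^ (- a) * v k i) `^ (q - 1))%:E)); last first.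
  by move=> y; rewrite inE => /(mesh_cubeP _ _ (rho0 k)) yi; rewrite /f yi.
rewrite integral_cst; last exact: measurable_mesh_cube.
do 2 (rewrite (_ : _ (mesh_cube (rho k) i) = (v k i)%:E); last exact: vE).
rewrite poweR_EFin -!EFinM lee_fin powRM ?powR_ge0// -powRrM -mulrA.
have qn0 : q != 0 by rewrite gt_eqF.
by rewrite -(powR_pred (v0 k i) qn0).
Qed.

(** The [k]-th term of [psi], present since [k < m], alone forces [theta] below [rho k] to the power
    [a] divided by the mass of the cube. *)
Lemma integral_theta_cube k i : (k < m)%N ->
  (\int[mu]_(y in mesh_cube (rho k) i) (theta y)%:E <= (rho k `^ a)%:E)%E.
Proof.
move=> km; have [vi|vi] := eqVneq (v k i) 0.
  apply: (@le_trans _ _ (\int[mu]_(y in mesh_cube (rho k) i) (cst 1%E) y)%E).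
    apply: ge0_le_integral => //.
    - exact: measurable_mesh_cube.
    - by move=> y _; rewrite lee_fin ltW// theta_gt0.
    - by apply/measurable_EFinP; apply: measurable_funS measurable_theta.
    - by move=> y _; rewrite lee_fin theta_le1.
  rewrite integral_cst; last exact: measurable_mesh_cube.
  rewrite mul1e (_ : _ (mesh_cube (rho k) i) = 0%:E) ?lee_fin ?powR_ge0//.
  by rewrite -vi; exact: vE.
have vi0 : 0 < v k i by rewrite lt_neqAle eq_sym vi v0.
apply: (@le_trans _ _ (\int[mu]_(y in mesh_cube (rho k) i) (rho k `^ a / v k i)%:E)%E).
  apply: ge0_le_integral.
  - exact: measurable_mesh_cube.
  - by move=> y _; rewrite lee_fin ltW// theta_gt0.
  - by apply/measurable_EFinP; apply: measurable_funS measurable_theta.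
  - exact: measurable_cst.
  move=> y /(mesh_cubeP _ _ (rho0 k)) yi; rewrite lee_fin /theta powRN.
  rewrite -[leRHS]invrK lef_pV2 ?posrE ?powR_gt0 ?invr_gt0 ?divr_gt0 ?powR_gt0//.
  rewrite invf_div; apply: (@le_trans _ _ (((v k i / rho k `^ a) `^ (q - 1)) `^ (q - 1)^-1)).
    by rewrite -powRrM divff ?gt_eqF// powRr1// divr_ge0 ?powR_ge0// ltW.
  rewrite ge0_ler_powR ?nnegrE ?invr_ge0 ?powR_ge0 ?(ltW pq0) ?(ltW (psi_gt0 y))//.
  rewrite /psi (bigD1 (Ordinal km))//= yi powRN mulrC addrCA lerDl addr_ge0//.
  by apply: sumr_ge0 => j _; exact: powR_ge0.
rewrite integral_cst; last exact: measurable_mesh_cube.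
rewrite (_ : _ (mesh_cube (rho k) i) = (v k i)%:E); last exact: vE.
by rewrite -EFinM lee_fin divfK.
Qed.

End weight.

Lemma decay_le1 {R : realType} (N : nat) (alpha t r : R) (z : 'rV[R]_N) : 0 < t ->
  decay alpha t r z <= 1.
Proof.
move=> t0; rewrite /decay powRN invf_le1 ?powR_gt0 ?ltr_pwDl ?divr_ge0 ?powR_ge0 ?sqr_ge0//.
apply: (@le_trans _ _ (1 `^ (t / 2))); first by rewrite powR1.
rewrite ge0_ler_powR ?nnegrE ?divr_ge0 ?(ltW t0)//.
  by rewrite addr_ge0// divr_ge0 ?sqr_ge0// powR_ge0.
by rewrite lerDl divr_ge0 ?sqr_ge0// powR_ge0.
Qed.

Lemma decay_le_power {R : realType} (N : nat) (alpha t r : R) (z : 'rV[R]_N) : 0 < t -> 0 < r ->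
  0 < euclidean_norm z -> decay alpha t r z <= r `^ t * euclidean_norm z `^ (- (alpha * t)).
Proof.
move=> t0 r0 z0; set u := euclidean_norm z in z0 *.
have w0 : 0 < u `^ (2 * alpha) / r ^+ 2 by rewrite divr_gt0 ?exprn_gt0// powR_gt0.
apply: (@le_trans _ _ ((u `^ (2 * alpha) / r ^+ 2) `^ (- (t / 2)))).
  rewrite /decay !powRN lef_pV2 ?posrE ?powR_gt0 ?addr_gt0//.
  rewrite -/u; move: (_ / _) w0 => w w0.
  by rewrite ge0_ler_powR ?nnegrE ?divr_ge0 ?(ltW t0) ?(ltW w0) ?addr_ge0 ?(ltW w0)// lerDr.
rewrite powRM ?powR_ge0 ?invr_ge0 ?sqr_ge0// mulrC le_eqVlt; apply/orP; left; apply/eqP.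
rewrite -powRrM -powR_mulrn ?(ltW r0)// -powRN -powRrM.
by congr (_ `^ _ * _ `^ _); field.
Qed.

(** The power of the distance is discretized over dyadic shells: on the shell from [2^-1 ^+ k.+1] to
    [2^-1 ^+ k] it is bounded by its value at the inner radius, hence the shift [k.+1]. The summand
    1 is for distances above 1. *)
Lemma decay_le_dyadic {R : realType} (N : nat) (alpha t : R) (m : nat) (z : 'rV[R]_N) :
  0 < alpha -> 0 < t ->
  decay alpha t ((2^-1 ^+ m) `^ alpha) z <= (2^-1 ^+ m) `^ (alpha * t) *
    (1 + \sum_(k < m) (2^-1 ^+ k.+1) `^ (- (alpha * t)) * (euclidean_norm z <= 2^-1 ^+ k)%R%:R).
Proof.
move=> a0 t0; pose rho k : R := 2^-1 ^+ k.
have rho0 k : 0 < rho k by rewrite exprn_gt0// invr_gt0.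
set u := euclidean_norm z; have at0 : 0 < alpha * t by rewrite mulr_gt0.
have s0 n : 0 <= \sum_(k < n) rho k.+1 `^ (- (alpha * t)) * (u <= rho k)%R%:R.
  by apply: sumr_ge0 => k _; rewrite mulr_ge0 ?powR_ge0.
have mono (x y : R) : 0 < x -> x <= y -> y `^ (- (alpha * t)) <= x `^ (- (alpha * t)).
  move=> x0 xy; have y0 := lt_le_trans x0 xy.
  by rewrite !powRN lef_pV2 ?posrE ?powR_gt0// ge0_ler_powR ?nnegrE// ltW.
have claim n : rho n < u -> u `^ (- (alpha * t)) <=
    1 + \sum_(k < n) rho k.+1 `^ (- (alpha * t)) * (u <= rho k)%R%:R.
  elim: n => [|n IH] nu.
    by rewrite big_ord0 addr0 (le_trans (mono _ _ _ (ltW nu)))// /rho expr0 powR1.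
  rewrite big_ord_recr/=; have [un|un] := leP u (rho n).
    rewrite mulr1 (le_trans (mono _ _ (rho0 n.+1) (ltW nu)))//.
    by rewrite addrA lerDr; apply: addr_ge0 => //; exact: s0.
  by rewrite mulr0 addr0 IH.
have [um|mu] := leP u (rho m); last first.
  have u0 : 0 < u by exact: lt_trans (rho0 m) mu.
  rewrite (le_trans (decay_le_power alpha t0 _ u0)) ?powR_gt0//.
  by rewrite -powRrM ler_wpM2l ?powR_ge0// claim.
rewrite (le_trans (decay_le1 _ _ _ t0))//.
(* Within [rho m] the decay is bounded by 1. The last shell, or the summand 1 if [m = 0],
   compensates the prefactor. *)
case: m um => [um|n un]; first by rewrite expr0 powR1 big_ord0 addr0 mul1r.
rewrite big_ord_recr/= addrA mulrDr.
have -> : (u <= rho n)%R by rewrite (le_trans un)// /rho exprS ler_piMl ?(ltW (rho0 n))// invf_le1//; lra.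
rewrite mulr1 powRN mulfV ?lerDr; last by rewrite gt_eqF// powR_gt0//; exact: rho0.
by apply: mulr_ge0; [exact: powR_ge0|apply: addr_ge0 => //; exact: s0].
Qed.

Section energy.
Context {R : realType} (N : nat) (mu : probability (borel_rV R N) R) (q : R) (q1 : 1 < q).
Context (alpha t t' : R) (a0 : 0 < alpha) (t0 : 0 < t) (tt' : t < t').

Let rho k : R := 2^-1 ^+ k.
Let rho0 k : 0 < rho k. Proof. by rewrite exprn_gt0// invr_gt0. Qed.

Let coord_le (z : 'rV[R]_N) j : `|z 0 j| <= euclidean_norm z.
Proof.
rewrite -sqrtr_sqr ler_wsqrtr// (bigD1 j)//= lerDl.
by apply: sumr_ge0 => i _; exact: sqr_ge0.
Qed.

Let measurable_dist x : measurable_fun [set: borel_rV R N]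
  (fun y : 'rV[R]_N => euclidean_norm (y - x)).
Proof.
apply: (measurableT_comp (continuous_measurable_fun (@sqrt_continuous R))).
apply: measurable_sum => j; apply: measurable_funX.
rewrite (_ : (fun y : 'rV[R]_N => _) = (fun y : 'rV[R]_N => y 0 j - x 0 j)).
  by apply: measurable_funB => //; exact: measurable_rV_coord.
by apply/funext => y; rewrite !mxE.
Qed.

Let measurable_ball x s : measurable_fun [set: borel_rV R N]
  (fun y : 'rV[R]_N => (euclidean_norm (y - x) <= s)%R%:R : R).
Proof.
pose A : set (borel_rV R N) := (fun y : 'rV[R]_N => euclidean_norm (y - x)) @^-1` `]-oo, s].
rewrite (_ : (fun y => _) = \1_A).
  apply: measurable_indic; rewrite -[X in measurable X]setTI.
  by apply: measurable_dist.
apply/funext => y; rewrite indicE; congr (nat_of_bool _)%:R.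
by apply/idP/idP; rewrite inE /A/= in_itv.
Qed.

Let integral_ball m x k : (k < m)%N ->
  (\int[mu]_y ((euclidean_norm (y - x) <= rho k)%R%:R * theta mu q (alpha * t') m y)%:E <=
   (#|{ffun 'I_N -> 'I_3}|%:R * rho k `^ (alpha * t'))%:E)%E.
Proof.
move=> km; set th := theta mu q (alpha * t') m.
have mth : measurable_fun [set: borel_rV R N] (fun y => (th y)%:E : \bar R).
  by apply/measurable_EFinP; exact: measurable_theta.
have th0 y : 0 <= th y by rewrite ltW// theta_gt0.
pose f (e : {ffun 'I_N -> 'I_3}) : 'rV[int]_N :=
  \row_j (Num.floor (x 0 j / rho k - 1) + (e j)%:Z).
have mC e := @measurable_mesh_cube R N (rho k) (f e).
apply: (@le_trans _ _ (\int[mu]_y (\sum_e ((\1_(mesh_cube (rho k) (f e)) y)%:E * (th y)%:E)))%E).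
  apply: ge0_le_integral => //.
  - by move=> y _; rewrite lee_fin mulr_ge0.
  - apply/measurable_EFinP; apply: measurable_funM; first exact: measurable_ball.
    exact: measurable_theta.
  - apply: emeasurable_sum => e; apply: emeasurable_funM => //.
    by apply/measurable_EFinP; exact: measurable_indic.
  move=> y _; under eq_bigr do rewrite -EFinM; rewrite sumEFin lee_fin.
  have [xy|_] := leP (euclidean_norm (y - x)) (rho k); last first.
    by rewrite mul0r sumr_ge0// => e _; rewrite mulr_ge0.
  rewrite mul1r.
  pose z j := Num.floor (y 0 j / rho k) - Num.floor (x 0 j / rho k - 1).
  have z03 j : 0 <= z j < 3.
    apply: floor_window; have := le_trans (coord_le (y - x) j) xy.
    rewrite !mxE ler_norml => /andP[y1 y2].
    have e1 : (y 0 j - x 0 j) / rho k <= 1 by rewrite ler_pdivrMr// mul1r.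
    have e2 : -1 <= (y 0 j - x 0 j) / rho k by rewrite ler_pdivlMr// mulN1r.
    by move: e1 e2; rewrite mulrBl; lra.
  pose e := [ffun j => inord `|z j|%N : 'I_3].
  rewrite (bigD1 e)//= indicE mem_set ?mul1r ?lerDl ?sumr_ge0//.
    by move=> e' _; rewrite mulr_ge0.
  apply/mesh_cubeP => //; apply/rowP => j.
  rewrite !mxE ffunE; have /andP[k0 k3] := z03 j.
  rewrite inordK; last by rewrite -ltz_nat gez0_abs.
  by rewrite gez0_abs// /z addrC subrK.
rewrite ge0_integral_sum//; last 2 first.
- move=> e; apply: emeasurable_funM => //.
  by apply/measurable_EFinP; exact: measurable_indic.
- by move=> e y _; rewrite mule_ge0// lee_fin.
apply: (@le_trans _ _ (\sum_(e : {ffun 'I_N -> 'I_3}) (rho k `^ (alpha * t'))%:E)%E).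
  apply: lee_sum => e _.
  under eq_integral do rewrite muleC.
  have -> : (\int[mu]_y ((th y)%:E * (\1_(mesh_cube (rho k) (f e)) y)%:E) =
      \int[mu]_(y in mesh_cube (rho k) (f e)) (th y)%:E)%E.
    by rewrite [RHS]integral_mkcond epatch_indic.
  exact: integral_theta_cube.
by rewrite sumEFin sumr_const lee_fin mulr_natl.
Qed.

Lemma measurable_decay r x : measurable_fun [set: borel_rV R N]
  (fun y : 'rV[R]_N => decay alpha t r (y - x)).
Proof.
apply: (measurableT_comp (measurable_powR _)); apply: measurable_funD => //.
apply: measurable_funM => //; apply: (measurableT_comp (measurable_powR _)).
exact: measurable_dist.
Qed.

(** Under the weight a ball of radius [rho k] has mass of order [rho k] to the power [alpha * t'],
    so the shells contribute a geometric series thanks to [t < t']. The power of 2 in the constant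
    accounts for the shift from [k.+1] to [k]. *)
Lemma energy_le : exists2 C : R, 0 <= C & forall m x,
  (\int[mu]_y (decay alpha t ((2^-1 ^+ m) `^ alpha) (y - x) * theta mu q (alpha * t') m y)%:E <=
   (C * (2^-1 ^+ m) `^ (alpha * t))%:E)%E.
Proof.
pose E : R := #|{ffun 'I_N -> 'I_3}|%:R.
pose e : R := 2^-1 `^ (alpha * (t' - t)).
have e0 : 0 <= e by exact: powR_ge0.
have e1 : e < 1.
  rewrite (@lt_le_trans _ _ (1 `^ (alpha * (t' - t))))//; last by rewrite powR1.
  by rewrite gt0_ltr_powR ?nnegrE ?mulr_gt0 ?subr_gt0// invf_lt1//; lra.
pose w k : R := rho k.+1 `^ (- (alpha * t)).
have w0 k : 0 <= w k by exact: powR_ge0.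
exists (1 + 2 `^ (alpha * t) * E / (1 - e)).
  by rewrite addr_ge0// divr_ge0 ?subr_ge0 ?(ltW e1)// mulr_ge0// powR_ge0.
move=> m x; set th := theta mu q (alpha * t') m.
have mth : measurable_fun [set: borel_rV R N] (fun y => (th y)%:E : \bar R).
  by apply/measurable_EFinP; exact: measurable_theta.
have th0 y : 0 <= th y by rewrite ltW// theta_gt0.
pose B k (y : 'rV[R]_N) : R := (euclidean_norm (y - x) <= rho k)%R%:R * th y.
have B0 k y : 0 <= B k y by rewrite mulr_ge0.
have mB k : measurable_fun [set: borel_rV R N] (fun y => (B k y)%:E : \bar R).
  apply/measurable_EFinP; apply: measurable_funM; first exact: measurable_ball.
  exact: measurable_theta.
apply: (@le_trans _ _ (\int[mu]_y ((rho m `^ (alpha * t))%:E *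
    ((th y)%:E + \sum_(k < m) ((w k)%:E * (B k y)%:E))))%E).
  apply: ge0_le_integral => //.
  - by move=> y _; rewrite lee_fin mulr_ge0// decay_ge0.
  - apply/measurable_EFinP; apply: measurable_funM; last exact: measurable_theta.
    exact: measurable_decay.
  - apply: emeasurable_funM => //; apply: emeasurable_funD => //.
    by apply: emeasurable_sum => k; apply: emeasurable_funM.
  move=> y _; under eq_bigr do rewrite -EFinM; rewrite sumEFin -EFinD -EFinM lee_fin.
  rewrite (le_trans (ler_wpM2r (th0 y) (decay_le_dyadic m _ a0 t0)))//.
  rewrite -mulrA ler_wpM2l ?powR_ge0// mulrDl mul1r lerD2l mulr_suml ler_sum// => k _.
  by rewrite -mulrA.
rewrite ge0_integralZl_EFin ?powR_ge0//; last 2 first.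
- by move=> y _; rewrite adde_ge0 ?lee_fin// sume_ge0// => k _; rewrite mule_ge0// lee_fin.
- apply: emeasurable_funD => //.
  by apply: emeasurable_sum => k; apply: emeasurable_funM.
rewrite ge0_integralD//; last 3 first.
- by move=> y _; rewrite lee_fin.
- by move=> y _; rewrite sume_ge0// => k _; rewrite mule_ge0// lee_fin.
- by apply: emeasurable_sum => k; apply: emeasurable_funM.
rewrite ge0_integral_sum//; last 2 first.
- by move=> k; apply: emeasurable_funM.
- by move=> k y _; rewrite mule_ge0// lee_fin.
rewrite [X in (_ <= X%:E)%E]mulrC EFinM lee_wpmul2l ?lee_fin ?powR_ge0// EFinD leeD//.
  apply: (@le_trans _ _ (\int[mu]_y (cst 1%E) y)%E).
    apply: ge0_le_integral => //.
    - by move=> y _; rewrite lee_fin.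
    - by move=> y _; rewrite lee_fin theta_le1.
  by rewrite integral_cst//= mul1e probability_setT.
apply: (@le_trans _ _ (\sum_(k < m) (2 `^ (alpha * t) * E * e ^+ k)%:E)%E).
  apply: lee_sum => k _; rewrite ge0_integralZl_EFin//; last by move=> y _; rewrite lee_fin.
  apply: (@le_trans _ _ ((w k)%:E * (E * rho k `^ (alpha * t'))%:E)%E).
    by rewrite lee_wpmul2l ?lee_fin//; exact: integral_ball.
  rewrite -EFinM lee_fin le_eqVlt; apply/orP; left; apply/eqP.
  rewrite mulrCA [RHS]mulrAC [RHS]mulrC; congr (_ * _).
  rewrite /w /rho exprS powRM ?invr_ge0 ?exprn_ge0 ?invr_ge0// -mulrA.
  rewrite -powRD; last by have := rho0 k; rewrite /rho => /gt_eqF ->; rewrite implybT.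
  rewrite powR_exprC ?invr_ge0// /e -(powR_inv1 (ler0n R 2)) -!powRrM.
  by congr (_ `^ _ * _ `^ _ ^+ _); ring.
rewrite sumEFin lee_fin -mulr_sumr ler_wpM2l ?mulr_ge0 ?powR_ge0//.
have := subrX1 e m; have : 0 <= e ^+ m by rewrite exprn_ge0.
move=> em eE; rewrite -[leRHS]mul1r ler_pdivlMr ?subr_gt0//; nra.
Qed.

End energy.

Section lower_moment.
Context d {T : measurableType d} {R : realType} (P : probability T R) (N D : nat) (N0 : (0 < N)%N).
Context (alpha : R) (a01 : 0 < alpha < 1) (X : T -> 'rV[R]_N -> 'rV[R]_D) (fX : fbm P alpha X).
Context (mu : probability (borel_rV R N) R) (q : R) (q1 : 1 < q).
Context (t t' : R) (t0D : 0 < t <= D%:R) (tt' : t < t').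

Let a0 : 0 < alpha. Proof. by case/andP: a01. Qed.
Let t0 : 0 < t. Proof. by case/andP: t0D. Qed.

Let mX x i : measurable_fun [set: T] (fun w => X w x 0 i).
Proof. exact: fbm_measurable fX x i. Qed.

Let cX w i : continuous (fun x => X w x 0 i).
Proof.
have [_ _ c] := fX; move=> x.
by apply: (@cvg_comp _ _ _ (X w) (fun y : 'rV[R]_D => y 0 i)); [exact: c|exact: coord_continuous].
Qed.

Let mXj i : measurable_fun [set: T * borel_rV R N] (fun wx => X wx.1 wx.2 0 i).
Proof. exact: (@measurable_joint _ T R N (fun w x => X w x 0 i)). Qed.

Let rho m : R := 2^-1 ^+ m.
Let rad m : R := rho m `^ alpha.
Let rho0 k : 0 < rho k. Proof. by rewrite exprn_gt0// invr_gt0. Qed.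
Let rad0 k : 0 < rad k. Proof. exact: powR_gt0. Qed.
Let th m := theta mu q (alpha * t') m.
Let th0 m y : 0 <= th m y. Proof. by rewrite ltW// theta_gt0. Qed.
Let mth m : measurable_fun [set: borel_rV R N] (th m).
Proof. exact: measurable_theta. Qed.

Let near m : set (T * borel_rV R N * borel_rV R N) :=
  [set u | forall i, `|X u.1.1 u.2 0 i - X u.1.1 u.1.2 0 i| <= rad m].

Let mnear m : measurable (near m).
Proof.
rewrite (_ : near m = \bigcap_(i in [set: 'I_D])
  ((fun u => `|X u.1.1 u.2 0 i - X u.1.1 u.1.2 0 i|) @^-1` `]-oo, rad m])); last first.
  apply/seteqP; split => u /= h i; first by move=> _; rewrite /= in_itv/=; exact: h.
  by have := h i Logic.I; rewrite /= in_itv.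
apply: fin_bigcap_measurable => //= i _; rewrite -[X in measurable X]setTI.
apply: (_ : measurable_fun setT _) => //.
apply: measurableT_comp => //; apply: measurable_funB.
  apply: (measurableT_comp (mXj i) (_ : measurable_fun setT (fun u : T * borel_rV R N * borel_rV R N => (u.1.1, u.2)))).
  by apply: measurable_fun_pair => //; exact: measurableT_comp measurable_fst measurable_fst.
exact: (measurableT_comp (mXj i) measurable_fst).
Qed.

Let kern m (u : T * borel_rV R N * borel_rV R N) : R := \1_(near m) u * th m u.2.

Let kern0 m u : 0 <= kern m u. Proof. by rewrite mulr_ge0. Qed.

Let mkern m : measurable_fun setT (kern m).
Proof.
apply: measurable_funM; first exact: measurable_indic.
exact: (measurableT_comp (mth m) measurable_snd).
Qed.

Let massE m (wx : T * borel_rV R N) : \bar R := (\int[mu]_y (kern m (wx, y))%:E)%E.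
Let mass m wx : R := fine (massE m wx).

Let mkern_wx m wx : measurable_fun [set: borel_rV R N] (fun y => kern m (wx, y)).
Proof. exact: (measurableT_comp (mkern m) (measurable_pair1 wx)). Qed.

Let massE_le1 m wx : (0 <= massE m wx <= 1)%E.
Proof.
rewrite integral_ge0/=; last by move=> y _; rewrite lee_fin.
apply: (@le_trans _ _ (\int[mu]_y (cst 1%E) y)%E).
  apply: ge0_le_integral => //.
  - by move=> y _; rewrite lee_fin.
  - by apply/measurable_EFinP; exact: mkern_wx.
  - move=> y _; rewrite lee_fin mulr_ile1// ?theta_le1// indicE.
by rewrite integral_cst//= mul1e probability_setT.
Qed.

Let massEE m wx : massE m wx = (mass m wx)%:E.
Proof.
have /andP[m0 m1] := massE_le1 m wx.
by rewrite fineK// ge0_fin_numE// (le_lt_trans m1)// ltry.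
Qed.

Let mass0 m wx : 0 <= mass m wx.
Proof. by rewrite -lee_fin -massEE; case/andP: (massE_le1 m wx). Qed.

Let mmass m : measurable_fun setT (mass m).
Proof.
apply: (measurableT_comp (fine_measurable measurableT)).
have := @measurable_fun_fubini_tonelli_F _ _ (T * borel_rV R N)%type (borel_rV R N) R mu
  (fun u => (kern m u)%:E).
apply; last by move=> u; rewrite lee_fin.
by apply/measurable_EFinP; exact: mkern.
Qed.

Let mmass_w m x : measurable_fun [set: T] (fun w => mass m (w, x)).
Proof. exact: (measurableT_comp (mmass m) (measurable_pair2 x)). Qed.

Let mmass_x m w : measurable_fun [set: borel_rV R N] (fun x => mass m (w, x)).
Proof. exact: (measurableT_comp (mmass m) (measurable_pair1 w)). Qed.

Let cluster m n (p : nat -> 'rV[R]_N) : set T :=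
  [set w | forall l i, (l < n)%N -> `|X w (p l.+1) 0 i - X w (p 0%N) 0 i| <= rad m].

Let mcluster m n p : measurable (cluster m n p).
Proof.
rewrite (_ : cluster m n p = \bigcap_(i in [set: 'I_D])
    [set w | forall l, (l < n)%N -> `|X w (p l.+1) 0 i - X w (p 0%N) 0 i| <= rad m]).
  apply: fin_bigcap_measurable => //= i _.
  exact: (@measurable_increments _ T R _ (fun w x => X w x 0 i)).
by apply/seteqP; split => w /= h; [move=> i _ l ln; exact: h|move=> l i ln; exact: (h i)].
Qed.

(** Each power of the mass is an integral over one more point [y] whose image is close to that of
    [x]. The induction on the number [j] of remaining powers adds [y] to the cluster and then
    integrates it out by the energy bound, uniformly in the earlier points. *)
Let mass_moment (n : nat) : exists2 C : R, 0 <= C & forall m x,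
  (\int[P]_w (mass m (w, x) ^+ n)%:E <= (C * (rho m `^ (alpha * t)) ^+ n)%:E)%E.
Proof.
have [C0 C00 ball] := fbm_small_ball fX n N0 a01 t0D.
have [C3 C30 energy] := energy_le mu q1 a0 t0 tt'.
exists (C0 * (n%:R * C3) ^+ n).
  by rewrite mulr_ge0 ?(ltW C00)// exprn_ge0// mulr_ge0.
move=> m x; set s := rho m `^ (alpha * t); have s0 : 0 <= s by exact: powR_ge0.
pose prod_dec n (p : nat -> 'rV[R]_N) := \prod_(l < n) \sum_(k < l.+1) decay alpha t (rad m) (p l.+1 - p k).
have prod_dec0 n' p : 0 <= prod_dec n' p.
  by apply: prodr_ge0 => l _; apply: sumr_ge0 => k _; exact: decay_ge0.
(* A new point is compared with at most [n] earlier ones, each comparison costing an energy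
   [C3 * s]. *)
pose K := n%:R * (C3 * s).
have K0 : 0 <= K by rewrite !mulr_ge0.
have claim j : forall n' (p : nat -> 'rV[R]_N), (n' + j = n)%N ->
    (\int[P]_w (\1_(cluster m n' p) w * mass m (w, p 0%N) ^+ j)%:E <=
     (C0 * prod_dec n' p * K ^+ j)%:E)%E.
  elim: j => [|j IH] n' p nj.
    under eq_integral do rewrite expr0 mulr1.
    rewrite integral_indic// setIT expr0 mulr1.
    by move: nj; rewrite addn0 => ->; exact: ball.
  pose g (w : T) : R := \1_(cluster m n' p) w * mass m (w, p 0%N) ^+ j.
  have g0 w : 0 <= g w by rewrite mulr_ge0// exprn_ge0.
  have mg : measurable_fun setT g.
    apply: measurable_funM; first exact: measurable_indic.
    by apply: measurable_funX; exact: mmass_w.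
  pose F (wy : T * borel_rV R N) : \bar R := (g wy.1 * kern m (wy.1, p 0%N, wy.2))%:E.
  have mF : measurable_fun setT F.
    apply/measurable_EFinP; apply: measurable_funM; first exact: measurableT_comp mg measurable_fst.
    apply: (measurableT_comp (mkern m) (_ : measurable_fun setT (fun u : T * borel_rV R N => (u.1, p 0%N : borel_rV R N, u.2)))).
    by apply: measurable_fun_pair => //; exact: measurable_fun_pair.
  have F0 wy : (0 <= F wy)%E by rewrite lee_fin mulr_ge0.
  have -> : (\int[P]_w (\1_(cluster m n' p) w * mass m (w, p 0%N) ^+ j.+1)%:E =
      \int[P]_w \int[mu]_y F (w, y))%E.
    apply: eq_integral => w _; rewrite exprSr mulrA EFinM -massEE.
    rewrite /massE -ge0_integralZl_EFin//; last 3 first.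
    - by move=> y _; rewrite lee_fin.
    - by apply/measurable_EFinP; exact: mkern_wx.
    - exact: g0.
  rewrite (fubini_tonelli F)//.
  (* A cluster of index [n'] consists of the points [p 0] to [p n']; the new point takes the place
     [n'.+1]. *)
  pose p' (y : 'rV[R]_N) l := if (l <= n')%N then p l else y.
  have step y : (\int[P]_w F (w, y) <= (C0 * prod_dec n' p * K ^+ j)%:E *
      \sum_(k < n'.+1) (decay alpha t (rad m) (y - p k) * th m y)%:E)%E.
    have FE w : F (w, y) = ((th m y)%:E *
       (\1_(cluster m n'.+1 (p' y)) w * mass m (w, p' y 0%N) ^+ j)%:E)%E.
      rewrite /F /= /g /kern /= -EFinM; congr EFin.
      rewrite [X in _ = _ * (X * _)](_ : _ = \1_(cluster m n' p) w * \1_(near m) (w, p 0%N, y)).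
        by rewrite (_ : p' y 0%N = p 0%N)//; ring.
      rewrite !indicE -natrM mulnb; congr (nat_of_bool _)%:R.
      apply/idP/idP; rewrite !inE.
        move=> h; apply/andP; split; rewrite inE.
          move=> l i ln; have := h l i (ltnW ln); rewrite /p' /= ln; exact.
        by move=> i; have := h n' i (leqnn _); rewrite /p' /= ltnn.
      move=> /andP[]; rewrite !inE => h1 h2 l i; rewrite ltnS leq_eqVlt => /orP[/eqP ->|ln].
        by rewrite /p' /= ltnn; exact: h2.
      by rewrite /p' /= ln; exact: h1.
    under eq_integral do rewrite FE.
    rewrite ge0_integralZl_EFin//; last 2 first.
    - by move=> w _; rewrite lee_fin mulr_ge0// exprn_ge0.
    - apply/measurable_EFinP; apply: measurable_funM; first exact: measurable_indic.
      by apply: measurable_funX; exact: mmass_w.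
    apply: (le_trans (lee_wpmul2l _ (IH n'.+1 (p' y) _))); first by rewrite lee_fin.
      by rewrite addSnnS.
    rewrite sumEFin -!EFinM lee_fin -mulr_suml le_eqVlt; apply/orP; left; apply/eqP.
    have -> : prod_dec n'.+1 (p' y) = prod_dec n' p * \sum_(k < n'.+1) decay alpha t (rad m) (y - p k).
      have pd (dd : 'rV[R]_N -> 'rV[R]_N -> R) :
          \prod_(l < n'.+1) \sum_(k < l.+1) dd (p' y l.+1) (p' y k) =
          \prod_(l < n') (\sum_(k < l.+1) dd (p l.+1) (p k)) * \sum_(k < n'.+1) dd y (p k).
        rewrite big_ord_recr/=; congr (_ * _).
          apply: eq_bigr => l _; apply: eq_bigr => k _.
          by rewrite /p' ltn_ord (leq_trans _ (ltnW (ltn_ord l)))// -ltnS.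
        by apply: eq_bigr => k _; rewrite /p' ltnn -ltnS ltn_ord.
      exact: (pd (fun z z' => decay alpha t (rad m) (z - z'))).
    by move: (\sum_(_ < _) _) => S'; ring.
  apply: (@le_trans _ _ (\int[mu]_y ((C0 * prod_dec n' p * K ^+ j)%:E *
      \sum_(k < n'.+1) (decay alpha t (rad m) (y - p k) * th m y)%:E))%E).
    apply: ge0_le_integral => //.
    - by move=> y _; exact: integral_ge0.
    - have := @measurable_fun_fubini_tonelli_G _ _ T (borel_rV R N) R P F; exact.
    - apply: emeasurable_funM => //; apply: emeasurable_sum => k.
      apply/measurable_EFinP; apply: measurable_funM => //; exact: measurable_decay.
  have c0 : 0 <= C0 * prod_dec n' p * K ^+ j by rewrite !mulr_ge0 ?exprn_ge0// ltW.
  have mdec k : measurable_fun [set: borel_rV R N] (fun y => (decay alpha t (rad m) (y - p k) * th m y)%:E : \bar R).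
    by apply/measurable_EFinP; apply: measurable_funM => //; exact: measurable_decay.
  have dec0 k y : (0 <= (decay alpha t (rad m) (y - p k) * th m y)%:E)%E.
    by rewrite lee_fin mulr_ge0// decay_ge0.
  rewrite ge0_integralZl_EFin//; last 2 first.
  - by move=> y _; exact: sume_ge0.
  - by apply: emeasurable_sum => k.
  rewrite ge0_integral_sum//.
  rewrite (_ : (C0 * prod_dec n' p * K ^+ j.+1)%:E = ((C0 * prod_dec n' p * K ^+ j)%:E * K%:E)%E).
    rewrite lee_wpmul2l ?lee_fin//.
    apply: (@le_trans _ _ (\sum_(k < n'.+1) (C3 * s)%:E)%E).
      by apply: lee_sum => k _; exact: energy.
    rewrite sumEFin lee_fin sumr_const card_ord -[leLHS]mulr_natl ler_wpM2r ?mulr_ge0//.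
    by rewrite ler_nat -nj addnS ltnS leq_addr.
  by rewrite -EFinM exprSr mulrA.
have := claim n 0%N (fun=> x) (add0n n).
rewrite /prod_dec big_ord0 mulr1 (_ : K ^+ n = (n%:R * C3) ^+ n * s ^+ n); last first.
  by rewrite -exprMn /K mulrA.
rewrite mulrA; apply: le_trans; rewrite le_eqVlt; apply/orP; left; apply/eqP.
by apply: eq_integral => w _; rewrite indicE mem_set ?mul1r.
Qed.

Let ps m := psi mu q (alpha * t') m.
Let ps0 m y : 0 <= ps m y.
Proof. by rewrite (le_trans _ (psi_ge1 mu q _ m y)). Qed.
Let mps m : measurable_fun [set: borel_rV R N] (ps m).
Proof. exact: measurable_psi. Qed.

Let cell m w (j : 'rV[int]_D) : set (borel_rV R N) := X w @^-1` mesh_cube (rad m) j.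

Let mcell m w j : measurable (cell m w j).
Proof.
apply: (@measurable_preimage_mesh_cube R D _ (borel_rV R N)) => i.
exact: continuous_measurable_rV.
Qed.

Let cell_mass m w j x : cell m w j x -> (\int[mu]_(y in cell m w j) (th m y)%:E <= massE m (w, x))%E.
Proof.
move=> jx; rewrite integral_mkcond; apply: ge0_le_integral => //.
- by move=> y _; rewrite patchE; case: ifP => // _; rewrite lee_fin.
- apply/measurable_restrict => //; rewrite setTI.
  by apply/measurable_EFinP; exact: measurable_funS (mth m).
- by apply/measurable_EFinP; exact: mkern_wx.
move=> y _; rewrite patchE; case: ifPn => [|_]; last by rewrite lee_fin.
rewrite inE => jy; rewrite lee_fin /kern /= indicE mem_set ?mul1r// => i /=.
have /andP[x1 x2] := jx i; have /andP[y1 y2] := jy i.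
move: x2 y2; rewrite !intrD !mulrDl !mul1r => x2 y2.
by rewrite ler_norml; apply/andP; split; lra.
Qed.

(** [psi_theta] integrated over the cell bounds its mass [c] by the integrals [a] of [theta] and [b]
    of [psi]. Then [a] is replaced by [mass m (w, x)], which is at least [a] for every [x] of the
    cell. *)
Let cell_moment m w j : (mu (cell m w j) `^ q <=
  (2 `^ q)%:E * \int[mu]_(x in cell m w j) (ps m x * mass m (w, x) `^ (q - 1))%:E)%E.
Proof.
have q0 : 0 < q by rewrite (lt_trans _ q1).
have pq0 : 0 < q - 1 by rewrite subr_gt0.
set S := cell m w j; have mS : measurable S by exact: mcell.
have I0 : (0 <= \int[mu]_(x in S) (ps m x * mass m (w, x) `^ (q - 1))%:E)%E.
  by apply: integral_ge0 => x _; rewrite lee_fin mulr_ge0// powR_ge0.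
have cE : mu S = (fine (mu S))%:E by rewrite fineK// fin_num_measure.
have [c0|cn0] := eqVneq (fine (mu S)) 0.
  by rewrite cE c0 poweR_EFin powR0 ?gt_eqF// mule_ge0// lee_fin powR_ge0.
set c := fine (mu S) in cE cn0.
have c0 : 0 < c by rewrite lt_neqAle eq_sym cn0 fine_ge0.
have mEth : measurable_fun S (fun y => (th m y)%:E : \bar R).
  by apply/measurable_EFinP; exact: measurable_funS (mth m).
have mEps : measurable_fun S (fun y => (ps m y)%:E : \bar R).
  by apply/measurable_EFinP; exact: measurable_funS (mps m).
have [B psB] := psi_le mu q1 (alpha * t') m.
have B1 : 1 <= B by rewrite (le_trans (psi_ge1 mu q (alpha * t') m 0) (psB 0)).
have B0 : 0 < B by exact: lt_le_trans B1.
have finE (f : 'rV[R]_N -> R) M : (forall y, 0 <= f y <= M) ->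
    measurable_fun S (fun y => (f y)%:E : \bar R) ->
    (\int[mu]_(y in S) (f y)%:E = (fine (\int[mu]_(y in S) (f y)%:E))%:E)%E.
  move=> fM mf; rewrite fineK// ge0_fin_numE; last first.
    by apply: integral_ge0 => y _; rewrite lee_fin; case/andP: (fM y).
  apply: (@le_lt_trans _ _ (\int[mu]_(y in S) (cst M%:E) y)%E).
    apply: ge0_le_integral => //.
    - by move=> y _; rewrite lee_fin; case/andP: (fM y).
    - by move=> y _; rewrite lee_fin; case/andP: (fM y).
  rewrite integral_cst// (_ : _ S = c%:E)//.
  by rewrite -EFinM ltry.
have aE := finE (th m) 1 (fun y => introT andP (conj (th0 m y) (theta_le1 _ q1 _ _ _))) mEth.
have bE := finE (ps m) B (fun y => introT andP (conj (ps0 m y) (psB y))) mEps.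
set a := fine _ in aE; set b := fine _ in bE.
(* The bound [B] on [psi] keeps [theta] away from 0; without [0 < a] the threshold [l] would not be
   positive. *)
have a_gt0 : 0 < a.
  pose u := B `^ (- (q - 1)^-1); have u0 : 0 < u by exact: powR_gt0.
  have uth y : u <= th m y.
    rewrite /u /th /theta !powRN lef_pV2 ?posrE ?powR_gt0//; last first.
      exact: lt_le_trans (psi_ge1 mu q (alpha * t') m y).
    by rewrite ge0_ler_powR ?nnegrE ?invr_ge0 ?(ltW pq0) ?(ltW B0) ?psB//; exact: ps0.
  rewrite (@lt_le_trans _ _ (u * c)) ?mulr_gt0// -lee_fin -aE EFinM -cE.
  rewrite -integral_cst//.
  by apply: ge0_le_integral => // y _; rewrite lee_fin// ltW.
(* This makes [a / l] equal to [c / 2], which is absorbed by the left-hand side. *)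
pose l := 2 * a / c; have l0 : 0 < l by rewrite divr_gt0// mulr_gt0.
have main : c <= a / l + l `^ (q - 1) * b.
  rewrite -lee_fin -cE EFinD [(a / l)%:E]EFinM muleC [(_ * b)%:E]EFinM -aE -bE.
  rewrite -ge0_integralZl_EFin ?invr_ge0 ?(ltW l0)//; last by move=> y _; rewrite lee_fin.
  rewrite -ge0_integralZl_EFin ?powR_ge0//; last by move=> y _; rewrite lee_fin.
  rewrite -ge0_integralD//; last 4 first.
  - by move=> y _; rewrite lee_fin mulr_ge0 ?invr_ge0// ltW.
  - by apply: emeasurable_funM.
  - by move=> y _; rewrite lee_fin mulr_ge0 ?powR_ge0.
  - by apply: emeasurable_funM.
  rewrite -[leLHS]mul1e -integral_cst//.
  apply: ge0_le_integral => //.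
  - by apply: emeasurable_funD; exact: emeasurable_funM.
  - move=> y _; rewrite -!EFinM -EFinD lee_fin mulrC.
    exact: psi_theta.
have cab : c `^ q <= 2 `^ q * (a `^ (q - 1) * b).
  have al : a / l = c / 2 by rewrite /l; field; rewrite !gt_eqF.
  move: main; rewrite al => main.
  have half : c / 2 <= l `^ (q - 1) * b by lra.
  have lE : l `^ (q - 1) * c `^ (q - 1) = 2 `^ (q - 1) * a `^ (q - 1).
    rewrite -powRM ?(ltW l0) ?(ltW c0)// /l divfK// powRM//; exact: ltW.
  have cq : c `^ q = c `^ (q - 1) * c by rewrite -powR_pred ?gt_eqF// ltW.
  have q2 : 2 `^ q = 2 `^ (q - 1) * 2 :> R by rewrite -powR_pred ?gt_eqF.
  have h := ler_wpM2l (powR_ge0 c (q - 1)) half.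
  rewrite cq q2 (_ : _ * c = 2 * (c `^ (q - 1) * (c / 2))); last by field.
  rewrite (le_trans (ler_wpM2l _ h))// le_eqVlt; apply/orP; left; apply/eqP.
  rewrite (_ : c `^ (q - 1) * (l `^ (q - 1) * b) = l `^ (q - 1) * c `^ (q - 1) * b); last by ring.
  by rewrite lE; ring.
rewrite cE poweR_EFin; apply: (@le_trans _ _ ((2 `^ q)%:E * ((a `^ (q - 1))%:E * b%:E))%E).
  by rewrite -!EFinM lee_fin.
rewrite lee_wpmul2l ?lee_fin ?powR_ge0// -bE -ge0_integralZl_EFin ?powR_ge0//; last first.
  by move=> y _; rewrite lee_fin.
apply: ge0_le_integral => //.
- by move=> y _; rewrite mule_ge0// lee_fin ?powR_ge0.
- exact: emeasurable_funM.
- apply/measurable_EFinP; apply: measurable_funM; first exact: measurable_funS (mps m).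
  apply: (measurableT_comp (measurable_powR _)); exact: measurable_funS (mmass_x m w).
move=> x Sx; rewrite -EFinM lee_fin mulrC ler_wpM2l//.
rewrite ge0_ler_powR ?nnegrE ?(ltW pq0) ?(ltW a_gt0)//.
by rewrite -lee_fin -aE -massEE; exact: cell_mass.
Qed.

Let mesh_moment_mass m w (nu : probability (borel_rV R D) R) :
  (nu : set _ -> \bar R) = image_measure mu (X w) ->
  (mesh_moment nu q (rad m) <=
   (2 `^ q)%:E * \int[mu]_x (ps m x * mass m (w, x) `^ (q - 1))%:E)%E.
Proof.
move=> nuE; rewrite /mesh_moment.
under eq_esum => j _ do rewrite nuE.
apply: (le_trans (le_esum (fun j _ => cell_moment m w j))).
have f0 x : 0 <= ps m x * mass m (w, x) `^ (q - 1) by rewrite mulr_ge0// powR_ge0.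
rewrite esumZl ?powR_ge0//; last by move=> j; apply: integral_ge0 => x _; rewrite lee_fin.
rewrite lee_wpmul2l ?lee_fin ?powR_ge0//.
apply: esum_integral_le => //.
- by move=> i j x; exact: mesh_cube_inj.
- apply/measurable_EFinP; apply: measurable_funM => //.
  exact: (measurableT_comp (measurable_powR _) (mmass_x m w)).
Qed.

(** The power [q - 1] of the mass, measured in units of [s m], is at most 1 plus an integer power.
    Averaging over [w] at fixed [x] leaves [ps m x] as a factor, whose integral is at most
    [1 + C2]. *)
Lemma lower_gdim_fbm_ge (C2 t2 : R) : 0 < t2 < t -> alpha <= 1 ->
  (forall m, \sum_(k < m) rho k `^ (- (alpha * t') * (q - 1)) * mesh_momentR mu q (rho k) <= C2) ->
  {ae P, forall w, forall nu : probability (borel_rV R D) R,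
    (nu : set _ -> \bar R) = image_measure mu (X w) -> (t2%:E <= lower_gdim q nu)%E}.
Proof.
move=> /andP[t20 t2t] al1 C2P.
have pq0 : 0 < q - 1 by rewrite subr_gt0.
pose n := (Num.trunc (q - 1)).+1.
have nq : q - 1 <= n%:R by rewrite ltW// truncnS_gt.
have [C C0 CP] := mass_moment n.
have C20 : 0 <= C2 by rewrite (le_trans _ (C2P 0%N))// big_ord0.
pose s m := rho m `^ (alpha * t); have s0 m : 0 < s m by exact: powR_gt0.
pose f m (u : T * borel_rV R N) : R := ps m u.2 * (1 + (s m ^+ n)^-1 * mass m u ^+ n).
have f0 m u : 0 <= f m u.
  by rewrite mulr_ge0// addr_ge0// mulr_ge0 ?invr_ge0 ?exprn_ge0// ltW.
have mf m : measurable_fun setT (f m).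
  apply: measurable_funM; first exact: measurableT_comp (mps m) measurable_snd.
  by apply: measurable_funD => //; apply: measurable_funM => //; exact: measurable_funX.
(* Normalized so that [g m w <= 1] gives the moment bound of exponent [t2] at mesh size [rad m] with
   constant 1. *)
pose c m : R := 2 `^ q * s m `^ (q - 1) * rho m `^ (- (alpha * t2 * (q - 1))).
have c0 m : 0 <= c m by rewrite !mulr_ge0// powR_ge0.
pose g m w := ((c m)%:E * \int[mu]_x (f m (w, x))%:E)%E.
have If0 m w : (0 <= \int[mu]_x (f m (w, x))%:E)%E by apply: integral_ge0 => x _; rewrite lee_fin.
have mIf m : measurable_fun [set: T] (fun w => \int[mu]_x (f m (w, x))%:E)%E.
  have := @measurable_fun_fubini_tonelli_F _ _ T (borel_rV R N) R mu (fun u => (f m u)%:E).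
  by apply; [exact/measurable_EFinP|move=> u; rewrite lee_fin].
pose e : R := 2^-1 `^ (alpha * (t - t2) * (q - 1)).
have e01 : 0 <= e < 1.
  rewrite powR_ge0/= (@lt_le_trans _ _ (1 `^ (alpha * (t - t2) * (q - 1))))//; last by rewrite powR1.
  by rewrite gt0_ltr_powR ?nnegrE ?mulr_gt0 ?subr_gt0// invf_lt1//; lra.
have fC m x : (\int[P]_w (f m (w, x))%:E <= (1 + C)%:E * (ps m x)%:E)%E.
  rewrite (eq_integral (fun w => ((ps m x)%:E *
    (1%:E + ((s m ^+ n)^-1)%:E * (mass m (w, x) ^+ n)%:E))%E)); last by [].
  rewrite ge0_integralZl_EFin//; last 2 first.
  - by move=> w _; rewrite adde_ge0// mule_ge0// lee_fin ?invr_ge0 ?exprn_ge0// ltW.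
  - apply: emeasurable_funD => //; apply: emeasurable_funM => //.
    by apply/measurable_EFinP; apply: measurable_funX; exact: mmass_w.
  rewrite muleC lee_wpmul2r ?lee_fin//.
  have mmn : measurable_fun [set: T] (fun w => (mass m (w, x) ^+ n)%:E : \bar R).
    by apply/measurable_EFinP; apply: measurable_funX; exact: mmass_w.
  rewrite ge0_integralD//; last 2 first.
  - by move=> w _; rewrite mule_ge0// lee_fin ?invr_ge0 ?exprn_ge0// ltW.
  - exact: emeasurable_funM.
  rewrite integral_cst//= mul1e probability_setT EFinD leeD2l//.
  have sn0 : 0 < s m ^+ n by rewrite exprn_gt0.
  rewrite ge0_integralZl_EFin ?invr_ge0 ?(ltW sn0)//; last first.
    by move=> w _; rewrite lee_fin exprn_ge0.
  apply: (@le_trans _ _ (((s m ^+ n)^-1)%:E * (C * s m ^+ n)%:E)%E).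
    by rewrite lee_wpmul2l ?lee_fin ?invr_ge0 ?(ltW sn0)//; exact: CP.
  by rewrite -EFinM lee_fin mulrCA mulVf ?mulr1// gt_eqF.
have gC m : (\int[P]_w g m w <= (2 `^ q * ((1 + C) * (1 + C2)) * e ^+ m)%:E)%E.
  rewrite ge0_integralZl_EFin//.
  rewrite (@fubini_tonelli _ _ T (borel_rV R N) R P mu (fun u => (f m u)%:E)); last 2 first.
  - exact/measurable_EFinP.
  - by move=> u; rewrite lee_fin.
  apply: (@le_trans _ _ ((c m)%:E * ((1 + C)%:E * (1 + C2)%:E))%E).
    rewrite lee_wpmul2l ?lee_fin//.
    apply: (@le_trans _ _ (\int[mu]_x ((1 + C)%:E * (ps m x)%:E))%E).
      apply: ge0_le_integral => //.
      - by move=> x _; apply: integral_ge0 => w _; rewrite lee_fin.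
      - have := @measurable_fun_fubini_tonelli_G _ _ T (borel_rV R N) R P (fun u => (f m u)%:E).
        by apply; [exact/measurable_EFinP|move=> u; rewrite lee_fin].
      - by apply: emeasurable_funM => //; exact/measurable_EFinP.
    rewrite ge0_integralZl_EFin ?addr_ge0//; last 2 first.
    - by move=> x _; rewrite lee_fin.
    - exact/measurable_EFinP.
    rewrite lee_wpmul2l ?lee_fin ?addr_ge0// (le_trans (integral_psi mu q1 _ m))//.
    by rewrite lee_fin lerD2l; exact: C2P.
  rewrite -!EFinM lee_fin le_eqVlt; apply/orP; left; apply/eqP.
  have -> : e ^+ m = s m `^ (q - 1) * rho m `^ (- (alpha * t2 * (q - 1))).
    rewrite /e -powR_exprC ?invr_ge0// -/(rho m) /s -powRrM -powRD; last first.
      by rewrite (gt_eqF (rho0 m)) implybT.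
    by congr (_ `^ _); ring.
  by rewrite /c; ring.
have H : {ae P, forall w, \forall m \near \oo, (g m w <= 1)%E}.
  apply: (ae_eventually_le1 _ _ _ e01 gC).
  - by move=> m; exact: emeasurable_funM.
  - by move=> m w; apply: mule_ge0; [rewrite lee_fin; exact: c0|exact: If0].
  - by rewrite !mulr_ge0 ?addr_ge0// powR_ge0.
apply: filterS H => w Hw nu nuE.
(* [alpha <= 1] keeps the ratio of consecutive mesh sizes [rad m] at least 1/2, as the comparison
   along geometric sequences demands. *)
have b12 : (2^-1 : R) <= 2^-1 `^ alpha < 1.
  apply/andP; split; first by rewrite ger1_powR// invr_gt0//=; lra.
  rewrite (@lt_le_trans _ _ (1 `^ alpha))//; last by rewrite powR1.
  by rewrite gt0_ltr_powR ?nnegrE// invf_lt1//; lra.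
apply: (lower_gdim_ge_seq q1 b12 (ltW t20) ler01).
apply: filterS Hw => m gm; rewrite mul1r.
have radE : (2^-1 `^ alpha) ^+ m = rad m by rewrite /rad /rho powR_exprC ?invr_ge0.
rewrite radE -lee_fin -mesh_momentE//.
apply: (le_trans (mesh_moment_mass m nuE)).
have -> : rad m `^ (t2 * (q - 1)) = (rho m `^ (- (alpha * t2 * (q - 1))))^-1.
  by rewrite powRN invrK /rad -powRrM mulrA.
set rr := rho m `^ _; have rr0 : 0 < rr by exact: powR_gt0.
apply: (@le_trans _ _ ((2 `^ q * s m `^ (q - 1))%:E * \int[mu]_x (f m (w, x))%:E)%E).
  rewrite EFinM -muleA lee_wpmul2l ?lee_fin ?powR_ge0//.
  rewrite -ge0_integralZl_EFin ?powR_ge0//; last 2 first.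
  - by move=> x _; rewrite lee_fin.
  - apply/measurable_EFinP; exact: (measurableT_comp (mf m) (pair1_measurable w)).
  apply: ge0_le_integral => //.
  - by move=> x _; rewrite lee_fin mulr_ge0// powR_ge0.
  - apply/measurable_EFinP; apply: measurable_funM => //.
    exact: (measurableT_comp (measurable_powR _) (mmass_x m w)).
  - apply: emeasurable_funM => //.
    apply/measurable_EFinP; exact: (measurableT_comp (mf m) (pair1_measurable w)).
  move=> x _; rewrite -EFinM lee_fin /f/= mulrCA ler_wpM2l//.
  set A := mass m (w, x); have A0 : 0 <= A by exact: mass0.
  pose u := A / s m; have u0 : 0 <= u by rewrite divr_ge0// ltW.
  have -> : A = s m * u by rewrite mulrC divfK ?gt_eqF.
  rewrite powRM ?(ltW (s0 m))// ler_wpM2l ?powR_ge0//.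
  rewrite exprMn mulrA mulVf ?mul1r ?gt_eqF ?exprn_gt0//.
  have [u1|u1] := leP u 1.
    rewrite (@le_trans _ _ 1)// ?lerDl ?exprn_ge0//.
    apply: (@le_trans _ _ (1 `^ (q - 1))); last by rewrite powR1.
    by rewrite ge0_ler_powR ?nnegrE// ltW.
  rewrite (@le_trans _ _ (u ^+ n))// ?lerDr//.
  by rewrite -powR_mulrn// ler_powR// ltW.
move: gm; rewrite /g /c -/rr [(_ * rr)%:E]EFinM muleAC.
move: ((2 `^ q * s m `^ (q - 1))%:E * _)%E => z.
case: z => [z| |]; [|by rewrite gt0_mulye// ?lte_fin// leye_eq|by rewrite leNye].
by rewrite -EFinM !lee_fin -[rr^-1]mul1r ler_pdivlMr.
Qed.

End lower_moment.

(** * Transfer of dimensions between the two scales, and conclusion *)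

Section gdim_transfer.
Context {R : realType} (N D : nat) (mu : probability (borel_rV R N) R) (nu : probability (borel_rV R D) R).
Context (q : R) (q1 : 1 < q) (b C : R) (b01 : 0 < b <= 1) (C0 : 0 < C).
Hypothesis comparison : \forall m \near \oo,
    mesh_momentR mu q (2^-1 ^+ m) <= C * mesh_momentR nu q ((2^-1 `^ b) ^+ m).

Let b0 : 0 < b. Proof. by case/andP: b01. Qed.
Let pq0 : 0 < q - 1. Proof. by rewrite subr_gt0. Qed.

Let base m : 0 < ((2^-1 : R) `^ b) ^+ m <= 1.
Proof.
rewrite exprn_gt0 ?powR_gt0//= exprn_ile1 ?powR_ge0//.
apply: (@le_trans _ _ (1 `^ b)); last by rewrite powR1.
by rewrite ge0_ler_powR ?nnegrE// ?(ltW b0)// invf_le1//; lra.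
Qed.

Let half12 : (2^-1 : R) <= (2^-1 : R) < 1. Proof. by rewrite lexx invf_lt1//; lra. Qed.

Lemma lower_gdim_transfer (s : R) : 0 <= s -> (s%:E < lower_gdim q nu)%E ->
  ((b * s)%:E <= lower_gdim q mu)%E.
Proof.
move=> s0 /(lower_gdim_gtP q1 s0)[C' C'0 MC'].
apply: (@lower_gdim_ge_seq _ _ mu q q1 2^-1 (b * s) (C * C')) => //.
- by rewrite mulr_ge0// ltW.
- by rewrite mulr_ge0// ltW.
apply: filterS comparison => m /le_trans; apply; rewrite -mulrA ler_wpM2l ?(ltW C0)//.
rewrite (le_trans (MC' _ (base m)))// ler_wpM2l ?(ltW C'0)// -powR_exprC ?invr_ge0//.
by rewrite -powRrM mulrA.
Qed.

Lemma upper_gdim_transfer (s : R) : 0 <= s -> (upper_gdim q mu < s%:E)%E ->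
  (upper_gdim q nu <= (s / b)%:E)%E.
Proof.
move=> s0 /(upper_gdim_ltP q1)[e /andP[e0 e1] Me].
apply: (@upper_gdim_le_seq _ _ nu q q1 (2^-1 `^ b) (s / b) C^-1).
- rewrite ger1_powR ?invr_gt0//=; last by case/andP: b01.
    rewrite (@lt_le_trans _ _ (1 `^ b))//; last by rewrite powR1.
    by rewrite gt0_ltr_powR ?nnegrE// invf_lt1//; lra.
  by rewrite invf_le1//; lra.
- by rewrite divr_ge0// ltW.
- by rewrite invr_gt0.
have rc : (2^-1 : R) ^+ m @[m --> \oo] --> (0 : R).
  by apply: cvg_expr; rewrite gtr0_norm ?invr_gt0// invf_lt1//; lra.
have /cvgrPdist_lt/(_ e e0) small := rc.
near=> m.
have r0 : 0 < (2^-1 : R) ^+ m by rewrite exprn_gt0// invr_gt0.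
rewrite ler_pdivrMl//; apply: (@le_trans _ _ (mesh_momentR mu q (2^-1 ^+ m))); last first.
  by near: m; exact: comparison.
rewrite -[(2^-1 `^ b) ^+ m]powR_exprC ?invr_ge0// -powRrM.
rewrite (_ : b * (s / b * (q - 1)) = s * (q - 1)); last by field; rewrite gt_eqF.
apply: Me; rewrite r0/= -[ltLHS]gtr0_norm// -normrN -sub0r.
by near: m.
Unshelve. all: by end_near. Qed.

End gdim_transfer.

Section fbm_gdim.
Context d {T : measurableType d} {R : realType} (P : probability T R) (N D : nat).
Context (N0 : (0 < N)%N) (alpha : R) (a01 : 0 < alpha < 1).
Context (X : T -> 'rV[R]_N -> 'rV[R]_D) (fX : fbm P alpha X).
Context (mu : probability (borel_rV R N) R) (q : R) (q1 : 1 < q).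

Let a0 : 0 < alpha. Proof. by case/andP: a01. Qed.
Let a1 : alpha < 1. Proof. by case/andP: a01. Qed.
Let pq0 : 0 < q - 1. Proof. by rewrite subr_gt0. Qed.

Let gdim_fin n (nu : probability (borel_rV R n) R) : exists l u : R,
  [/\ 0 <= l, l <= u, u <= n%:R, lower_gdim q nu = l%:E & upper_gdim q nu = u%:E].
Proof.
have := lower_gdim_ge0 nu q1; have := lower_gdim_le_upper nu q; have := upper_gdim_le_dim nu q1.
case: (upper_gdim q nu) => [u| |]; case: (lower_gdim q nu) => [l| |]//.
by rewrite !lee_fin => un lu l0; exists l, u.
Qed.

Let lower_bound (t2 b : R) : 0 < t2 < b -> b <= D%:R -> ((alpha * b)%:E <= lower_gdim q mu)%E ->
  {ae P, forall w, forall nu : probability (borel_rV R D) R,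
    (nu : set _ -> \bar R) = image_measure mu (X w) -> (t2%:E <= lower_gdim q nu)%E}.
Proof.
move=> /andP[t20 t2b] bD bL.
(* The chain [t2 < t < t' < s / alpha < b] has one gap for each estimate: Borel-Cantelli, the
   energy, the sum of the moments of [mu], and the passage strictly below [lower_gdim q mu]. *)
pose t := (t2 + b) / 2; pose t' := (t + b) / 2; pose s := alpha * ((t' + b) / 2).
have [t2t tt' t'b] : [/\ t2 < t, t < t' & t' < b] by rewrite /t' /t; split; lra.
have st' : alpha * t' < s by rewrite ltr_pM2l//; lra.
have sb : s < alpha * b by rewrite ltr_pM2l//; lra.
have s0 : 0 <= s by rewrite mulr_ge0 ?(ltW a0)//; lra.
have sL : (s%:E < lower_gdim q mu)%E by apply: lt_le_trans bL; rewrite lte_fin.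
have [C C0 MC] := lower_gdim_gtP q1 s0 sL.
pose e : R := 2^-1 `^ ((s - alpha * t') * (q - 1)).
have e0 : 0 <= e by exact: powR_ge0.
have e1 : e < 1.
  rewrite (@lt_le_trans _ _ (1 `^ ((s - alpha * t') * (q - 1))))//; last by rewrite powR1.
  by rewrite gt0_ltr_powR ?nnegrE ?mulr_gt0 ?subr_gt0// invf_lt1//; lra.
apply: (@lower_gdim_fbm_ge _ T R P N D N0 alpha a01 X fX mu q q1 t t' _ tt' (C / (1 - e)) t2).
- by rewrite (lt_trans t20)//; lra.
- by rewrite t20.
- exact: ltW.
move=> m; apply: (@le_trans _ _ (\sum_(k < m) C * e ^+ k)).
  apply: ler_sum => k _; have r0 : 0 < (2^-1 : R) ^+ k by rewrite exprn_gt0// invr_gt0.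
  have r1 : 0 < (2^-1 : R) ^+ k <= 1 by rewrite r0 exprn_ile1 ?invr_ge0// invf_le1//; lra.
  rewrite (le_trans (ler_wpM2l (powR_ge0 _ _) (MC _ r1)))// mulrCA ler_wpM2l ?(ltW C0)//.
  rewrite -powRD; last by rewrite (gt_eqF r0) implybT.
  rewrite /e -powR_exprC ?invr_ge0// le_eqVlt; apply/orP; left; apply/eqP.
  by congr (_ `^ _); ring.
rewrite -mulr_sumr ler_wpM2l ?(ltW C0)//.
have := subrX1 e m; have : 0 <= e ^+ m by rewrite exprn_ge0.
by move=> em eE; rewrite -[leRHS]mul1r ler_pdivlMr ?subr_gt0//; nra.
Qed.

(** Exponents approach their limits along this sequence, so that countably many null sets suffice.
    It stays strictly below 1, since every estimate needs a strict gap. *)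
Let approx (k : nat) : R := 1 - k.+2%:R^-1.

Let approx01 k : 0 < approx k < 1.
Proof.
rewrite /approx subr_gt0 invf_lt1// ltr1n/= ltrBlDr ltrDl invr_gt0.
by rewrite ltr0n.
Qed.

Let le_approx (x y : R) : 0 <= x -> (forall k, approx k * x <= y) -> x <= y.
Proof.
move=> x0 xy; rewrite leNgt; apply/negP => yx.
pose k := Num.trunc (x / (x - y)).
have := xy k; rewrite /approx mulrBl mul1r lerBlDr -lerBlDl; apply/negP; rewrite -ltNge.
rewrite mulrC ltr_pdivrMr// -ltr_pdivrMl ?subr_gt0// mulrC.
by rewrite (lt_trans (truncnS_gt _))// ltr_nat.
Qed.

(** Both assertions hold off a common null set. An inequality is enough for the upper dimension:
    when the dimensions of [mu] agree, the lower dimension of [nu] attains that bound. *)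
Lemma fbm_gdim_image : {ae P, forall w, forall nu : probability (borel_rV R D) R,
  (nu : set _ -> \bar R) = image_measure mu (X w) ->
  lower_gdim q nu = Order.min D%:R%:E ((alpha^-1)%:E * lower_gdim q mu)%E /\
  (upper_gdim q nu <= Order.min D%:R%:E ((alpha^-1)%:E * upper_gdim q mu))%E}.
Proof.
have [l [u [l0 lu uN lE uE]]] := gdim_fin mu.
pose b := Num.min D%:R (alpha^-1 * l).
have b0 : 0 <= b by rewrite le_min ler0n mulr_ge0// invr_ge0 ltW.
have HL : {ae P, forall w, forall k, forall nu : probability (borel_rV R D) R,
    (nu : set _ -> \bar R) = image_measure mu (X w) -> ((approx k * b)%:E <= lower_gdim q nu)%E}.
  apply: ae_foralln => k; have /andP[k0 k1] := approx01 k.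
  (* [lower_bound] requires a positive exponent; for [b = 0] the claim is that dimensions are
     nonnegative. *)
  have [->|bn0] := eqVneq b 0.
    by apply: aeW => w nu _; rewrite mulr0; exact: lower_gdim_ge0.
  have b_gt0 : 0 < b by rewrite lt_neqAle eq_sym bn0.
  apply: (@lower_bound _ b).
  - by rewrite mulr_gt0//= gtr_pMl.
  - by rewrite ge_min lexx.
  - by rewrite lE lee_fin -ler_pdivlMl// ge_min lexx orbT.
have HU : {ae P, forall w, forall k, forall nu : probability (borel_rV R D) R,
    (nu : set _ -> \bar R) = image_measure mu (X w) ->
    exists2 C : R, 0 < C & \forall m \near \oo, mesh_momentR mu q (2^-1 ^+ m) <=
      C * mesh_momentR nu q ((2^-1 `^ (approx k * alpha)) ^+ m)}.
  apply: ae_foralln => k; have /andP[k0 k1] := approx01 k.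
  apply: (upper_comparison a01 fX mu q1); rewrite mulr_gt0//=.
  by rewrite gtr_pMl.
apply: filterS2 HL HU => w HL HU nu nuE.
have [ln [un [ln0 lnun unD lnE unE]]] := gdim_fin nu.
have lb : b <= ln.
  by apply: le_approx => // k; have := HL k nu nuE; rewrite lnE lee_fin.
have beta01 k : 0 < approx k * alpha <= 1.
  have /andP[k0 k1] := approx01 k.
  by rewrite mulr_gt0//= ltW// (lt_trans _ a1)// gtr_pMl.
have lU : ln <= alpha^-1 * l.
  rewrite ler_pdivlMl//; apply: le_approx; first by rewrite mulr_ge0// ltW.
  move=> k; have [C C0 cmp] := HU k nu nuE.
  (* The first approximation lets the path exponent tend to [alpha]; this second one is there
     because the transfer starts strictly below [lower_gdim q nu]. *)
  apply: le_approx; first by rewrite !mulr_ge0 ?(ltW a0)//; case/andP: (approx01 k) => /ltW.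
  move=> j; have [->|lnn0] := eqVneq ln 0; first by rewrite !mulr0.
  have ln_gt0 : 0 < ln by rewrite lt_neqAle eq_sym lnn0.
  have /andP[j0 j1] := approx01 j.
  have := @lower_gdim_transfer R N D mu nu q q1 _ C (beta01 k) C0 cmp (approx j * ln).
  rewrite lnE lE !lee_fin lte_fin mulr_ge0 ?(ltW j0)// gtr_pMl// => /(_ isT j1).
  by rewrite (_ : approx j * (approx k * (alpha * ln)) = approx k * alpha * (approx j * ln))//; ring.
have uU : un <= alpha^-1 * u.
  rewrite ler_pdivlMl//; apply: le_approx; first by rewrite mulr_ge0 ?(ltW a0)// (le_trans ln0).
  move=> k; have [C C0 cmp] := HU k nu nuE.
  rewrite leNgt; apply/negP => uk.
  (* The midpoint lies above [upper_gdim q mu], as the transfer requires, and still contradicts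
     [uk]. *)
  pose s := (u + approx k * (alpha * un)) / 2.
  have us : u < s by rewrite /s; lra.
  have su : s < approx k * (alpha * un) by rewrite /s; lra.
  have s0 : 0 <= s by rewrite (le_trans _ (ltW us))// (le_trans l0).
  have := @upper_gdim_transfer R N D mu nu q q1 _ C (beta01 k) C0 cmp s s0.
  rewrite uE unE lte_fin lee_fin => /(_ us); have /andP[bk _] := beta01 k.
  by rewrite ler_pdivlMr// leNgt mulrC -mulrA su.
have minE (x : R) : Order.min D%:R%:E ((alpha^-1)%:E * x%:E)%E = (Num.min D%:R (alpha^-1 * x))%:E.
  by rewrite -EFinM -EFin_min.
rewrite lE uE lnE unE !minE; split.
  congr EFin; apply/eqP; rewrite eq_le lb andbT le_min lU andbT.
  exact: le_trans unD.
by rewrite lee_fin le_min unD uU.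
Qed.

End fbm_gdim.

Unset Implicit Arguments.

Theorem corollary2 (R : realType) (disp : measure_display)
    (T : measurableType disp) (P : probability T R)
    (N d : nat) (N_gt0 : (0 < N)%N) (d_gt0 : (0 < d)%N)
    (alpha : R) (alpha_gt0 : 0 < alpha) (alpha_lt1 : alpha < 1)
    (X : T -> 'rV[R]_N -> 'rV[R]_d) (X_fbm : fbm P alpha X)
    (mu : probability (borel_rV R N) R) (mu_supp : compact (msupport mu))
    (q : R) (q_gt1 : 1 < q) :
  {ae P, forall w, lower_gdim q (image_measure mu (X w)) =
                   Order.min (d%:R%:E) ((alpha^-1)%:E * lower_gdim q mu)%E} /\
  (gdim_exists q mu ->
    {ae P, forall w, gdim_exists q (image_measure mu (X w))} /\
    {ae P, forall w, gdim q (image_measure mu (X w)) =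
                     Order.min (d%:R%:E) ((alpha^-1)%:E * gdim q mu)%E}).
Proof.
have a01 : 0 < alpha < 1 by rewrite alpha_gt0.
have H := fbm_gdim_image N_gt0 a01 X_fbm mu q_gt1.
have L : {ae P, forall w, lower_gdim q (image_measure mu (X w)) =
    Order.min (d%:R%:E) ((alpha^-1)%:E * lower_gdim q mu)%E}.
  apply: filterS H => w Hw; have [_ _ /(_ w) Xw] := X_fbm.
  by have [nu nuE] := image_probability mu Xw; rewrite -nuE; have [] := Hw nu nuE.
split=> // mu_ex; split=> //.
apply: filterS H => w Hw; have [_ _ /(_ w) Xw] := X_fbm.
have [nu nuE] := image_probability mu Xw; have [lE uU] := Hw nu nuE.
(* As the two dimensions of [mu] agree, the bound for the upper dimension of [nu] is exactly its
   lower dimension. *)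
rewrite -nuE /gdim_exists; apply/eqP; rewrite eq_le lower_gdim_le_upper/=.
by rewrite lE mu_ex.
Qed.
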